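(* Let $(a_n)_{n\geq0}$ be complex coefficients, and consider a series $\sum_{n=0}^\infty a_n\phi_n(z)$ with sections $f_n(z)=\sum_{k=0}^n a_k\phi_k(z)$, $n\in\mathbb{N}_0$, of one of the following four types, with associated growth exponents $\lambda_n$, function $\omega:\mathbb{C}\to[0,\infty)$ and number $\rho\in[0,\infty]$: (1) General Dirichlet series: $\phi_n(z)=e^{-\lambda_n z}$, where $\lambda_0<\lambda_1<\cdots<\lambda_n\to\infty$ are given real numbers, and the series is assumed to have abscissa of absolute convergence $\sigma_a<\infty$; growth exponents $\lambda_n$; $\omega(z)=\exp(-\operatorname{Re}z)$; $\rho^{-1}=e^{\sigma_c}$, where $\sigma_c$ is the abscissa of convergence. (2) Power series: $\phi_n(z)=z^n$; $\lambda_n=n$; $\omega(z)=|z|$; $\rho^{-1}=\limsup_{n\to\infty}|a_n|^{1/n}$. (3) Neumann series: $\phi_n(z)=J_n(z)$; $\lambda_n=n$; $\omega(z)=|z|$; $\rho^{-1}=\limsup_{n\to\infty}\frac{e}{2n}|a_n|^{1/n}$. (4) Kapteyn series: $\phi_n(z)=J_n(nz)$; $\lambda_n=n$; $\omega(z)=\Omega(z)$; $\rho^{-1}=\limsup_{n\to\infty}|a_n|^{1/n}$. Assume $0<\rho<\infty$. Then, in each of the four cases, $\omega$ is a proper height function, $(\lambda_n)$ is an admissible sequence of growth exponents for $(f_n)$, $\rho$ is the convergence level of $(f_n)$ for $\omega$, and, with $D_\rho=\{z:\omega(z)<\rho\}$ and $\mu(z)=\limsup_{n\to\infty}|f_n(z)|^{1/\lambda_n}$: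 (i) the sections $f_n$ converge compactly in $D_\rho$ to a non-constant holomorphic function $f$; (ii) the growth function satisfies $$\mu(z)=\max\left(1,\rho^{-1}\omega(z)\right)$$ unless (a) $f_n(z)\to0$ and $\omega(z)\leq\rho$, or (b) the series is a Kapteyn series and $z\in S$. Hence, in all cases, $\{\omega>\rho\}\subset\{\mu>1\}\cup\{\omega=1\}$, every point of $\partial D_\rho$ is a cluster point of zeros of the $f_n$, and $D_\rho$ is the maximal open set in which $(f_n)$ converges pointwise (every open set on which $(f_n)$ converges pointwise is contained in $D_\rho$).
   Context: $J_n$ denotes the Bessel function of the first kind of order $n$. Conventions $1/0=\infty$, $1/\infty=0$, $e^{-\infty}=0$, $e^{\infty}=\infty$ are used in defining $\rho$. The abscissa of convergence $\sigma_c\in[-\infty,\infty]$ of $\sum_n a_ne^{-\lambda_nz}$ is the number such that the series converges for $\operatorname{Re}z>\sigma_c$ and diverges for $\operatorname{Re}z<\sigma_c$; the abscissa of absolute convergence $\sigma_a$ is the abscissa of convergence of $\sum_n|a_n|e^{-\lambda_nz}$. (Ordinary Dirichlet series $\sum_{n\ge1}a_nn^{-z}$ correspond to $a_0=0$, $\lambda_n=\log n$ for $n\geq1$.) $S:=\{x\in\mathbb{R}:|x|\geq1\}$, and $\Omega:\mathbb{C}\to[0,\infty)$ is $$\Omega(z):=\left|\frac{z\exp\sqrt{1-z^2}}{1+\sqrt{1-z^2}}\right|,$$ defined by the principal branch of the square root for $z\notin S$ and by continuity for $z\in S$; on $S$ both signs of the square root give the same value, namely $\Omega|_S\equiv1$.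 Proper height function: a continuous function $\omega:\mathbb{C}\to[0,\infty)$ such that the open sublevel sets $D_r:=\{\omega<r\}$ are nonempty for all $r>0$ and there are no local maxima of positive height, that is, equivalently, $\overline{\{\omega>r\}}=\{\omega\geq r\}$ for all $r>0$. Convergence level of $(f_n)$ for $\omega$: $\sup\{r>0:f_n\text{ converges compactly on }D_r\}$ ($0$ if there is no such $D_r$, $\infty$ if there is convergence in all $D_r$). ''Converges compactly'' means converges uniformly on compact subsets. Admissible growth exponents: a strictly increasing real sequence $\lambda_n\to\infty$ is an admissible sequence of growth exponents for $(f_n)$ if for every compact $K\subset\mathbb{C}$ one has $\limsup_{n\to\infty}\max_{z\in K}|f_n(z)|^{1/\lambda_n}\leq c(K)<\infty$ for some constant $c(K)$. (Only large $n$, for which $\lambda_n>0$, matter.) The growth function of $(f_n)$ is then $\mu(z)=\limsup_{n\to\infty}|f_n(z)|^{1/\lambda_n}$. A point $z_0$ is a cluster point of zeros of the $f_n$ if for every open neighborhood $U$ of $z_0$ and every $n_0$ there is some $n\geq n_0$ such that $f_n$ has a zero in $U$. *)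

(* Defs.v *)
(* The complex plane is R[i], over an arbitrary R : realType. *)
From HB Require Import structures.
From mathcomp Require Import all_boot all_order all_algebra.
From mathcomp Require Import complex.
From mathcomp Require Import ring lra.
From mathcomp Require Import all_classical all_reals all_analysis.

Set Implicit Arguments.
Unset Strict Implicit.
Unset Printing Implicit Defensive.

Import Order.TTheory GRing.Theory Num.Theory.
Import numFieldNormedType.Exports.
Import ComplexField.Normc.

Local Open Scope classical_set_scope.
Local Open Scope complex_scope.
Local Open Scope ring_scope.

(* The library gives R[i]^o the topology of the complex modulus and the
   structure of a normed module over R[i]; transport it to R[i] itself.  In
   particular [derivable f z 1], for f : R[i] -> R[i], is complex
   differentiability at z. *)
HB.instance Definition _ (R : realType) :=
  PseudoPointedMetric.copy R[i] R[i]^o.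
HB.instance Definition _ (R : realType) := GRing.ComAlgebra.copy R[i] R[i]^o.
HB.instance Definition _ (R : realType) := Vector.copy R[i] R[i]^o.
HB.instance Definition _ (R : realType) := NormedModule.copy R[i] R[i]^o.

Definition cexp (R : realType) (z : R[i]) : R[i] :=
  (expR (complex.Re z))%:C * (cos (complex.Im z) +i* sin (complex.Im z)).

Definition besselJ (R : realType) (n : nat) (z : R[i]) : R[i] :=
  limn (series (fun k : nat =>
    (-1) ^+ k / (k`! * (n + k)`!)%:R * (z / 2) ^+ (2 * k + n))).

Definition realS (R : realType) : set R[i] :=
  [set z | complex.Im z = 0 /\ 1 <= `|complex.Re z|].

(* [sqrtc] is the principal square root; off realS the number 1 - z^2 is not in
   ]-oo, 0], and on realS the formula takes the value 1 for either root (Omega_S,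
   Omega_S_opp below), which is the continuous extension. *)
Definition Omega (R : realType) (z : R[i]) : R :=
  normc (z * cexp (sqrtc (1 - z ^+ 2)) / (1 + sqrtc (1 - z ^+ 2))).

Definition is_holomorphic (R : realType) (D : set R[i]) (f : R[i] -> R[i]) :=
  forall z, D z -> derivable f z 1.

Definition is_constant (R : realType) (D : set R[i]) (f : R[i] -> R[i]) :=
  exists c, forall z, D z -> f z = c.

Definition sublevel (R : realType) (w : R[i] -> R) (r : R) : set R[i] :=
  [set z | w z < r].

Definition boundary (T : topologicalType) (A : set T) : set T :=
  closure A `\` interior A.

Definition no_positive_local_max (R : realType) (w : R[i] -> R) :=
  forall z, 0 < w z -> ~ (\forall x \near z, w x <= w z).

Definition proper_height (R : realType) (w : R[i] -> R) :=
  [/\ forall z, 0 <= w z,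
      continuous w,
      forall r, 0 < r -> sublevel w r !=set0
    & no_positive_local_max w].

Definition compact_cvg (R : realType) (f : nat -> R[i] -> R[i]) (D : set R[i])
    (g : R[i] -> R[i]) :=
  {family compactly_in D, f @ \oo --> g}.

(* The outer maximum gives the value 0 when there is no such r. *)
Definition convergence_level (R : realType) (f : nat -> R[i] -> R[i])
    (w : R[i] -> R) : \bar R :=
  maxe 0%E (ereal_sup [set r%:E | r in
    [set r : R | 0 < r /\ exists g, compact_cvg f (sublevel w r) g]]).

(* The real number |f_n(z)|^(1/lambda_n); only large n, for which
   lambda_n > 0, matter below.  Note that 0 `^ x = 0 for x != 0. *)
Definition nth_growth (R : realType) (f : nat -> R[i] -> R[i])
    (lam : nat -> R) (z : R[i]) (n : nat) : R :=
  normc (f n z) `^ (lam n)^-1.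

Definition increasing_to_infinity (R : realType) (lam : nat -> R) :=
  {homo lam : m n / (m < n)%N >-> m < n} /\ lam @ \oo --> +oo.

Definition admissible_exponents (R : realType) (f : nat -> R[i] -> R[i])
    (lam : nat -> R) :=
  increasing_to_infinity lam /\
  forall K : set R[i], compact K -> exists c : R,
    (limn_esup (fun n => ereal_sup [set (nth_growth f lam z n)%:E | z in K])
       <= c%:E)%E.

Definition growth_function (R : realType) (f : nat -> R[i] -> R[i])
    (lam : nat -> R) (z : R[i]) : \bar R :=
  limn_esup (fun n => (nth_growth f lam z n)%:E).

Definition zero_cluster_point (R : realType) (f : nat -> R[i] -> R[i])
    (z0 : R[i]) :=
  forall U : set R[i], open U -> U z0 -> forall n0 : nat,
    exists n : nat, (n0 <= n)%N /\ exists z, U z /\ f n z = 0.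

Definition pointwise_cvg (R : realType) (f : nat -> R[i] -> R[i])
    (U : set R[i]) :=
  forall z, U z -> cvgn (fun n => f n z).

Inductive series_type (R : realType) : Type :=
| Dirichlet of (nat -> R)
| Power
| Neumann
| Kapteyn.

Arguments Power {R}.
Arguments Neumann {R}.
Arguments Kapteyn {R}.

Definition basis (R : realType) (t : series_type R) (n : nat) (z : R[i]) :
    R[i] :=
  match t with
  | Dirichlet lam => cexp (- (lam n)%:C * z)
  | Power => z ^+ n
  | Neumann => besselJ n z
  | Kapteyn => besselJ n (n%:R * z)
  end.

Definition exponents (R : realType) (t : series_type R) (n : nat) : R :=
  if t is Dirichlet lam then lam n else n%:R.

Definition height (R : realType) (t : series_type R) (z : R[i]) : R :=
  match t with
  | Dirichlet _ => expR (- complex.Re z)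
  | Power | Neumann => normc z
  | Kapteyn => Omega z
  end.

Definition sections (R : realType) (t : series_type R) (a : nat -> R[i])
    (n : nat) (z : R[i]) : R[i] :=
  \sum_(k < n.+1) a k * basis t k z.

Definition is_abscissa (R : realType) (lam : nat -> R) (a : nat -> R[i])
    (s : \bar R) :=
  forall z : R[i],
    ((s < (complex.Re z)%:E)%E -> cvgn (fun n => sections (Dirichlet lam) a n z))
    /\ (((complex.Re z)%:E < s)%E ->
          ~ cvgn (fun n => sections (Dirichlet lam) a n z)).

(* Here [`|a n|] is the modulus as an element of R[i]. *)
Definition is_abs_abscissa (R : realType) (lam : nat -> R) (a : nat -> R[i])
    (s : \bar R) :=
  is_abscissa lam (fun n => `|a n|) s.

Definition well_posed (R : realType) (t : series_type R) (a : nat -> R[i]) :=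
  if t is Dirichlet lam then
    increasing_to_infinity lam /\
    exists sa : \bar R, is_abs_abscissa lam a sa /\ (sa < +oo)%E
  else True.

(* [inve] and [expeR] follow the conventions 1/0 = +oo, 1/(+oo) = 0,
   e^(-oo) = 0 and e^(+oo) = +oo. *)
Definition is_rho (R : realType) (t : series_type R) (a : nat -> R[i])
    (rho : \bar R) :=
  match t with
  | Dirichlet lam =>
      exists sc : \bar R, is_abscissa lam a sc /\ (rho^-1 = expeR sc)%E
  | Power | Kapteyn =>
      (rho^-1)%E = limn_esup (fun n => (normc (a n) `^ n%:R^-1)%:E)
  | Neumann =>
      (rho^-1)%E =
      limn_esup (fun n => (expR 1 / (2 * n%:R) * normc (a n) `^ n%:R^-1)%:E)
  end.

Section SanityChecks.
Variable R : realType.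
Implicit Types (w : R[i] -> R) (z : R[i]).

Lemma no_positive_local_maxP w : continuous w ->
  no_positive_local_max w <->
  forall r, 0 < r -> closure [set z | r < w z] = [set z | r <= w z].
Proof.
move=> cw; split=> [nmax r r0|clw z wz0 zmax].
  apply/seteqP; split=> z /=.
    move=> clz; rewrite leNgt; apply/negP => wzr.
    have /clz [x [/= rx xr]] : nbhs z [set x | w x < r].
      by have := cw z _ (lt_nbhsl wzr); exact.
    by move: (lt_trans rx xr); rewrite ltxx.
  move=> rz B zB; apply: contrapT => nB.
  apply: (nmax z (lt_le_trans r0 rz)).
  near=> x; rewrite leNgt; apply/negP => zx; apply: nB.
  by exists x; split; [exact: le_lt_trans rz zx|near: x].
have : closure [set x | w z < w x] z by rewrite clw//=.
by move=> /(_ _ zmax) [x [/= zx xz]]; move: (lt_le_trans zx xz); rewrite ltxx.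
Unshelve. all: by end_near. Qed.

Lemma normc_cexp z : normc (cexp z) = expR (complex.Re z).
Proof.
rewrite /cexp normcM /= expr0n/= addr0 cos2Dsin2 sqrtr1 mulr1.
by rewrite sqrtr_sqr ger0_norm ?expR_ge0.
Qed.

Lemma Omega_root_S z (s : R[i]) : realS z -> s ^+ 2 = 1 - z ^+ 2 ->
  normc (z * cexp s / (1 + s)) = 1.
Proof.
rewrite normcM normcV normcM normc_cexp.
case: z s => x y [u v] [/= -> x1] /eqP.
have x2 : 1 <= x ^+ 2 by rewrite -(real_normK (num_real x)) exprn_ege1.
rewrite !expr2 eq_complex /= => /andP[/eqP ruv /eqP iuv].
have u0 : u = 0.
  have /eqP : u * v = 0 by lra.
  by rewrite mulf_eq0 => /orP[/eqP//|/eqP v0]; move: ruv; rewrite v0; nra.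
subst u.
rewrite expR0 mulr1 mulr0 !addr0 add0r mulr1 -!expr2.
have -> : 1 + v ^+ 2 = x ^+ 2 :> R by move: ruv; lra.
by rewrite divff// sqrtr_eq0 -ltNge; lra.
Qed.

Lemma Omega_S z : realS z -> Omega z = 1.
Proof. by move=> Sz; apply: Omega_root_S; rewrite ?sqr_sqrtc. Qed.

Lemma Omega_S_opp z : realS z ->
  let s := - sqrtc (1 - z ^+ 2) in normc (z * cexp s / (1 + s)) = 1.
Proof. by move=> Sz s; apply: Omega_root_S; rewrite ?sqrrN ?sqr_sqrtc. Qed.

End SanityChecks.

(* Main.v *)
(* Suppose that no f_n with n large vanishes near some z0 in the boundary of
   D = {w < rho}.  Near z0 we have |f_n| <= exp (C lambda_n), while |f_n| tends to the
   modulus of the nonzero limit f on a small disc inside D.  By the Borel-Caratheodory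
   inequality the Taylor coefficients of lambda_n^-1 log f_n are bounded, and small on
   the small disc; hence |f_n| <= exp (e lambda_n) for every e > 0 near z0, also at
   points with w > rho.  But there |f_n|^(1/lambda_n) has limsup w / rho > 1.

   It remains to compare phi_n with w.  In types (2), (3), (4) one has
   c / n <= |phi_n| / (beta_n w^n) <= C, where beta_n = 1, (e / 2n)^n, 1, and the growth
   of the sections is read off from the coefficients.  For Kapteyn series the upper
   bound comes from moving Bessel's integral to the circle through the saddle point, and
   the lower bound off S from a Liouville-Green estimate along the segment from 0 to z,
   on which Re (sqrt (1 - z^2)) > 0.  For Dirichlet series Abel summation is used.

   Contour integrals are replaced by averages over roots of unity, and holomorphy by
   local uniform approximation by polynomials. *)
Require Import Defs.
From mathcomp Require Import all_boot all_order all_algebra.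
From mathcomp Require Import complex ring lra zify.
From mathcomp Require Import all_classical all_reals all_analysis.

Import Order.TTheory GRing.Theory Num.Theory.
Import numFieldNormedType.Exports.
Import ComplexField.Normc.
Local Open Scope classical_set_scope.
Local Open Scope complex_scope.
Local Open Scope ring_scope.

Set Implicit Arguments.
Unset Strict Implicit.
Unset Printing Implicit Defensive.

(** * Complex modulus and averages over roots of unity *)

(** All four types are instances of [growth_theorem], whose hypotheses isolate what depends on the
    series. Its lower growth bound can only deny that |f_n| <= exp (L lambda_n) holds for all large
    n, because a limsup is reached along a subsequence; the contradiction at the boundary fits this
    form, since it makes the small bound hold for all large n at once. It compares f_n with the
    limit f at a point of D near the boundary, so f must not vanish there: hence the identity
    theorem, the connectedness of D and the proof that f is not constant. For types (2), (3), (4)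
    the last point compares a constant limit with a rapidly decaying expansion of 1; for Dirichlet
    series it compares f with its translate by 1. As n grows while the discs stay fixed, the
    constants of the quantitative lemmas are chosen before the function and before lambda_n. For
    lambda_n = n a factor 1 / n disappears in |f_n|^(1/n), so crude bounds for phi_n suffice. The
    exceptional set S matters only for the lower bound of phi_n, and its empty interior lets the
    boundary argument avoid it. *)

Lemma half_gt0 {R : realType} (e : R) : 0 < e -> 0 < e / 2.
Proof. by move=> e0; rewrite divr_gt0. Qed.

Section ComplexModulus.
Context {R : realType}.
Implicit Types (x y z : R[i]).

Local Notation Re := (@complex.Re R).
Local Notation Im := (@complex.Im R).

Lemma normcD x y : normc (x + y) <= normc x + normc y.
Proof. exact: le_normcD. Qed.

Lemma normcBC x y : normc (x - y) = normc (y - x).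
Proof. by rewrite -opprB; exact: normcN. Qed.

Lemma normcNE x : normc (- x) = normc x.
Proof. exact: normcN. Qed.

Lemma normcB x y : normc (x - y) <= normc x + normc y.
Proof. by rewrite -(normcNE y); exact: normcD. Qed.

Lemma normcBD x y z : normc (x - z) <= normc (x - y) + normc (y - z).
Proof. by rewrite -[x - z](subrKA y); exact: normcD. Qed.

Lemma normc_ge0 x : 0 <= normc x.
Proof. by case: x => a b; exact: sqrtr_ge0. Qed.

Lemma normcBl x y : normc x - normc y <= normc (x - y).
Proof. by rewrite lerBlDr; have := normcD (x - y) y; rewrite subrK. Qed.

Lemma normc_eq0 x : (normc x == 0) = (x == 0).
Proof.
by apply/eqP/eqP => [/eq0_normc//|->]; rewrite normc0.
Qed.

Lemma normc_gt0 x : (0 < normc x) = (x != 0).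
Proof. by rewrite lt_def normc_ge0 andbT normc_eq0. Qed.

Lemma normcX x n : normc (x ^+ n) = normc x ^+ n.
Proof.
by elim: n => [|n IH]; rewrite ?expr0 ?normc1// !exprS normcM IH.
Qed.

Lemma normcR (a : R) : normc a%:C = `|a|.
Proof. by rewrite /normc /= expr0n/= addr0 sqrtr_sqr. Qed.

Lemma normc_nat n : normc (n%:R : R[i]) = n%:R.
Proof.
have -> : (n%:R : R[i]) = (n%:R : R)%:C by rewrite rmorph_nat.
by rewrite normcR normr_nat.
Qed.

Lemma sqr_normc_ReIm x : normc x ^+ 2 = Re x ^+ 2 + Im x ^+ 2.
Proof. by case: x => a b /=; rewrite sqr_sqrtr// addr_ge0 ?sqr_ge0. Qed.

Lemma normc_ReIm_le x : normc x <= `|Re x| + `|Im x|.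
Proof.
rewrite -(@ler_pXn2r _ 2) ?nnegrE ?normc_ge0 ?addr_ge0// sqr_normc_ReIm sqrrD.
rewrite !real_normK ?num_real// lerD2r lerDl mulrn_wge0// mulr_ge0//.
Qed.

Lemma Re_le_normc x : `|Re x| <= normc x.
Proof.
rewrite -(@ler_pXn2r _ 2) ?nnegrE ?normc_ge0// sqr_normc_ReIm.
by rewrite real_normK ?num_real// lerDl sqr_ge0.
Qed.

Lemma Im_le_normc x : `|Im x| <= normc x.
Proof.
rewrite -(@ler_pXn2r _ 2) ?nnegrE ?normc_ge0// sqr_normc_ReIm.
by rewrite real_normK ?num_real// lerDr sqr_ge0.
Qed.

Lemma Re_le x : Re x <= normc x.
Proof. exact: le_trans (ler_norm _) (Re_le_normc x). Qed.

Lemma normc_sum (I : Type) (r : seq I) (P : pred I) (F : I -> R[i]) :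
  normc (\sum_(i <- r | P i) F i) <= \sum_(i <- r | P i) normc (F i).
Proof.
elim/big_rec2: _ => [|i y1 y2 _ le12]; first by rewrite normc0.
by apply: le_trans (normcD _ _) _; rewrite lerD2l.
Qed.

Lemma normr_normc x : `|x| = (normc x)%:C.
Proof. by case: x. Qed.

Lemma ReD x y : Re (x + y) = Re x + Re y.
Proof. by case: x y => a b []. Qed.
Lemma ImD x y : Im (x + y) = Im x + Im y.
Proof. by case: x y => a b []. Qed.
Lemma ReN x : Re (- x) = - Re x. Proof. by case: x. Qed.
Lemma ImN x : Im (- x) = - Im x. Proof. by case: x. Qed.
Lemma ReM x y : Re (x * y) = Re x * Re y - Im x * Im y.
Proof. by case: x y => a b []. Qed.
Lemma ImM x y : Im (x * y) = Re x * Im y + Im x * Re y.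
Proof. by case: x y => a b []. Qed.
Lemma ReRM (a : R) x : Re (a%:C * x) = a * Re x.
Proof. by rewrite ReM /= mul0r subr0. Qed.
Lemma ImRM (a : R) x : Im (a%:C * x) = a * Im x.
Proof. by rewrite ImM /= mul0r addr0. Qed.
Lemma Re_sum (I : Type) (r : seq I) (P : pred I) (F : I -> R[i]) :
  Re (\sum_(i <- r | P i) F i) = \sum_(i <- r | P i) Re (F i).
Proof. by elim/big_rec2: _ => // i y1 y2 _ <-; rewrite ReD. Qed.
Lemma complexP x y : Re x = Re y -> Im x = Im y -> x = y.
Proof. by case: x y => a b [c d] /= -> ->. Qed.

Lemma Re_mulJ x y : Re (x * y^*) = Re x * Re y + Im x * Im y.
Proof. by case: x y => a b [c d] /=; rewrite mulrN opprK. Qed.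

(** Balls of [R[i]] have radii in [R[i]]; a positive radius is real there, so all topology can be
    done with real radii and [normc]. *)
Lemma nbhs_normc z (A : set R[i]) :
  nbhs z A <-> exists2 e : R, 0 < e & forall y, normc (y - z) < e -> A y.
Proof.
split=> [/nbhs_ballP[e /= e0 eA]|[e e0 eA]].
  exists (Re e); first by move: e0; rewrite ltcE => /andP[].
  move=> y yz; apply: eA; rewrite -ball_normE /= distrC normr_normc.
  by rewrite (_ : e = (Re e)%:C) ?ltcR// RRe_real// gtr0_real.
apply/nbhs_ballP; exists e%:C => /=; first by rewrite ltcR.
move=> y; rewrite -ball_normE /= distrC normr_normc ltcR; exact: eA.
Qed.

Lemma cvgc_normcP (u : nat -> R[i]) z :
  u @ \oo --> z <-> forall e : R, 0 < e ->
    exists N, forall n, (N <= n)%N -> normc (u n - z) <= e.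
Proof.
split=> [uz e e0|H].
  have /uz : nbhs z [set y | normc (y - z) < e] by apply/nbhs_normc; exists e.
  by case=> N _ NA; exists N => n /NA /= /ltW.
move=> A /nbhs_normc [e e0 eA].
have [N HN] := H _ (half_gt0 e0).
exists N => // n /= /HN un; apply: eA; apply: le_lt_trans un _.
by rewrite ltr_pdivrMr// ltr_pMr// ltr1n.
Qed.

Lemma cvgR_normP (u : nat -> R) (l : R) :
  u @ \oo --> l <-> forall e : R, 0 < e ->
    exists N, forall n, (N <= n)%N -> `|u n - l| <= e.
Proof.
split=> [/cvgrPdist_le H e /H [N _ NA]|H].
  by exists N => n /NA; rewrite distrC.
apply/cvgrPdist_le => e /H[N NA]; exists N => // n /= /NA.
by rewrite distrC.
Qed.

Lemma cvgc_ReIm (u : nat -> R[i]) z :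
  (fun n => Re (u n)) @ \oo --> Re z -> (fun n => Im (u n)) @ \oo --> Im z ->
  u @ \oo --> z.
Proof.
move=> /cvgR_normP ru /cvgR_normP iu; apply/cvgc_normcP => e e0.
have e20 : 0 < e / 2 by rewrite divr_gt0.
have [N1 H1] := ru _ e20; have [N2 H2] := iu _ e20.
exists (maxn N1 N2) => n; rewrite geq_max => /andP[/H1 h1 /H2 h2].
apply: le_trans (normc_ReIm_le _) _.
by rewrite ReD ReN ImD ImN (splitr e) lerD.
Qed.

Lemma cvgc_cvg_Re (u : nat -> R[i]) z :
  u @ \oo --> z -> (fun n => Re (u n)) @ \oo --> Re z.
Proof.
move=> /cvgc_normcP uz; apply/cvgR_normP => e /uz[N NA]; exists N => n /NA.
by apply: le_trans; rewrite -ReN -ReD Re_le_normc.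
Qed.

Lemma cauchyR_cvg (u : nat -> R) :
  (forall e : R, 0 < e -> exists N, forall m n, (N <= m)%N -> (N <= n)%N ->
    `|u m - u n| <= e) -> cvgn u.
Proof.
move=> H; apply/cauchy_cvgP/cauchy_ballP => e e0 /=.
have [N HN] := H _ (half_gt0 e0).
exists (u @` [set n | (N <= n)%N], u @` [set n | (N <= n)%N]).
  by split; exists N => // n Nn; exists n.
move=> [_ _] /= [[m Nm <-] [n Nn <-]]; rewrite -ball_normE /=.
apply: le_lt_trans (HN _ _ _ _) _ => //.
by rewrite ltr_pdivrMr// ltr_pMr// ltr1n.
Qed.

Lemma cauchyc_cvg (u : nat -> R[i]) :
  (forall e : R, 0 < e -> exists N, forall m n, (N <= m)%N -> (N <= n)%N ->
    normc (u m - u n) <= e) -> cvgn u.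
Proof.
move=> H.
have /cvg_ex[a ua] : cvgn (fun n => Re (u n)).
  apply: cauchyR_cvg => e /H[N HN]; exists N => m n Nm Nn.
  by rewrite -ReN -ReD; apply: le_trans (Re_le_normc _) _; exact: HN.
have /cvg_ex[b ub] : cvgn (fun n => Im (u n)).
  apply: cauchyR_cvg => e /H[N HN]; exists N => m n Nm Nn.
  by rewrite -ImN -ImD; apply: le_trans (Im_le_normc _) _; exact: HN.
by apply/cvg_ex; exists (a +i* b); exact: cvgc_ReIm.
Qed.

Lemma cvgc_normc_le (u : nat -> R[i]) z (M : R) N :
  u @ \oo --> z -> (forall n, (N <= n)%N -> normc (u n) <= M) -> normc z <= M.
Proof.
move=> /cvgc_normcP uz uM; apply/ler_addgt0Pr => e e0.
have [N' H] := uz _ e0.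
have := H _ (leq_maxl N' N); have := uM _ (leq_maxr N' N).
move=> h1 h2; have := normcBD 0 (u (maxn N' N)) z.
rewrite !sub0r !normcNE; lra.
Qed.

End ComplexModulus.

Lemma cvgc_unique {R : realType} (u : nat -> R[i]) (a b : R[i]) :
  u @ \oo --> a -> u @ \oo --> b -> a = b.
Proof.
move=> /cvgc_normcP ua /cvgc_normcP ub; apply/eqP; rewrite -subr_eq0 -normc_eq0.
rewrite eq_le normc_ge0 andbT; apply/ler_addgt0Pr => e e0; rewrite add0r.
have [N1 H1] := ua _ (half_gt0 e0).
have [N2 H2] := ub _ (half_gt0 e0).
have h1 := H1 _ (leq_maxl N1 N2); have h2 := H2 _ (leq_maxr N1 N2).
by apply: le_trans (normcBD _ (u (maxn N1 N2)) _) _; rewrite normcBC; lra.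
Qed.

(** * Coefficient estimates for polynomials by averaging over roots of unity *)

Section RootsOfUnity.
Context {R : realType}.
Implicit Types (z w : R[i]) (p q : {poly R[i]}).

Lemma cisX (t : R) n :
  (cos t +i* sin t) ^+ n = cos (n%:R * t) +i* sin (n%:R * t).
Proof.
elim: n => [|n IH]; first by rewrite expr0 mul0r cos0 sin0.
rewrite exprS IH -natr1 mulrDl mul1r cosD sinD.
by apply: complexP; rewrite ?ReM ?ImM /=; ring.
Qed.

Lemma normc_cis (t : R) : normc (cos t +i* sin t) = 1.
Proof. by rewrite /normc cos2Dsin2 sqrtr1. Qed.

Lemma exists_prim_root n : (0 < n)%N ->
  exists2 w : R[i], n.-primitive_root w & normc w = 1.
Proof.
move=> n0; have nR : (0 : R) < n%:R by rewrite ltr0n.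
exists (cos (2 * pi / n%:R) +i* sin (2 * pi / n%:R)); last exact: normc_cis.
rewrite /primitive_root_of_unity n0/=; apply/forallP => -[i /= iltn].
rewrite unity_rootE cisX; apply/eqP.
have [in1|inen] := eqVneq i.+1 n.
  rewrite in1; have -> : n%:R * (2 * pi / n%:R) = pi *+ 2 :> R.
    by rewrite -(mulr_natl pi 2); field; rewrite gt_eqF.
  by rewrite cos2pi sin2pi; apply/eqP.
apply/eqP => /eqP H.
have i1n : (i.+1 < n)%N by rewrite ltn_neqAle inen.
set t := i.+1%:R * (2 * pi / n%:R) in H.
(* A power equal to 1 before the n-th would give [cos t = 1]; but [cos t = 1 - 2 sin (t / 2) ^ 2]
   and t / 2 lies strictly between 0 and pi. *)
have : 0 < sin (t / 2).
  apply: sin_gt0_pi; rewrite /t.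
  have -> : i.+1%:R * (2 * pi / n%:R) / 2 = (i.+1%:R / n%:R) * pi :> R.
    by field; rewrite gt_eqF.
  apply/andP; split; first by rewrite mulr_gt0 ?pi_gt0 ?divr_gt0.
  by rewrite gtr_pMl ?pi_gt0// ltr_pdivrMr// mul1r ltr_nat.
move=> s0; have [ct _] : cos t = 1 /\ sin t = 0 by move: H => /eqP [].
have : cos t = 1 - 2 * sin (t / 2) ^+ 2.
  by rewrite {1}(splitr t) cosD; have := cos2Dsin2 (t / 2); lra.
rewrite ct => /eqP; rewrite -subr_eq0 opprB addrC subrK mulf_eq0.
by rewrite pnatr_eq0/= expf_eq0/= gt_eqF.
Qed.

Lemma sum_prim_root n w m : n.-primitive_root w ->
  \sum_(j < n) (w ^+ j) ^+ m = if (n %| m)%N then n%:R else 0.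
Proof.
move=> wn; rewrite (prim_order_dvd wn).
under eq_bigr => j _ do rewrite -exprM mulnC exprM.
case: eqP => [->|/eqP wm].
  by under eq_bigr => j _ do rewrite expr1n; rewrite sumr_const card_ord.
apply/eqP; have := subrX1 (w ^+ m) n.
rewrite -exprM mulnC exprM (prim_expr_order wn) expr1n subrr => /esym/eqP.
by rewrite mulf_eq0 subr_eq0 (negbTE wm).
Qed.

Lemma sum_horner_prim_root n w p z m : n.-primitive_root w ->
  \sum_(j < n) p.[z * w ^+ j] * (w ^+ j) ^+ m =
  n%:R * \sum_(i < size p | (n %| i + m)%N) p`_i * z ^+ i.
Proof.
move=> wn; under eq_bigr => j _ do rewrite horner_coef mulr_suml.
rewrite exchange_big /= mulr_sumr [RHS]big_mkcond /=; apply: eq_bigr => i _.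
under eq_bigr => j _.
  rewrite exprMn mulrA -mulrA -exprD; over.
by rewrite -mulr_sumr (sum_prim_root _ wn); case: ifP => _; rewrite ?mulr0// mulrC.
Qed.

(** The discrete form of Cauchy's coefficient formula. With at least [size p] nodes no two indices
    of coefficients are congruent, so the average is exact; the exponent [n - k] stands for
    [- k]. *)
Lemma sum_coef_prim_root n w p z k : n.-primitive_root w ->
  (size p <= n)%N -> (k < n)%N ->
  \sum_(j < n) p.[z * w ^+ j] * (w ^+ j) ^+ (n - k) = n%:R * (p`_k * z ^+ k).
Proof.
move=> wn pn kn; rewrite (sum_horner_prim_root _ _ _ wn); congr (_ * _).
have dvd (i : nat) : (i < n)%N -> (n %| i + (n - k))%N = (i == k).
  move=> iltn; apply/idP/eqP => [|->]; last by rewrite subnKC ?(ltnW kn).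
  move=> /dvdnP[[|[|q]] /eqP]; rewrite ?mul0n ?mul1n.
  - by move/eqP; lia.
  - by move/eqP; lia.
  - by move/eqP; nia.
have [pk|kp] := leqP (size p) k.
  rewrite [p`_k]nth_default// mul0r big1// => i.
  rewrite dvd => [/eqP ik|]; last exact: leq_trans (ltn_ord i) pn.
  by move: (ltn_ord i); rewrite ik ltnNge pk.
rewrite (big_pred1 (Ordinal kp))// => i.
by rewrite dvd//; exact: leq_trans (ltn_ord i) pn.
Qed.

Lemma cauchy_coef p (r M : R) k : 0 <= r ->
  (forall z, normc z = r -> normc p.[z] <= M) -> normc p`_k * r ^+ k <= M.
Proof.
move=> r0 pM; set n := (size p + k.+1)%N.
have n0 : (0 < n)%N by rewrite /n addnS.
have [w wn w1] := exists_prim_root n0.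
have sp : (size p <= n)%N by rewrite leq_addr.
have kn : (k < n)%N by rewrite /n; lia.
have nR : (0 : R) < n%:R by rewrite ltr0n.
have /(congr1 (@normc R)) := sum_coef_prim_root r%:C wn sp kn.
rewrite !normcM normcX normcR (ger0_norm r0) normc_nat => /esym H.
rewrite -(ler_pM2l nR) H; apply: le_trans (normc_sum _ _ _) _.
rewrite mulr_natl -[leRHS](_ : \sum_(j < n) M = _); last first.
  by rewrite sumr_const card_ord.
apply: ler_sum => j _; rewrite normcM !normcX w1 !expr1n mulr1.
by apply: pM; rewrite normcM normcX w1 expr1n mulr1 normcR ger0_norm.
Qed.

(* Averaging [Re p] against the nonnegative weight [1 + Re (c w^-jk)] over the
   n-th roots of unity isolates half of the k-th coefficient. *)
Lemma borel_caratheodory_coef p (r M : R) k : 0 <= r -> p`_0 = 0 ->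
  (forall z, normc z = r -> complex.Re p.[z] <= M) ->
  normc p`_k * r ^+ k <= 2 * M.
Proof.
move=> r0 p0 pM; set n := (size p + k.+1)%N.
have n0 : (0 < n)%N by rewrite /n addnS.
have [w wn w1] := exists_prim_root n0.
have sp : (size p <= n)%N by rewrite leq_addr.
have kn : (k < n)%N by rewrite /n; lia.
have nR : (0 : R) < n%:R by rewrite ltr0n.
have S0 : \sum_(j < n) p.[r%:C * w ^+ j] = 0.
  have := sum_coef_prim_root r%:C wn sp n0.
  under eq_bigr => j _ do
    rewrite subn0 exprAC (prim_expr_order wn) expr1n mulr1.
  by rewrite p0 mul0r mulr0.
(* The mean of [Re p] over the nodes is [Re p.[0] = 0], and it is at most M. *)
have M0 : 0 <= M.
  rewrite -(pmulr_rge0 _ nR) mulr_natl -[leRHS](_ : \sum_(j < n) M = _); last first.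
    by rewrite sumr_const card_ord.
  suff : complex.Re (\sum_(j < n) p.[r%:C * w ^+ j]) <= \sum_(j < n) M.
    by rewrite S0.
  rewrite Re_sum; apply: ler_sum => j _; apply: pM.
  by rewrite normcM normcX w1 expr1n mulr1 normcR ger0_norm.
have [->|k0] := posnP k; first by rewrite p0 normc0 mul0r mulr_ge0.
have [->|pk0] := eqVneq p`_k 0; first by rewrite normc0 mul0r mulr_ge0.
pose c := (p`_k)^* / (normc p`_k)%:C.
have nc1 : normc c = 1.
  rewrite /c normcM normcV normcR ger0_norm ?normc_ge0//.
  have -> : normc (p`_k)^* = normc p`_k.
    by case: (p`_k) => a b /=; rewrite sqrrN.
  by rewrite divff// normc_eq0.
have cpk : c * p`_k = (normc p`_k)%:C.
  rewrite /c mulrAC mulrC [_^* * _]mulrC -sqr_normc normr_normc expr2 mulrA mulVf ?mul1r//.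
  by rewrite eq_complex /= eqxx andbT normc_eq0.
have wJ (j : nat) : (w ^+ j)^* = (w ^+ j)^-1.
  by rewrite invc_norm normr_normc normcX w1 expr1n expr1n invr1 mul1r.
have wjV (j : nat) : ((w ^+ j) ^+ (n - k))^* = (w ^+ j) ^+ k.
  rewrite -exprM wJ exprM; apply: (mulIf (x := (w ^+ j) ^+ (n - k))).
    rewrite expf_neq0// expf_neq0// -normc_eq0 w1 oner_eq0//.
  rewrite mulVf; last by rewrite expf_neq0// expf_neq0// -normc_eq0 w1 oner_eq0.
  by rewrite -exprD subnKC ?(ltnW kn)// exprAC (prim_expr_order wn) expr1n.
have sumw : \sum_(j < n) (w ^+ j) ^+ (n - k) = 0.
  rewrite (sum_prim_root _ wn); case: ifP => // /dvdnP[[|q]]; first by lia.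
  by nia.
have S1 : \sum_(j < n) c * (p.[r%:C * w ^+ j] * (w ^+ j) ^+ (n - k)) =
    (n%:R * (normc p`_k * r ^+ k))%:C.
  rewrite -mulr_sumr (sum_coef_prim_root _ wn)// mulrCA (mulrA c) cpk.
  by rewrite !rmorphM/= rmorph_nat rmorphXn.
(* For 0 < k and i < size p the frequency i + k lies strictly between 0 and n; this is why n is
   [size p + k.+1]. The conjugate half of the weight therefore contributes nothing. *)
have S2 : \sum_(j < n) c^* * (p.[r%:C * w ^+ j] * (w ^+ j) ^+ k) = 0.
  rewrite -mulr_sumr (sum_horner_prim_root _ _ _ wn) big1 ?mulr0// => i.
  move: (ltn_ord i) => + /dvdnP[[|q]]; rewrite /n; first by lia.
  by nia.
pose a j := complex.Re (c * (w ^+ j) ^+ (n - k)).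
have sa : \sum_(j < n) a j = 0.
  by rewrite /a -Re_sum -mulr_sumr sumw mulr0.
have H : \sum_(j < n) complex.Re p.[r%:C * w ^+ j] * (1 + a j) =
    n%:R * (normc p`_k * r ^+ k) / 2.
  transitivity (complex.Re
    (\sum_(j < n) c * (p.[r%:C * w ^+ j] * (w ^+ j) ^+ (n - k)) +
     \sum_(j < n) c^* * (p.[r%:C * w ^+ j] * (w ^+ j) ^+ k)) / 2); last first.
    by rewrite S1 S2 addr0.
  rewrite -big_split/= Re_sum.
  under eq_bigr => j _ do rewrite mulrDr mulr1.
  rewrite big_split/= -Re_sum S0 add0r mulr_suml; apply: eq_bigr => j _.
  rewrite /a -wjV; move: (c) p.[_] ((w ^+ j) ^+ (n - k)) => [? ?] [? ?] [? ?] /=.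
  by field.
have : \sum_(j < n) complex.Re p.[r%:C * w ^+ j] * (1 + a j) <=
    \sum_(j < n) M * (1 + a j).
  apply: ler_sum => j _; apply: ler_wpM2r.
    have := Re_le_normc (c * (w ^+ j) ^+ (n - k)).
    by rewrite normcM nc1 !normcX w1 !expr1n mul1r -/(a j) ler_norml; lra.
  by apply: pM; rewrite normcM normcX w1 expr1n mulr1 normcR ger0_norm.
rewrite H -mulr_sumr big_split/= sa addr0 sumr_const card_ord.
by rewrite -(mulr_natl 1) mulr1 -mulrA mulrC ler_pM2r//; lra.
Qed.

Lemma horner_geo p (A t : R) z K : 0 <= t -> t < 1 ->
  (forall k, (K <= k)%N -> normc (p`_k * z ^+ k) <= A * t ^+ k) ->
  normc (\sum_(K <= k < size p) p`_k * z ^+ k) <= A * t ^+ K / (1 - t).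
Proof.
move=> t0 t1 H; apply: le_trans (normc_sum _ _ _) _.
have [pK|Kp] := leqP (size p) K.
  rewrite big_geq// divr_ge0//; last by rewrite subr_ge0 ltW.
  exact: le_trans (normc_ge0 _) (H _ (leqnn _)).
apply: (@le_trans _ _ (\sum_(K <= k < size p) A * t ^+ k)).
  by rewrite !big_nat; apply: ler_sum => k /andP[Kk _]; exact: H.
have A0 : 0 <= A * t ^+ K by apply: le_trans (H _ (leqnn _)); exact: normc_ge0.
rewrite -{1}(add0n K) big_addn.
under eq_bigr => i _ do rewrite exprD mulrCA mulrC.
rewrite -mulr_sumr ler_wpM2l// big_mkord.
have := subrX1 t (size p - K); rewrite -[_ - 1]opprB -[t - 1]opprB mulNr.
move=> /oppr_inj /esym E; rewrite -[leRHS]mul1r ler_pdivlMr ?subr_gt0//.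
by rewrite [leLHS]mulrC E gerBl exprn_ge0.
Qed.

(** The bound on the circle of radius Q makes the terms from K on a geometric tail of ratio s / Q,
    with K depending only on C, s, Q, e; the first K terms are controlled by d. Neither K nor d
    depends on p or its degree, so the lemma serves whole families of polynomials. *)
Lemma horner_propagation (r s Q C e : R) : 0 < r -> 0 <= s -> s < Q -> 0 <= C ->
  0 < e -> exists2 d : R, 0 < d & forall p,
    (forall k, normc p`_k * r ^+ k <= d) -> (forall k, normc p`_k * Q ^+ k <= C) ->
    forall z, normc z <= s -> normc p.[z] <= e.
Proof.
move=> r0 s0 sQ C0 e0; have Q0 : 0 < Q by exact: le_lt_trans sQ.
pose t := s / Q; have t0 : 0 <= t by rewrite divr_ge0// ltW.
have t1 : t < 1 by rewrite /t ltr_pdivrMr// mul1r.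
have [K HK] : exists K, C * t ^+ K / (1 - t) <= e / 2.
  have /cvgR_normP H : (fun n => C / (1 - t) * t ^+ n) @ \oo --> C / (1 - t) * 0.
    by apply: cvgMr; apply: cvg_expr; rewrite ger0_norm.
  have [K /(_ _ (leqnn _))] := H _ (half_gt0 e0).
  by rewrite mulr0 subr0 => /(le_trans (ler_norm _)) h; exists K; rewrite mulrAC.
pose B := \sum_(0 <= k < K) (s / r) ^+ k.
have B0 : 0 <= B by apply: sumr_ge0 => k _; rewrite exprn_ge0// divr_ge0// ltW.
exists (e / 2 / (B + 1)).
  by rewrite divr_gt0// ?half_gt0//; lra.
move=> p pr pQ z zs.
have szp : p.[z] = \sum_(0 <= k < size p) p`_k * z ^+ k.
  by rewrite horner_coef big_mkord.
have low k : normc (p`_k * z ^+ k) <= e / 2 / (B + 1) * (s / r) ^+ k.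
  rewrite normcM normcX expr_div_n mulrA ler_pdivlMr ?exprn_gt0//.
  rewrite mulrAC ler_pM ?mulr_ge0 ?exprn_ge0 ?normc_ge0 ?(ltW r0) ?(ltW Q0)//.
  by rewrite lerXn2r ?nnegrE ?normc_ge0.
have hi k : normc (p`_k * z ^+ k) <= C * t ^+ k.
  rewrite normcM normcX expr_div_n mulrA ler_pdivlMr ?exprn_gt0//.
  rewrite mulrAC ler_pM ?mulr_ge0 ?exprn_ge0 ?normc_ge0 ?(ltW r0) ?(ltW Q0)//.
  by rewrite lerXn2r ?nnegrE ?normc_ge0.
have lowsum K' : (K' <= K)%N ->
    normc (\sum_(0 <= k < K') p`_k * z ^+ k) <= e / 2.
  move=> K'K; apply: le_trans (normc_sum _ _ _) _.
  apply: (@le_trans _ _ (\sum_(0 <= k < K') e / 2 / (B + 1) * (s / r) ^+ k)).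
    by apply: ler_sum => k _; exact: low.
  rewrite -mulr_sumr -mulrA ler_piMr//; first by rewrite ltW// half_gt0.
  rewrite mulrC ler_pdivrMr; last by lra.
  rewrite mul1r; apply: (@le_trans _ _ B); last by lra.
  rewrite /B (big_cat_nat (leq0n _) K'K)/= lerDl sumr_ge0// => k _.
  by rewrite exprn_ge0// divr_ge0// ltW.
have [pK|Kp] := leqP (size p) K.
  by rewrite szp; apply: le_trans (lowsum _ pK) _; lra.
rewrite szp (big_cat_nat (leq0n _) (ltnW Kp))/=.
apply: le_trans (normcD _ _) _; rewrite (splitr e) lerD ?lowsum//.
by apply: le_trans HK; apply: horner_geo => // k _.
Qed.

(** An estimate of Schwarz type: for |z| <= r / 2 the geometric series of the terms is at most twice
    its first term, which carries the factor |z|. *)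
Lemma horner_sub0_le p (r A : R) z : 0 < r -> (forall k, normc p`_k * r ^+ k <= A) ->
  normc z <= r / 2 -> normc (p.[z] - p.[0]) <= 2 * A / r * normc z.
Proof.
move=> r0 pA zr.
have A0 : 0 <= A.
  by apply: le_trans (pA 0%N); rewrite mulr_ge0 ?normc_ge0// exprn_ge0// ltW.
rewrite horner_coef0.
have [sp|sp] := leqP (size p) 0.
  move: sp; rewrite leqn0 size_poly_eq0 => /eqP->; rewrite horner0 coef0 subr0 normc0.
  by rewrite mulr_ge0 ?normc_ge0// divr_ge0// ?mulr_ge0// ltW.
rewrite horner_coef -(big_mkord predT (fun i => p`_i * z ^+ i)).
rewrite big_ltn// expr0 mulr1 addrC addKr.
have z0 := normc_ge0 z.
pose t := normc z / r.
have t0 : 0 <= t by rewrite divr_ge0// ltW.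
have t2 : t <= 1 / 2 by rewrite /t ler_pdivrMr// mulrC; lra.
apply: le_trans (@horner_geo p A t z 1 t0 _ _) _; first by lra.
  move=> k _; rewrite normcM normcX expr_div_n mulrA ler_pdivlMr ?exprn_gt0//.
  by rewrite mulrAC ler_wpM2r ?exprn_ge0.
rewrite expr1 ler_pdivrMr; last by lra.
have -> : 2 * A / r * normc z = 2 * (A * t) by rewrite /t; field; rewrite gt_eqF.
have At0 : 0 <= A * t by rewrite mulr_ge0.
have := mulr_ge0 At0 (_ : 0 <= 1 - 2 * t); lra.
Qed.

End RootsOfUnity.

(** * Logarithms of zero-free functions *)

Section RealDerivative.
Context {R : realType}.
Implicit Types (f g : R -> R) (x y a b : R).

Definition has_deriv f x l := is_derive (x : R) (1 : R) (f : R -> R) l.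

Lemma has_deriv_eq f x a b : has_deriv f x a -> a = b -> has_deriv f x b.
Proof. by move=> fa <-. Qed.

Lemma has_derivD f g x a b : has_deriv f x a -> has_deriv g x b ->
  has_deriv (fun t => f t + g t) x (a + b).
Proof. by move=> fa gb; exact: is_deriveD. Qed.

Lemma has_derivN f x a : has_deriv f x a -> has_deriv (fun t => - f t) x (- a).
Proof. by move=> fa; exact: is_deriveN. Qed.

Lemma has_derivB f g x a b : has_deriv f x a -> has_deriv g x b ->
  has_deriv (fun t => f t - g t) x (a - b).
Proof. by move=> fa gb; exact: is_deriveB. Qed.

Lemma has_derivM f g x a b : has_deriv f x a -> has_deriv g x b ->
  has_deriv (fun t => f t * g t) x (a * g x + f x * b).
Proof.
move=> fa gb; apply: (has_deriv_eq (is_deriveM fa gb)).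
by rewrite addrC mulrC.
Qed.

Lemma has_deriv_cst x a : has_deriv (fun=> a) x 0.
Proof. exact: is_derive_cst. Qed.

Lemma has_deriv_id x : has_deriv id x 1.
Proof. exact: is_derive_id. Qed.

Lemma has_derivZ f x a b : has_deriv f x a -> has_deriv (fun t => b * f t) x (b * a).
Proof.
by move=> fa; have := has_derivM (has_deriv_cst x b) fa; rewrite mul0r add0r.
Qed.

Lemma has_deriv_comp f g x a b : has_deriv f (g x) a -> has_deriv g x b ->
  has_deriv (fun t => f (g t)) x (a * b).
Proof. by move=> fa gb; exact: (is_derive1_comp fa gb). Qed.

Lemma has_deriv_expR g x b : has_deriv g x b ->
  has_deriv (fun t => expR (g t)) x (expR (g x) * b).
Proof. by move=> gb; apply: has_deriv_comp gb; exact: is_derive_expR. Qed.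

Lemma has_deriv_cos g x b : has_deriv g x b ->
  has_deriv (fun t => cos (g t)) x (- sin (g x) * b).
Proof. by move=> gb; apply: has_deriv_comp gb; exact: is_derive_cos. Qed.

Lemma has_deriv_sin g x b : has_deriv g x b ->
  has_deriv (fun t => sin (g t)) x (cos (g x) * b).
Proof. by move=> gb; apply: has_deriv_comp gb; exact: is_derive_sin. Qed.

Lemma has_deriv_ln g x b : 0 < g x -> has_deriv g x b ->
  has_deriv (fun t => ln (g t)) x ((g x)^-1 * b).
Proof. by move=> g0 gb; apply: has_deriv_comp gb; exact: is_derive1_ln. Qed.

Lemma has_derivX f x a n : has_deriv f x a ->
  has_deriv (fun t => f t ^+ n) x (n%:R * f x ^+ n.-1 * a).
Proof. by move=> fa; have := is_deriveX n fa; rewrite exprfctE. Qed.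

Lemma has_deriv_sum (I : Type) (s : seq I) (P : pred I) (F : I -> R -> R)
    (dF : I -> R) x : (forall i, P i -> has_deriv (F i) x (dF i)) ->
  has_deriv (fun t => \sum_(i <- s | P i) F i t) x (\sum_(i <- s | P i) dF i).
Proof.
move=> H; elim: s => [|i s IH].
  rewrite big_nil; under [fun t => _]eq_fun do rewrite big_nil.
  exact: has_deriv_cst.
rewrite big_cons; under [fun t => _]eq_fun do rewrite big_cons.
by case: ifP => Pi //; apply: has_derivD => //; exact: H.
Qed.

Lemma has_deriv_within f (df : R -> R) a b :
  (forall x, a <= x <= b -> has_deriv f x (df x)) ->
  {within `[a, b], continuous f}.
Proof.
move=> H; apply: derivable_within_continuous => x; rewrite in_itv/= => xab.
by have := H _ xab; rewrite /has_deriv => h; exact: ex_derive.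
Qed.

Lemma mean_value f (df : R -> R) a b : a < b ->
  (forall x, a <= x <= b -> has_deriv f x (df x)) ->
  exists2 c, a < c < b & f b - f a = df c * (b - a).
Proof.
move=> ab H.
have [|c] := @MVT R f df a b ab _ (has_deriv_within H).
  by move=> x; rewrite in_itv/= => /andP[ax xb]; apply: H; rewrite !ltW.
by rewrite in_itv/= => acb E; exists c.
Qed.

Lemma has_deriv_nondecreasing f (df : R -> R) a b : a <= b ->
  (forall x, a <= x <= b -> has_deriv f x (df x)) ->
  (forall x, a < x < b -> 0 <= df x) -> f a <= f b.
Proof.
rewrite le_eqVlt => /predU1P[->//|ab H df0].
have [c cab E] := mean_value ab H.
by rewrite -subr_ge0 E mulr_ge0 ?df0// subr_ge0 ltW.
Qed.

End RealDerivative.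

(** * Real parts of logarithms of zero-free polynomials *)

Section ComplexLog.
Context {R : realType}.
Implicit Types (z w : R[i]) (p q : {poly R[i]}).
Local Notation Re := (@complex.Re R).

(** The Taylor formula for the real part of log (1 - w), which avoids a branch of the complex
    logarithm. Along the segment t w the left side has derivative [- Re (w * v ^+ K / (1 - v))] with
    v = t w, by the finite geometric sum, and the mean value theorem gives the error. *)
Lemma ln_normc_sub1 w K : normc w < 1 ->
  `|ln (normc (1 - w)) + \sum_(1 <= k < K.+1) Re (w ^+ k) / k%:R| <=
  normc w ^+ K.+1 / (1 - normc w).
Proof.
move=> w1; have w0 := normc_ge0 w.
pose N (t : R) := normc (1 - t%:C * w) ^+ 2.
have NE t : N t = 1 - 2 * Re w * t + normc w ^+ 2 * t ^+ 2.
  rewrite /N !sqr_normc_ReIm; case: w {w0 w1 N} => a b /=.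
  by rewrite !(add0r, sub0r, addr0, subr0, mul0r, mulr0); ring.
have lb t : 0 <= t <= 1 -> 1 - normc w <= normc (1 - t%:C * w).
  move=> /andP[t0 t1]; have := normcBl 1 (t%:C * w).
  rewrite normc1 normcM normcR ger0_norm//; apply: le_trans.
  by rewrite lerB// ler_piMl.
have N0 t : 0 <= t <= 1 -> 0 < N t.
  by move=> /lb h; rewrite /N exprn_gt0//; apply: lt_le_trans h; rewrite subr_gt0.
pose f t := 2^-1 * ln (N t) + \sum_(1 <= k < K.+1) Re (w ^+ k) / k%:R * t ^+ k.
pose df t := 2^-1 * ((N t)^-1 * (- 2 * Re w + normc w ^+ 2 * (2 * t))) +
  \sum_(1 <= k < K.+1) Re (w ^+ k) / k%:R * (k%:R * t ^+ k.-1).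
have Hf t : 0 <= t <= 1 -> has_deriv f t (df t).
  move=> t01; apply: has_derivD.
    apply/has_derivZ/has_deriv_ln; first exact: N0.
    rewrite (_ : N = fun t => 1 - 2 * Re w * t + normc w ^+ 2 * t ^+ 2); last first.
      exact/funext.
    apply: has_deriv_eq.
      apply: has_derivD; last exact/has_derivZ/has_derivX/has_deriv_id.
      by apply: has_derivB; [exact: has_deriv_cst|exact/has_derivZ/has_deriv_id].
    by rewrite expr1; ring.
  apply: has_deriv_sum => k _; apply/has_derivZ.
  by apply: has_deriv_eq (has_derivX _ (has_deriv_id _)) _; rewrite mulr1.
have [c /andP[c0 c1] E] := mean_value ltr01 Hf.
have c01 : 0 <= c <= 1 by rewrite !ltW.
have f0 : f 0 = 0.
  rewrite /f NE !mulr0 expr0n/= mulr0 subr0 addr0 ln1 mulr0 add0r.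
  rewrite big_nat_cond big1// => k; rewrite andbT => /andP[k1 _].
  by rewrite expr0n/= gtn_eqF// mulr0.
have f1 : f 1 = ln (normc (1 - w)) + \sum_(1 <= k < K.+1) Re (w ^+ k) / k%:R.
  rewrite /f /N rmorph1 mul1r lnXn; last first.
    by have := lb 1; rewrite rmorph1 mul1r ler01 lexx => /(_ isT); lra.
  rewrite -[ln _ *+ 2]mulr_natl mulKf ?pnatr_eq0//; congr (_ + _).
  by apply: eq_bigr => k _; rewrite expr1n mulr1.
rewrite -f1 -[f 1]subr0 -f0 E subr0 mulr1.
set v := c%:C * w.
have nz : 1 - v != 0 by rewrite -normc_gt0; apply: lt_le_trans (lb c c01); lra.
have -> : df c = - Re (w * v ^+ K / (1 - v)).
  have E1 : \sum_(1 <= k < K.+1) Re (w ^+ k) / k%:R * (k%:R * c ^+ k.-1) =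
      Re (w * (1 - v ^+ K) / (1 - v)).
    have -> : w * (1 - v ^+ K) / (1 - v) = w * \sum_(i < K) v ^+ i.
      by rewrite -[1 - v ^+ K]opprB subrX1; field.
    rewrite mulr_sumr Re_sum big_add1 /= big_mkord; apply: eq_bigr => i _.
    rewrite mulrA divfK ?pnatr_eq0// /v exprMn mulrCA -exprS -rmorphXn ReRM.
    by rewrite mulrC.
  have E2 : 2^-1 * ((N c)^-1 * (- 2 * Re w + normc w ^+ 2 * (2 * c))) =
      - Re (w / (1 - v)).
    rewrite invc_norm normr_normc ReM.
    have -> : (normc (1 - v))%:C ^- 2 * (1 - v)^* = ((N c)^-1)%:C * (1 - v)^*.
      by rewrite /N rmorphV/= ?rmorphXn// unitfE expf_neq0// gt_eqF// normc_gt0.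
    rewrite ReRM ImRM sqr_normc_ReIm /v.
    by case: (w) => a b /=; rewrite !(add0r, sub0r, addr0, subr0, mul0r, mulr0); field; rewrite gt_eqF ?N0.
  rewrite /df E1 E2 -ReN -ReD -ReN; congr (Re _).
  by rewrite mulrBr mulr1 mulrBl; ring.
rewrite normrN; apply: le_trans (Re_le_normc _) _.
rewrite normcM normcV normcM normcX.
have vw : normc v <= normc w.
  by rewrite /v normcM normcR ger0_norm ?(ltW c0)// ler_piMl// ltW.
rewrite ler_pM ?invr_ge0 ?normc_ge0 ?mulr_ge0 ?exprn_ge0 ?normc_ge0//.
  by rewrite exprS ler_wpM2l// lerXn2r ?nnegrE ?normc_ge0.
by rewrite lef_pV2 ?posrE ?subr_gt0 ?normc_gt0//; exact: lb.
Qed.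

(** Factor p over its roots x, all of modulus > Q. On |z| <= s each ln |1 - z / x| is approximated
    by the truncated logarithm series with an error geometric in s / Q, and the allowed error is
    halved from root to root. The normalization at 0 is the one required by
    [borel_caratheodory_coef]. *)
Lemma ln_horner_approx p (Q s e : R) : 0 <= s -> s < Q -> 0 < e ->
  (forall z, normc z <= Q -> p.[z] != 0) ->
  exists2 q : {poly R[i]}, q`_0 = 0 & forall z, normc z <= s ->
    `|ln (normc p.[z]) - ln (normc p.[0]) - Re q.[z]| <= e.
Proof.
move=> s0 sQ + pQ; have Q0 : 0 < Q by exact: le_lt_trans sQ.
have [rs pE] := closed_field_poly_normal p.
have lp0 : lead_coef p != 0.
  have := pQ 0; rewrite normc0 => /(_ (ltW Q0)); apply: contra_neq => l0.
  by rewrite pE l0 scale0r horner0.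
have rsQ z : z \in rs -> Q < normc z.
  move=> zrs; rewrite ltNge; apply/negP => /pQ; rewrite pE hornerZ mulf_eq0.
  rewrite horner_prod (big_rem z)//= !hornerE subrr mul0r.
  by rewrite eqxx orbT.
rewrite {}pE; set c := lead_coef p in lp0 *; move: c lp0 => c c0 {p pQ}.
elim: rs rsQ e => [_|x rs IH rsQ] e e0.
  exists 0; first by rewrite coef0.
  move=> z _; rewrite big_nil !hornerE subrr subr0 normr0; exact: ltW.
have [q q0 Hq] := IH (fun z zrs => rsQ z (mem_behead (s := x :: rs) zrs)) _ (half_gt0 e0).
have Qx := rsQ x (mem_head _ _).
have x0 : x != 0 by rewrite -normc_gt0; exact: lt_trans Qx.
pose t := s / Q; have t0 : 0 <= t by rewrite divr_ge0// ltW.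
have t1 : t < 1 by rewrite /t ltr_pdivrMr// mul1r.
have [K HK] : exists K, t ^+ K.+1 / (1 - t) <= e / 2.
  have /cvgR_normP H : (fun n => (1 - t)^-1 * t ^+ n) @ \oo --> (1 - t)^-1 * 0.
    by apply: cvgMr; apply: cvg_expr; rewrite ger0_norm.
  have [K /(_ _ (leqnSn _))] := H _ (half_gt0 e0).
  by rewrite mulr0 subr0 => /(le_trans (ler_norm _)) h; exists K; rewrite mulrC.
pose l := - \sum_(1 <= k < K.+1) (k%:R * x ^+ k)^-1 *: 'X^k.
have l0 : l`_0 = 0.
  rewrite coefN coef_sum big_nat_cond big1 ?oppr0// => k; rewrite andbT => /andP[k1 _].
  by rewrite coefZ coefXn ltn_eqF// mulr0.
exists (q + l); first by rewrite coefD q0 l0 addr0.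
move=> z zs.
have zx : normc (z / x) <= t.
  rewrite normcM normcV /t ler_pM ?normc_ge0// ?invr_ge0 ?normc_ge0//.
  by rewrite lef_pV2 ?posrE ?normc_gt0// ltW.
have zx1 : normc (z / x) < 1 by exact: le_lt_trans t1.
have zQ : normc z < Q by exact: le_lt_trans sQ.
have tail_neq0 y : normc y < Q -> (c *: \prod_(z <- rs) ('X - z%:P)).[y] != 0.
  move=> yQ; rewrite hornerZ mulf_neq0// -rootE root_prod_XsubC.
  apply: contraTN yQ => yrs; rewrite -leNgt ltW// rsQ//.
  by rewrite in_cons yrs orbT.
rewrite big_cons !scalerAr -!scalerAr.
have split y : normc y < Q -> ln (normc (c *: (('X - x%:P) * \prod_(z <- rs) ('X - z%:P))).[y]) =
    ln (normc (c *: \prod_(z <- rs) ('X - z%:P)).[y]) + (ln (normc x) + ln (normc (1 - y / x))).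
  move=> yQ; have -> : (c *: (('X - x%:P) * \prod_(z <- rs) ('X - z%:P))).[y] =
      (c *: \prod_(z <- rs) ('X - z%:P)).[y] * (- x * (1 - y / x)).
    rewrite !(hornerZ, hornerM, hornerXsubC); move: (\prod_(_ <- _) _).[y] => P.
    by field.
  rewrite normcM lnM ?posrE ?normc_gt0 ?tail_neq0//; last first.
    rewrite mulf_neq0 ?oppr_eq0// subr_eq0 eq_sym; apply: contraTneq yQ => yx.
    rewrite -leNgt -[y](divfK x0) yx mul1r ltW//.
  rewrite normcM lnM ?posrE ?normc_gt0 ?oppr_eq0 ?normcNE//.
  rewrite subr_eq0 eq_sym; apply: contraTneq yQ => yx.
  by rewrite -leNgt -[y](divfK x0) yx mul1r ltW.
rewrite !split ?normc0// mul0r subr0 normc1 ln1 addr0.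
have lz : Re l.[z] = - \sum_(1 <= k < K.+1) Re ((z / x) ^+ k) / k%:R.
  rewrite hornerN horner_sum ReN Re_sum; congr (- _); rewrite !big_nat.
  apply: eq_bigr => k /andP[k1 _]; rewrite hornerZ hornerXn.
  rewrite invfM -mulrA expr_div_n mulrC [Re _ / _]mulrC.
  have -> : (k%:R : R[i])^-1 = ((k%:R : R)^-1)%:C.
    by rewrite rmorphV/= ?rmorph_nat// unitfE pnatr_eq0 -lt0n.
  by rewrite -ReRM; congr Re; ring.
rewrite hornerD ReD.
have := Hq _ zs; have := ln_normc_sub1 K zx1; rewrite lz.
have : normc (z / x) ^+ K.+1 / (1 - normc (z / x)) <= e / 2.
  apply: le_trans HK; rewrite ler_pM ?exprn_ge0 ?normc_ge0 ?invr_ge0 ?subr_ge0 ?(ltW zx1)//.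
    by rewrite lerXn2r ?nnegrE ?normc_ge0.
  by rewrite lef_pV2 ?posrE ?subr_gt0// lerB.
rewrite !ler_norml; lra.
Qed.

End ComplexLog.

(** * Growth of zero-free functions; uniform limits of polynomials *)

Section PolynomialApproximation.
Context {R : realType}.
Implicit Types (z w : R[i]) (p q : {poly R[i]}) (f : R[i] -> R[i]).
Local Notation Re := (@complex.Re R).

Lemma le_ln (a b : R) : 0 < a -> a <= b -> ln a <= ln b.
Proof. by move=> a0 ab; rewrite ler_ln ?posrE// (lt_le_trans a0 ab). Qed.

(** The polynomial u = q / L, with [Re q] close to ln |p / p(0)|, has bounds free of L:
    Borel-Caratheodory on the circles of radius r and Q' gives exactly the hypotheses of
    [horner_propagation]. Hence one d works for every p and every L. *)
Lemma zerofree_horner_growth (r s Q C e : R) :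
  0 < r -> r < Q -> 0 <= s -> s < Q -> 0 <= C -> 0 < e ->
  exists2 d : R, 0 < d & forall p (L : R), 0 < L ->
    (forall z, normc z <= Q -> p.[z] != 0) ->
    (forall z, normc z <= Q -> normc p.[z] <= expR (L * C) * normc p.[0]) ->
    (forall z, normc z <= r -> normc p.[z] <= expR (L * d) * normc p.[0]) ->
    forall z, normc z <= s -> normc p.[z] <= expR (L * e) * normc p.[0].
Proof.
move=> r0 rQ s0 sQ C0 e0.
pose m := Num.max r s; pose Q' := (m + Q) / 2.
have mQ : m < Q by rewrite /m gt_max rQ.
have rm : r <= m by rewrite /m le_max lexx.
have sm : s <= m by rewrite /m le_max lexx orbT.
have mQ' : m < Q' by rewrite /Q'; lra.
have Q'Q : Q' < Q by rewrite /Q'; lra.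
have C1 : 0 <= 2 * (C + 1) by lra.
have [d0 d00 H] := horner_propagation r0 s0 (le_lt_trans sm mQ') C1 (half_gt0 e0).
(* The three bounds give [2 * (d + d) <= d0] on the small circle, [2 * (C + d) <= 2 * (C + 1)] on
   the large one, and room for the approximation error [L * d] of q in the conclusion. *)
pose d := Num.min (d0 / 4) (Num.min 1 (e / 2)).
have d_gt0 : 0 < d by rewrite /d !lt_min !divr_gt0// ltr01.
have dd0 : d <= d0 / 4 by rewrite /d ge_min lexx.
have d1 : d <= 1 by rewrite /d !ge_min lexx orbT.
have de : d <= e / 2 by rewrite /d !ge_min lexx !orbT.
exists d => // p L L0 pQ pC pd.
have Q'0 : 0 <= Q' by rewrite ltW//; apply: le_lt_trans mQ'; exact: le_trans sm.
have [q q0 Hq] := ln_horner_approx Q'0 Q'Q (mulr_gt0 L0 d_gt0) pQ.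
have Q0 : 0 < Q by exact: le_lt_trans sQ.
have p0 : p.[0] != 0 by apply: pQ; rewrite normc0 ltW.
have lnp z (B : R) : normc z <= Q -> normc p.[z] <= expR (L * B) * normc p.[0] ->
    ln (normc p.[z]) - ln (normc p.[0]) <= L * B.
  move=> zQ h; rewrite lerBlDr -[L * B]expRK -lnM ?posrE ?expR_gt0 ?normc_gt0//.
  by apply: le_ln h; rewrite normc_gt0 pQ.
pose u := (L^-1)%:C *: q.
have uE z : Re u.[z] = L^-1 * Re q.[z] by rewrite hornerZ ReRM.
have u0 : u`_0 = 0 by rewrite coefZ q0 mulr0.
have ReU z (B : R) : normc z <= Q' -> normc p.[z] <= expR (L * B) * normc p.[0] ->
    Re u.[z] <= B + d.
  move=> zQ' h; rewrite uE ler_pdivrMl// mulrDr.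
  have := lnp _ _ (le_trans zQ' (ltW Q'Q)) h; have := Hq _ zQ'.
  by rewrite ler_norml; lra.
move=> z zs.
have zQ' : normc z <= Q' by apply: le_trans zs _; apply: le_trans sm _; exact: ltW.
have : normc u.[z] <= e / 2.
  apply: H zs => k.
  - apply: (@le_trans _ _ (2 * (d + d))); last by lra.
    apply: borel_caratheodory_coef => //; first exact: ltW.
    move=> w wr; apply: ReU; last by apply: pd; rewrite wr.
    by rewrite wr; apply: le_trans rm _; exact: ltW.
  - apply: (@le_trans _ _ (2 * (C + d))); last by lra.
    apply: borel_caratheodory_coef => // w wQ; apply: ReU; first by rewrite wQ.
    by apply: pC; rewrite wQ ltW.
move=> /(le_trans (Re_le _)); rewrite uE ler_pdivrMl// => h.
have pz : p.[z] != 0 by apply: pQ; apply: le_trans zQ' (ltW _).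
rewrite -ler_ln ?posrE ?mulr_gt0 ?expR_gt0 ?normc_gt0//.
rewrite lnM ?posrE ?expR_gt0 ?normc_gt0// expRK.
have := Hq _ zQ'; rewrite ler_norml.
have : L * d <= L * (e / 2) by rewrite ler_pM2l.
lra.
Qed.

(* [f] is holomorphic on the open disc and continuous on the closed one exactly
   when it is a uniform limit of polynomials there; this replaces Cauchy theory. *)
Definition poly_approx z (Q : R) f := forall e : R, 0 < e ->
  exists p : {poly R[i]}, forall w, normc w <= Q -> normc (f (z + w) - p.[w]) <= e.

Lemma poly_approx_shift z z' (Q Q' : R) f : normc (z' - z) + Q' <= Q ->
  poly_approx z Q f -> poly_approx z' Q' f.
Proof.
move=> QQ' fz e /fz[p Hp]; exists (p \Po ('X + (z' - z)%:P)) => w wQ'.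
rewrite horner_comp hornerD hornerX hornerC.
have -> : z' + w = z + (w + (z' - z)) by ring.
apply: Hp; apply: le_trans QQ'; rewrite addrC; apply: le_trans (normcD _ _) _.
by rewrite lerD2l.
Qed.

Lemma poly_approx_uniform_limit z (Q : R) (f : nat -> R[i] -> R[i]) g :
  (forall n, poly_approx z Q (f n)) ->
  (forall e : R, 0 < e -> exists n, forall w, normc w <= Q ->
     normc (f n (z + w) - g (z + w)) <= e) -> poly_approx z Q g.
Proof.
move=> fz fg e e0; have [n Hn] := fg _ (half_gt0 e0).
have [p Hp] := fz n _ (half_gt0 e0).
exists p => w wQ; apply: le_trans (normcBD _ (f n (z + w)) _) _.
by rewrite (splitr e) lerD ?Hp// normcBC Hn.
Qed.

Lemma poly_approxD z (Q : R) f g : poly_approx z Q f -> poly_approx z Q g ->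
  poly_approx z Q (fun x => f x + g x).
Proof.
move=> fz gz e e0.
have [p Hp] := fz _ (half_gt0 e0); have [q Hq] := gz _ (half_gt0 e0).
exists (p + q) => w wQ; rewrite hornerD opprD addrACA (splitr e).
by apply: le_trans (normcD _ _) _; rewrite lerD ?Hp ?Hq.
Qed.

Lemma poly_approxZ z (Q : R) c f : poly_approx z Q f ->
  poly_approx z Q (fun x => c * f x).
Proof.
move=> fz e e0; have c1 : 0 < normc c + 1 by rewrite ltr_wpDl ?normc_ge0.
have [p Hp] := fz _ (divr_gt0 e0 c1).
exists (c *: p) => w wQ; rewrite hornerZ -mulrBr normcM.
apply: (@le_trans _ _ ((normc c + 1) * (e / (normc c + 1)))).
  by rewrite ler_pM ?normc_ge0 ?Hp// lerDl.
by rewrite mulrC divfK// gt_eqF.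
Qed.

Lemma poly_approx_cst z (Q : R) c : poly_approx z Q (fun=> c).
Proof.
by move=> e e0; exists c%:P => w _; rewrite hornerC subrr normc0 ltW.
Qed.

Lemma poly_approx_sum z (Q : R) n (F : 'I_n -> R[i] -> R[i]) :
  (forall i, poly_approx z Q (F i)) -> poly_approx z Q (fun x => \sum_(i < n) F i x).
Proof.
elim: n F => [|n IH] F HF.
  by under [fun x => _]eq_fun do rewrite big_ord0; exact: poly_approx_cst.
under [fun x => _]eq_fun do rewrite big_ord_recr/=.
apply: (@poly_approxD _ _ (fun x => \sum_(i < n) F (widen_ord (leqnSn n) i) x)) => //.
by apply: IH => i; exact: HF.
Qed.

Lemma poly_approx_horner z (Q : R) p : poly_approx z Q (fun x => p.[x]).
Proof.
move=> e e0; exists (p \Po ('X + z%:P)) => w _.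
by rewrite horner_comp hornerD hornerX hornerC [w + z]addrC subrr normc0 ltW.
Qed.

Lemma horner_taylor1 p : exists2 B : R, 0 <= B & forall w, normc w <= 1 ->
  normc (p.[w] - p.[0] - p`_1 * w) <= B * normc w ^+ 2.
Proof.
elim/poly_ind: p => [|p c [B B0 HB]].
  exists 0 => // w _; rewrite !horner0 coef0 mul0r !subr0 normc0 mul0r//.
exists (normc p`_1 + B); first by rewrite addr_ge0 ?normc_ge0.
move=> w w1; rewrite !(hornerD, hornerM, hornerX, hornerC) coefD coefMX coefC/= addr0.
have -> : p.[w] * w + c - (p.[0] * 0 + c) - p`_0 * w =
    w * (p`_1 * w + (p.[w] - p.[0] - p`_1 * w)) by rewrite horner_coef0; ring.
rewrite normcM [X in _ <= X]mulrC expr2 -mulrA ler_wpM2l ?normc_ge0//.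
apply: le_trans (normcD _ _) _; rewrite normcM mulrDr mulrC lerD2l.
apply: le_trans (HB _ w1) _; rewrite expr2 mulrA [leRHS]mulrC.
by rewrite ler_piMr// mulr_ge0 ?normc_ge0.
Qed.

(** By Cauchy's inequality the linear coefficients of the approximating polynomials form a Cauchy
    sequence; its limit is the derivative. *)
Lemma poly_approx_coef_cvg z (Q : R) f : 0 < Q -> poly_approx z Q f ->
  exists l, forall e : R, 0 < e -> exists2 d : R, 0 < d & forall w, normc w <= d ->
    normc (f (z + w) - f z - l * w) <= e * normc w.
Proof.
move=> Q0 fz.
have n1 n : (0 : R) < n.+1%:R^-1 by rewrite invr_gt0.
have [p Hp] := choice (fun n => fz _ (n1 n)).
have coefBle m n k : normc (p m - p n)`_k * Q ^+ k <= m.+1%:R^-1 + n.+1%:R^-1.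
  apply: cauchy_coef; first exact: ltW.
  move=> w wQ; rewrite hornerD hornerN.
  apply: le_trans (normcBD _ (f (z + w)) _) _; rewrite normcBC.
  by rewrite lerD// Hp ?wQ.
have inv_small (e : R) : 0 < e -> exists N, forall n, (N <= n)%N -> n.+1%:R^-1 <= e.
  move=> e0; have /cvgR_normP/(_ _ e0) [N HN] := @cvg_harmonic R.
  by exists N => n /HN; rewrite /harmonic/= subr0 ger0_norm// ltW.
have : cvgn (fun n => (p n)`_1).
  apply: cauchyc_cvg => e e0.
  have [N HN] := inv_small _ (half_gt0 (mulr_gt0 e0 Q0)); exists N => m n Nm Nn.
  have := coefBle m n 1%N; rewrite coefB expr1 -ler_pdivlMr// => h.
  apply: le_trans h _; rewrite ler_pdivrMr// (splitr (e * Q)).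
  by rewrite lerD// HN.
move=> /cvg_ex [l /cvgc_normcP pl]; exists l => e e0.
(* Uniform closeness alone would lose the factor |w|. It is recovered by applying [horner_sub0_le]
   to [p N - p m] and letting N grow. *)
have diff m w : normc w <= Q / 2 ->
    normc ((f (z + w) - f z) - ((p m).[w] - (p m).[0])) <= 2 * m.+1%:R^-1 / Q * normc w.
  move=> wQ; have w0 := normc_ge0 w.
  have nwQ : normc w <= Q by apply: le_trans wQ _; lra.
  apply/ler_addgt0Pr => d d0.
  pose c := 2 * normc w / Q + 2.
  have c0 : 0 < c by rewrite ltr_wpDl// divr_ge0// ?mulr_ge0// ltW.
  have [N /(_ _ (leqnn _)) HN] := inv_small _ (divr_gt0 d0 c0).
  have h := horner_sub0_le Q0 (coefBle N m) wQ; move: h.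
  rewrite !(hornerD, hornerN) => h.
  have f0 := Hp N 0; rewrite normc0 addr0 in f0; move: (f0 (ltW Q0)) => {}f0.
  have fw := Hp N _ nwQ.
  have : normc (f (z + w) - f z - ((p m).[w] - (p m).[0])) <=
     normc (f (z + w) - (p N).[w]) + normc (f z - (p N).[0]) +
     normc ((p N).[w] - (p m).[w] - ((p N).[0] - (p m).[0])).
    rewrite -[normc (f z - _)]normcNE; apply: le_trans (lerD (normcD _ _) (lexx _)).
    apply: le_trans (normcD _ _).
    by rewrite (_ : _ - _ = f (z + w) - (p N).[w] - (f z - (p N).[0]) +
      ((p N).[w] - (p m).[w] - ((p N).[0] - (p m).[0])))//; ring.
  have : N.+1%:R^-1 * c <= d by rewrite -ler_pdivlMr.
  have E : 2 * (N.+1%:R^-1 + m.+1%:R^-1) / Q * normc w =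
     2 * m.+1%:R^-1 / Q * normc w + N.+1%:R^-1 * (2 * normc w / Q) by ring.
  rewrite {}E in h; rewrite /c; move: h f0 fw.
  by move: (2 * m.+1%:R^-1 / Q * _) N.+1%:R^-1 => u iN; lra.
have e3 : 0 < e / 3 by rewrite divr_gt0.
have [N1 H1] := inv_small _ (divr_gt0 (mulr_gt0 e3 Q0) (ltr0Sn R 1)).
have [N2 H2] := pl _ e3.
pose n := maxn N1 N2.
have [B B0 HB] := horner_taylor1 (p n).
have B1 : 0 < B + 1 by lra.
pose d := Num.min (Q / 2) (Num.min 1 (e / 3 / (B + 1))).
exists d; first by rewrite /d !lt_min ltr01 !divr_gt0.
move=> w; rewrite /d !le_min => /and3P[wQ w1 wB]; have w0 := normc_ge0 w.
have h1 := diff n w wQ; have h2 := HB w w1.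
have h3 := H2 n (leq_maxr _ _); have h4 := H1 n (leq_maxl _ _).
have : normc (f (z + w) - f z - l * w) <=
    normc (f (z + w) - f z - ((p n).[w] - (p n).[0])) +
    normc ((p n).[w] - (p n).[0] - (p n)`_1 * w) + normc ((p n)`_1 - l) * normc w.
  rewrite -normcM; apply: le_trans (lerD (normcD _ _) (lexx _)).
  apply: le_trans (normcD _ _).
  by rewrite (_ : _ - _ = f (z + w) - f z - ((p n).[w] - (p n).[0]) +
    ((p n).[w] - (p n).[0] - (p n)`_1 * w) + ((p n)`_1 - l) * w)//; ring.
have : 2 * n.+1%:R^-1 / Q * normc w <= e / 3 * normc w.
  by rewrite ler_wpM2r// ler_pdivrMr//; move: h4; move: n.+1%:R^-1 => iN; lra.
have : normc ((p n)`_1 - l) * normc w <= e / 3 * normc w by rewrite ler_wpM2r.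
have : B * normc w ^+ 2 <= e / 3 * normc w.
  rewrite expr2 mulrA ler_wpM2r//.
  move: wB; rewrite ler_pdivlMr// => h; apply: le_trans h.
  by rewrite mulrC ler_wpM2l//; lra.
move=> h5 h6 h7 h8; apply: le_trans h8 _.
rewrite [leRHS](_ : _ = e / 3 * normc w + e / 3 * normc w + e / 3 * normc w); last by field.
by rewrite !lerD// ?(le_trans h1)// (le_trans h2).
Qed.

Lemma poly_approx_derivable z (Q : R) f : 0 < Q -> poly_approx z Q f ->
  derivable f z 1.
Proof.
move=> Q0 /(poly_approx_coef_cvg Q0)[l Hl].
apply/cvg_ex; exists l => /= A /nbhs_normc[e e0 eA].
have [d d0 Hd] := Hl _ (half_gt0 e0).
apply/nbhs_normc; exists d => // w; rewrite subr0 => wd w0; apply: eA.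
have nw : 0 < normc w by rewrite normc_gt0.
rewrite /GRing.scale/= mulr1 [w + z]addrC.
have -> : w^-1 * (f (z + w) - f z) - l = w^-1 * (f (z + w) - f z - l * w) by field.
rewrite normcM normcV ltr_pdivrMl// [ltRHS]mulrC.
by apply: le_lt_trans (Hd _ (ltW wd)) _; rewrite ltr_pM2r// ltr_pdivrMr// ltr_pMr// ltr1n.
Qed.

Lemma poly_approx_continuous z (Q : R) f : 0 < Q -> poly_approx z Q f ->
  {for z, continuous f}.
Proof.
move=> Q0 /(poly_approx_coef_cvg Q0)[l Hl] A /nbhs_normc[e e0 eA].
have [d d0 Hd] := Hl _ ltr01.
have c0 : 0 < normc l + 1 by rewrite ltr_wpDl ?normc_ge0.
apply/nbhs_normc; exists (Num.min d (e / (normc l + 1))).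
  by rewrite lt_min d0 divr_gt0.
move=> y; rewrite lt_min => /andP[yd ye]; apply: eA.
have := Hd _ (ltW yd); rewrite [z + _]addrC subrK mul1r => h.
move: ye; rewrite ltr_pdivlMr// => h2.
have := normcD (f y - f z - l * (y - z)) (l * (y - z)).
rewrite subrK normcM; lra.
Qed.

Lemma poly_approx_bounded z (Q : R) f : poly_approx z Q f ->
  exists2 B : R, 0 <= B & forall w, normc w <= Q -> normc (f (z + w)) <= B.
Proof.
move=> /(_ _ ltr01)[p Hp].
have [|Q0] := ltP Q 0.
  by exists 0 => // w wQ; have := normc_ge0 w; lra.
exists (1 + \sum_(i < size p) normc p`_i * Q ^+ i).
  by rewrite addr_ge0// sumr_ge0// => i _; rewrite mulr_ge0 ?normc_ge0 ?exprn_ge0.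
move=> w wQ; rewrite -[f _](subrK p.[w]); apply: le_trans (normcD _ _) _.
rewrite lerD ?Hp// horner_coef; apply: le_trans (normc_sum _ _ _) _.
apply: ler_sum => i _; rewrite normcM ler_wpM2l ?normc_ge0// normcX.
by rewrite lerXn2r ?nnegrE ?normc_ge0.
Qed.

(** Polynomials close to f are small on the disc of radius r and bounded on that of radius Q, hence
    small at w by [horner_propagation]. *)
Lemma poly_approx_identity z (r Q : R) f : 0 < r -> poly_approx z Q f ->
  (forall w, normc w <= r -> f (z + w) = 0) ->
  forall w, normc w < Q -> f (z + w) = 0.
Proof.
move=> r0 fz f0 w wQ.
have [wr|rw] := leP (normc w) r; first exact: f0.
have rQ : r <= Q by apply/ltW/(lt_trans rw).
have [B B0 HB] := poly_approx_bounded fz.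
apply/eqP; rewrite -normc_eq0 eq_le normc_ge0 andbT.
apply/ler_addgt0Pr => e e0; rewrite add0r.
have B1 : 0 <= B + 1 by lra.
have [d d0 Hd] := horner_propagation r0 (normc_ge0 w) wQ B1 (half_gt0 e0).
pose d' := Num.min (Num.min d 1) (e / 2).
have d'0 : 0 < d' by rewrite /d' !lt_min d0 ltr01 half_gt0.
have d'd : d' <= d by rewrite /d' !ge_min lexx.
have d'1 : d' <= 1 by rewrite /d' !ge_min lexx orbT.
have d'e : d' <= e / 2 by rewrite /d' !ge_min lexx !orbT.
have [p Hp] := fz _ d'0.
have Q0 : 0 <= Q by apply/ltW/(lt_le_trans r0).
rewrite -[f _](subrK p.[w]); apply: le_trans (normcD _ _) _.
rewrite (splitr e) lerD ?(le_trans (Hp _ (ltW wQ)))//.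
apply: Hd => // k; apply: cauchy_coef => //; first exact: ltW.
  move=> x xr; have := Hp x; rewrite f0 ?xr// sub0r normcNE => /(_ rQ) h.
  exact: le_trans d'd.
move=> x xQ; have := Hp x; rewrite xQ => /(_ (lexx _)) h.
have := HB x; rewrite xQ => /(_ (lexx _)) h'.
by have := normcBD 0 (f (z + x)) p.[x]; rewrite !sub0r !normcNE; lra.
Qed.

(** The interior Z of the zero set is open, and closed relative to D by [poly_approx_identity]; a
    point with [f z != 0] would separate D into Z and its complement. *)
Lemma identity_theorem (D : set R[i]) f z0 : open D -> connected D ->
  (forall z (Q : R), 0 < Q -> (forall w, normc w <= Q -> D (z + w)) -> poly_approx z Q f) ->
  D z0 -> nbhs z0 [set z | f z = 0] -> forall z, D z -> f z = 0.
Proof.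
move=> oD cD fD Dz0 f0.
pose Z := [set z | D z /\ nbhs z [set x | f x = 0]].
have /connectedP : connected D by [].
move=> /(_ (fun b : bool => if b then Z else D `\` Z)) H z Dz.
apply: contrapT => fz; apply: H; split => //.
- case; first by exists z0.
  by exists z; split=> // -[_ /nbhs_singleton].
- apply/seteqP; split=> x => [Dx|[[]//|[]//]].
  by have [Zx|nZx] := pselect (Z x); [right|left].
split.
- apply/seteqP; split=> // x [cx [Dx xZ]].
  have : nbhs x Z.
    have Dx' : nbhs x D by exact: open_nbhs_nbhs.
    move: xZ => /nbhs_interior xZ; near=> y; split; [near: y|near: y] => //.
  by move=> /cx [y [[_]]].
- apply/seteqP; split=> // x [[Dx nZx] clx]; apply: nZx; split; first exact: Dx.
  have /nbhs_normc[e e0 eD] : nbhs x D by exact: open_nbhs_nbhs.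
  have e4 : 0 < e / 4 by rewrite divr_gt0.
  have /clx [y [[Dy /nbhs_normc[r r0 ry]] /= ye]] :
      nbhs x [set y | normc (y - x) < e / 4] by apply/nbhs_normc; exists (e / 4).
  (* Around y, at distance less than e / 4 from x, the disc of radius e / 2 stays in D and covers
     the disc of radius e / 4 around x, so f vanishes near x. *)
  have yD w : normc w <= e / 2 -> D (y + w).
    move=> we; apply: eD; rewrite addrAC; apply: le_lt_trans (normcD _ _) _; lra.
  have r2 := half_gt0 r0.
  apply/nbhs_normc; exists (e / 4) => // u ux /=.
  have -> : u = y + (u - y) by ring.
  apply: (poly_approx_identity r2 (fD _ _ (half_gt0 e0) yD)).
    by move=> w wr; apply: ry; rewrite addrC addKr; lra.
  by apply: le_lt_trans (normcBD _ x _) _; rewrite [normc (x - y)]normcBC; lra.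
Unshelve. all: by end_near. Qed.

Lemma continuous_normc : continuous (@normc R : R[i] -> R).
Proof.
move=> z A /nbhs_ballP[e /= e0 eA]; apply/nbhs_normc; exists e => // y yz.
apply: eA; rewrite -ball_normE /=.
apply: le_lt_trans yz; rewrite ler_norml.
by have := normcBl z y; have := normcBl y z; rewrite (normcBC z); lra.
Qed.

Lemma compact_disc (r : R) : compact [set z : R[i] | normc z <= r].
Proof.
pose h (u : R * R) : R[i] := u.1 +i* u.2.
have ch : continuous h.
  move=> u A /nbhs_normc[e e0 eA].
  have e2 := half_gt0 e0.
  have : \forall v \near u, ball u (e / 2) v by exact: nbhsx_ballx.
  apply: filterS => v [/= v1 v2]; apply: eA.
  apply: le_lt_trans (normc_ReIm_le _) _; rewrite /h /=.
  move: v1 v2; rewrite -!ball_normE /= distrC [X in _ -> X < _ -> _]distrC; lra.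
apply: (@subclosed_compact _ _ (h @` (`[- r, r] `*` `[- r, r]))).
- apply: (@preimage_closed _ _ (@normc R) [set x | x <= r]); last exact: closed_le.
  by move=> z _; exact: continuous_normc.
- apply: continuous_compact; first exact: continuous_subspaceT.
  by apply: compact_setX; exact: segment_compact.
- move=> z /= zr; exists (Re z, complex.Im z); last by case: z {zr}.
  rewrite /= !in_itv/= -!ler_norml; split.
    exact: le_trans (Re_le_normc _) _.
  exact: le_trans (Im_le_normc _) _.
Qed.

Lemma poly_approx_zerofree_bound z (Q Q' : R) f : 0 <= Q -> Q < Q' ->
  poly_approx z Q' f -> (forall w, normc w <= Q -> f (z + w) != 0) ->
  exists2 m : R, 0 < m & forall w, normc w <= Q -> m <= normc (f (z + w)).
Proof.
move=> Q0 QQ' fz f0.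
have cf : {within [set w | normc w <= Q], continuous (fun w => normc (f (z + w)))}.
  apply/continuous_in_subspaceT => w; rewrite inE/= => wQ.
  apply: continuous_comp; last exact: continuous_normc.
  apply: (@continuous_comp _ _ _ (+%R z) f).
    move=> A /nbhs_normc[e e0 eA]; apply/nbhs_normc; exists e => // y yw.
    by apply: eA; rewrite opprD addrACA subrr add0r.
  apply: (@poly_approx_continuous _ (Q' - Q)); first by rewrite subr_gt0.
  apply: poly_approx_shift fz; rewrite addrAC subrr add0r; lra.
have [] := compact_EVT_min _ (@compact_disc Q) cf.
  by exists 0 => /=; move: Q0; rewrite -{1}(@normc0 R).
move=> c; rewrite inE/= => cQ Hc; exists (normc (f (z + c))).
  by rewrite normc_gt0 f0.
by move=> w wQ; apply: Hc; rewrite inE.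
Qed.

(** On the compact disc |f| has a positive minimum m. A polynomial within [t * m] of f is zero-free
    and has |p| / |f| between 1 - t and 1 + t, so the polynomial case applies with slightly enlarged
    exponents. *)
Lemma zerofree_growth (r s Q C e : R) :
  0 < r -> r < Q -> 0 <= s -> s < Q -> 0 <= C -> 0 < e ->
  exists2 d : R, 0 < d & forall f z (Q' L : R), 0 < L -> Q < Q' ->
    poly_approx z Q' f ->
    (forall w, normc w <= Q -> f (z + w) != 0) ->
    (forall w, normc w <= Q -> normc (f (z + w)) <= expR (L * C) * normc (f z)) ->
    (forall w, normc w <= r -> normc (f (z + w)) <= expR (L * d) * normc (f z)) ->
    forall w, normc w <= s -> normc (f (z + w)) <= expR (L * e) * normc (f z).
Proof.
move=> r0 rQ s0 sQ C0 e0; have C1 : 0 <= C + 1 by lra.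
have [d d0 Hd] := zerofree_horner_growth r0 rQ s0 sQ C1 (half_gt0 e0).
exists (d / 2); first exact: half_gt0.
move=> f z Q' L L0 QQ' fz f0 fC fd.
have Q0 : 0 <= Q by rewrite ltW//; exact: le_lt_trans sQ.
have [m m0 Hm] := poly_approx_zerofree_bound Q0 QQ' fz f0.
pose x := L * Num.min (d / 2) (Num.min 1 (e / 2)).
have x0 : 0 < x by rewrite mulr_gt0// !lt_min ltr01 !half_gt0.
have xd : x <= L * (d / 2) by rewrite ler_pM2l// ge_min lexx.
have x1 : x <= L * 1 by rewrite ler_pM2l// !ge_min lexx orbT.
have xe : x <= L * (e / 2) by rewrite ler_pM2l// !ge_min lexx !orbT.
(* This t solves (1 + t) / (1 - t) = 1 + x, and 1 + x <= exp x: the exchange of f and p costs a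
   factor exp x, which the slack in each of the three exponents pays for. *)
pose t := x / (2 + x).
have t0 : 0 < t by rewrite divr_gt0//; lra.
have t1 : t < 1 by rewrite /t ltr_pdivrMr; lra.
have tx : (1 + t) = (1 - t) * (1 + x) by rewrite /t; field; rewrite gt_eqF//; lra.
have ex : 1 + x <= expR x by exact: expR_ge1Dx.
have [p Hp] := fz _ (mulr_gt0 t0 m0).
have pf w : normc w <= Q -> (1 - t) * normc (f (z + w)) <= normc p.[w] /\
    normc p.[w] <= (1 + t) * normc (f (z + w)).
  move=> wQ; have h1 := Hp _ (le_trans wQ (ltW QQ')).
  have h2 : t * m <= t * normc (f (z + w)) by rewrite ler_pM2l// Hm.
  have h3 := normcBl (f (z + w)) p.[w]; have h4 := normcBl p.[w] (f (z + w)).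
  by rewrite normcBC in h4; split; lra.
have p0 := pf 0; rewrite normc0 addr0 in p0; have {p0}[p0 _] := p0 Q0.
have step w (B B' : R) : normc w <= Q -> x + L * B <= L * B' ->
    normc (f (z + w)) <= expR (L * B) * normc (f z) ->
    normc p.[w] <= expR (L * B') * normc p.[0].
  move=> wQ BB' h; have [_ pw] := pf w wQ; apply: le_trans pw _.
  apply: (@le_trans _ _ (expR x * expR (L * B) * ((1 - t) * normc (f z)))).
    have -> : expR x * expR (L * B) * ((1 - t) * normc (f z)) =
        (1 - t) * (expR x * (expR (L * B) * normc (f z))) by ring.
    rewrite tx -mulrA ler_pM2l ?subr_gt0//.
    by rewrite ler_pM ?normc_ge0//; lra.
  by rewrite ler_pM ?mulr_ge0 ?expR_ge0 ?normc_ge0 ?subr_ge0 ?(ltW t1)// -expRD ler_expR.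
have sQ' w : normc w <= s -> normc w <= Q by move=> ws; rewrite (le_trans ws) ?ltW.
have pQ w : normc w <= Q -> p.[w] != 0.
  move=> wQ; rewrite -normc_gt0; apply: lt_le_trans (pf w wQ).1.
  by rewrite mulr_gt0 ?subr_gt0 ?normc_gt0 ?f0.
move=> w ws.
have := Hd p L L0 pQ _ _ w ws.
have h1 u : normc u <= Q -> normc p.[u] <= expR (L * (C + 1)) * normc p.[0].
  by move=> uQ; apply: (step u C) => //; [lra|exact: fC].
have h2 u : normc u <= r -> normc p.[u] <= expR (L * d) * normc p.[0].
  move=> ur; apply: (step u (d / 2)) => //; [|lra|exact: fd].
  by rewrite (le_trans ur) ?ltW.
move=> /(_ h1 h2) h3.
have [fw _] := pf w (sQ' _ ws).
have p0' := pf 0; rewrite normc0 addr0 in p0'; have {p0'}[_ p0'] := p0' Q0.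
rewrite -(@ler_pM2l _ (1 - t)) ?subr_gt0//; apply: le_trans fw _; apply: le_trans h3 _.
apply: (@le_trans _ _ (expR (L * (e / 2)) * ((1 - t) * (expR x * normc (f z))))).
  rewrite ler_pM2l ?expR_gt0//; apply: le_trans p0' _.
  by rewrite tx mulrA ler_wpM2r ?normc_ge0// ler_pM2l ?subr_gt0.
rewrite [leLHS](_ : _ = (1 - t) * (expR (L * (e / 2)) * expR x * normc (f z))); last by ring.
rewrite ler_pM2l ?subr_gt0// ler_wpM2r ?normc_ge0// -expRD ler_expR; lra.
Qed.

End PolynomialApproximation.

(** * Sections of prescribed exponential growth *)

Section Limsup.
Context {R : realType}.
Local Open Scope ereal_scope.

Lemma limn_esup_le (u : nat -> \bar R) (c : \bar R) N :
  (forall n, (N <= n)%N -> u n <= c) -> limn_esup u <= c.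
Proof.
move=> H; apply: (@le_trans _ _ (ereal_sup (u @` [set n | (N <= n)%N]))).
  by apply: ereal_inf_lbound; exists [set n | (N <= n)%N] => //; exists N.
by apply: ge_ereal_sup => _ [n /= Nn <-]; exact: H.
Qed.

Lemma limn_esup_lt (u : nat -> \bar R) (c : \bar R) :
  limn_esup u < c -> exists N, forall n, (N <= n)%N -> u n < c.
Proof.
move=> /ereal_inf_lt[_ [A [N _ NA] <-] Ac]; exists N => n Nn.
by apply: le_lt_trans Ac; apply: ereal_sup_ubound; exists n => //; exact: NA.
Qed.

End Limsup.

(** * Compact convergence and sublevel sets *)

Section CompactConvergence.
Context {R : realType}.
Implicit Types (f : nat -> R[i] -> R[i]) (g : R[i] -> R[i]) (D K : set R[i]).

Lemma compact_cvgP f D g : compact_cvg f D g <->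
  forall K, compact K -> K `<=` D -> forall e : R, 0 < e ->
    exists N, forall n, (N <= n)%N -> forall z, K z -> normc (f n z - g z) <= e.
Proof.
split=> [/fam_cvgP fg K cK KD e e0|H].
  have nb : nbhs (g : {uniform` K -> R[i]})
      [set h | forall y, K y -> normc (g y - h y) <= e].
    apply/uniform_nbhs; exists [set xy : R[i] * R[i] | normc (xy.1 - xy.2) <= e].
    split=> //; rewrite -entourage_ballE; exists e%:C; first by rewrite /= ltcR.
    by move=> [x y] /=; rewrite -ball_normE /= normr_normc ltcR => /ltW.
  have [N _ HN] := fg K (conj KD cK) _ nb.
  by exists N => n Nn z Kz; rewrite normcBC; exact: HN.
apply/fam_cvgP => K [KD cK] A /uniform_nbhs[E [entE EA]].
move: entE; rewrite -entourage_ballE => -[e /= e0 eE].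
have eR : e = (complex.Re e)%:C by rewrite RRe_real// gtr0_real.
have e1 : 0 < complex.Re e by move: e0; rewrite {1}eR ltcR.
have [N HN] := H K cK KD _ (half_gt0 e1).
exists N => // n /= Nn; apply: EA => z Kz; apply: eE => /=.
rewrite -ball_normE /= normr_normc eR ltcR normcBC.
by apply: le_lt_trans (HN _ Nn _ Kz) _; rewrite ltr_pdivrMr// ltr_pMr// ltr1n.
Qed.

Lemma compact_normc_bounded K : compact K ->
  exists2 M : R, 0 <= M & forall z, K z -> normc z <= M.
Proof.
move=> cK; have [->|/set0P K0] := eqVneq K set0; first by exists 0.
have [c _ Hc] := compact_EVT_max K0 cK (continuous_subspaceT (@continuous_normc R)).
by exists (normc c); [exact: normc_ge0|move=> z Kz; apply: Hc; rewrite inE].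
Qed.

Lemma compact_sublevel_le (w : R[i] -> R) (r : R) K : continuous w -> 0 < r ->
  compact K -> K `<=` sublevel w r ->
  exists2 r' : R, r' < r & forall z, K z -> w z <= r'.
Proof.
move=> cw r0 cK KD; have [->|/set0P K0] := eqVneq K set0.
  by exists 0.
have [c cin Hc] := compact_EVT_max K0 cK (continuous_subspaceT cw).
exists (w c); first by apply: KD; rewrite -inE.
by move=> z Kz; apply: Hc; rewrite inE.
Qed.

Lemma open_sublevel (w : R[i] -> R) (r : R) : continuous w -> open (sublevel w r).
Proof.
by move=> cw; rewrite openE => z zr; exact: (cw z _ (lt_nbhsl zr)).
Qed.

Lemma open_superlevel (w : R[i] -> R) (r : R) : continuous w -> open [set z | r < w z].
Proof.
by move=> cw; rewrite openE => z zr; exact: (cw z _ (lt_nbhsr zr)).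
Qed.

Lemma open_disc (z : R[i]) (r : R) : open [set y | normc (y - z) < r].
Proof.
rewrite openE => y /= yr; apply/nbhs_normc; exists (r - normc (y - z)).
  by rewrite subr_gt0.
by move=> x xy /=; apply: le_lt_trans (normcBD _ y _) _; lra.
Qed.

Lemma compact_closed_disc (z : R[i]) (r : R) : compact [set y | normc (y - z) <= r].
Proof.
have -> : [set y | normc (y - z) <= r] = (fun x => z + x) @` [set x | normc x <= r].
  apply/seteqP; split=> y /= => [yr|[x xr <-]]; last by rewrite addrAC subrr add0r.
  by exists (y - z) => //; rewrite addrC subrK.
apply: continuous_compact (@compact_disc R r); apply: continuous_subspaceT => x A.
move=> /nbhs_normc[e e0 eA]; apply/nbhs_normc; exists e => // y yw.
by apply: eA; rewrite opprD addrACA subrr add0r.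
Qed.

End CompactConvergence.

(** The exceptional set S is a parameter: it is [realS] for Kapteyn series and empty for the other
    types. *)
Definition growth_conclusion {R : realType} (f : nat -> R[i] -> R[i]) (lam : nat -> R)
    (w : R[i] -> R) (rho : R) (S : set R[i]) : Prop :=
  let D := sublevel w rho in
  let mu := growth_function f lam in
  proper_height w /\
  admissible_exponents f lam /\
  convergence_level f w = rho%:E /\
  (exists g : R[i] -> R[i],
     [/\ compact_cvg f D g, is_holomorphic D g & ~ is_constant D g]) /\
  (forall z : R[i],
     ~ ((fun n => f n z) @ \oo --> (0 : R[i]) /\ w z <= rho) -> ~ S z ->
     mu z = maxe 1%E (rho^-1 * w z)%:E) /\
  [set z | rho < w z] `<=` [set z | (1 < mu z)%E] `|` [set z | w z = 1] /\
  (forall z, boundary D z -> zero_cluster_point f z) /\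
  open D /\ pointwise_cvg f D /\
  (forall U : set R[i], open U -> pointwise_cvg f U -> U `<=` D).

(** * The growth theorem for abstract sections *)

Section GrowthTheorem.
Context {R : realType}.
Context (f : nat -> R[i] -> R[i]) (lam : nat -> R) (w : R[i] -> R) (rho : R)
  (S : set R[i]).
Let D := sublevel w rho.
Context (w_height : proper_height w) (lam_incr : increasing_to_infinity lam)
  (rho_gt0 : 0 < rho).
Context (f_entire : forall n z Q, poly_approx z Q (f n)).
Context (f_exp_bound : forall M : R, 0 <= M -> exists2 C : R, 0 <= C &
  exists N, forall n, (N <= n)%N -> forall z, normc z <= M ->
    normc (f n z) <= expR (lam n * C)).
(** The bound M on |z| accompanies [w z <= r] because the sublevel sets of a Dirichlet series are
    half-planes, on which convergence need not be uniform. *)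
Context (f_cauchy : forall M r, 0 <= M -> r < rho -> forall e : R, 0 < e ->
  exists N, forall m n, (N <= m)%N -> (N <= n)%N -> forall z, normc z <= M -> w z <= r ->
    normc (f m z - f n z) <= e).
Context (f_growth_le : forall z (L : R), 0 < L -> w z < rho * expR L ->
  exists N, forall n, (N <= n)%N -> normc (f n z) <= expR (lam n * L)).
(** A negated eventual bound is the exact counterpart of a lower bound for a limsup; no single n can
    be prescribed. *)
Context (f_growth_ge : forall z (L : R), ~ S z -> 0 < L -> rho * expR L < w z ->
  ~ exists N, forall n, (N <= n)%N -> normc (f n z) <= expR (lam n * L)).
Context (S_interior : forall U : set R[i], open U -> U !=set0 -> U `\` S !=set0).
Context (S_height1 : forall z, S z -> w z = 1).
Context (D_connected : connected D).
Context (f_nonconstant : forall c, ~ forall z, D z -> (fun n => f n z) @ \oo --> (c : R[i])).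
Context (w_onto : exists z, w z = rho).

Let w_cont : continuous w. Proof. by case: w_height. Qed.
Let g (z : R[i]) : R[i] := limn (fun n => f n z).

Lemma lam_large (B : R) : exists N, forall n, (N <= n)%N -> B <= lam n.
Proof.
case: lam_incr => _ /cvgryPge/(_ B)[N _ HN]; exists N => n Nn; exact: HN.
Qed.

Let f_cauchy_on K : compact K -> K `<=` D -> forall e : R, 0 < e ->
  exists N, forall m n, (N <= m)%N -> (N <= n)%N -> forall z, K z ->
    normc (f m z - f n z) <= e.
Proof.
move=> cK KD e e0; have [M M0 HM] := compact_normc_bounded cK.
have [r rr Hr] := compact_sublevel_le w_cont rho_gt0 cK KD.
have [N HN] := f_cauchy M0 rr e0; exists N => m n Nm Nn z Kz.
by apply: HN; [| |exact: HM|exact: Hr].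
Qed.

Let f_cvg z : D z -> (fun n => f n z) @ \oo --> g z.
Proof.
move=> Dz; suff : cvgn (fun n => f n z) by [].
apply: cauchyc_cvg => e e0.
have [|N HN] := @f_cauchy_on [set z] (@compact_set1 _ z) _ e e0.
  by move=> _ ->.
by exists N => m n Nm Nn; apply: HN.
Qed.

Let f_cvg_on K : compact K -> K `<=` D -> forall e : R, 0 < e ->
  exists N, forall n, (N <= n)%N -> forall z, K z -> normc (f n z - g z) <= e.
Proof.
move=> cK KD e e0; have [N HN] := f_cauchy_on cK KD (half_gt0 e0).
exists N => n Nn z Kz.
have /cvgc_normcP/(_ _ (half_gt0 e0))[N' HN'] := f_cvg (KD _ Kz).
apply: le_trans (normcBD _ (f (maxn N N') z) _) _.
by rewrite (splitr e) lerD ?HN' ?leq_maxr// HN// leq_maxl.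
Qed.

Lemma sections_compact_cvg : compact_cvg f D g.
Proof. by apply/compact_cvgP => K cK KD e e0; exact: f_cvg_on. Qed.

Let g_approx z (Q : R) : (forall x, normc x <= Q -> D (z + x)) -> poly_approx z Q g.
Proof.
move=> HD; apply: poly_approx_uniform_limit (fun n => f_entire n z Q) _ => e e0.
have [|N HN] := f_cvg_on (@compact_closed_disc R z Q) _ e0.
  by move=> y /= /HD; rewrite addrC subrK.
by exists N => x xQ; apply: HN => //=; rewrite addrAC subrr add0r.
Qed.

Let D_open : open D. Proof. exact: open_sublevel. Qed.

Lemma disc_in_open (U : set R[i]) z : open U -> U z ->
  exists2 r : R, 0 < r & forall x, normc x <= r -> U (z + x).
Proof.
move=> oU Uz; have /nbhs_normc[e e0 eU] : nbhs z U by exact: open_nbhs_nbhs.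
exists (e / 2); first exact: half_gt0.
by move=> x xe; apply: eU; rewrite addrAC subrr add0r; lra.
Qed.

Lemma limit_holomorphic : is_holomorphic D g.
Proof.
move=> z Dz; have [r r0 rD] := disc_in_open D_open Dz.
exact: poly_approx_derivable r0 (g_approx rD).
Qed.

Lemma limit_not_constant : ~ is_constant D g.
Proof.
move=> [c gc]; apply: (f_nonconstant (c := c)) => z Dz.
by rewrite -(gc z Dz); exact: f_cvg.
Qed.

(** As z is no local maximum, U contains points higher than z; they include a nonempty open set,
    which S cannot cover. *)
Let height_above z (U : set R[i]) : open U -> U z -> rho <= w z ->
  exists2 y, U y & rho < w y /\ ~ S y.
Proof.
move=> oU Uz rz; case: w_height => _ _ _ /(_ z (lt_le_trans rho_gt0 rz)) nmax.
have [y Uy wy] : exists2 y, U y & w z < w y.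
  apply: contrapT => H; apply: nmax.
  have : nbhs z U by exact: open_nbhs_nbhs.
  apply: filterS => x Ux; rewrite leNgt; apply/negP => wx; apply: H; by exists x.
pose V := U `&` [set x | rho < w x].
have oV : open V.
  by apply: openI => //; exact: open_superlevel.
have [x [[Ux rx] Sx]] := S_interior oV (ex_intro _ y (conj Uy (le_lt_trans rz wy))).
by exists x.
Qed.

Let bounded_growth (B L : R) : 0 < L -> exists N, forall n, (N <= n)%N ->
  B <= expR (lam n * L).
Proof.
move=> L0; have [N HN] := lam_large (B / L); exists N => n /HN.
rewrite ler_pdivrMr// => h; apply: le_trans (expR_ge1Dx _).
by apply: le_trans h _; rewrite lerDr.
Qed.

Let no_cvg_above z : rho < w z -> ~ S z -> ~ cvgn (fun n => f n z).
Proof.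
move=> rz nS /cvg_ex[l /cvgc_normcP/(_ _ ltr01)[N HN]].
pose L := ln (w z / rho) / 2.
have wr : 1 < w z / rho by rewrite ltr_pdivlMr// mul1r.
have lnwr : 0 < ln (w z / rho) by rewrite ln_gt0.
have L0 : 0 < L by rewrite divr_gt0.
have rL : rho * expR L < w z.
  rewrite mulrC -ltr_pdivlMr// -[ltRHS]lnK ?posrE ?(lt_trans ltr01)//.
  by rewrite ltr_expR /L ltr_pdivrMr// ltr_pMr// ltr1n.
apply: (f_growth_ge nS L0 rL).
have [N' HN'] := bounded_growth (1 + normc l) L0.
exists (maxn N N') => n; rewrite geq_max => /andP[Nn N'n].
apply: le_trans (HN' _ N'n); rewrite -[f n z](subrK l).
by apply: le_trans (normcD _ _) _; rewrite lerD2r HN.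
Qed.

(** The passage from roots of order [lam n] to exponential bounds, the form in which growth is
    handled everywhere else. *)
Lemma nth_growthE z n (L : R) : 0 < lam n ->
  (nth_growth f lam z n <= expR L) = (normc (f n z) <= expR (lam n * L)).
Proof.
move=> l0; rewrite /nth_growth.
have nf := normc_ge0 (f n z).
apply/idP/idP => [h|h].
  have := ge0_ler_powR (ltW l0) _ _ h.
  rewrite !nnegrE powR_ge0 expR_ge0 => /(_ isT isT).
  by rewrite -powRrM mulVf ?gt_eqF// powRr1// -expRM mulrC.
have il0 : 0 <= (lam n)^-1 by rewrite invr_ge0 ltW.
have := ge0_ler_powR il0 _ _ h.
rewrite !nnegrE expR_ge0 nf => /(_ isT isT) h'; apply: le_trans h' _.
by rewrite -expRM mulrAC divff ?gt_eqF// mul1r.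
Qed.

Lemma sections_admissible : admissible_exponents f lam.
Proof.
split=> // K cK; have [M M0 HM] := compact_normc_bounded cK.
have [C C0 [N HN]] := f_exp_bound M0; exists (expR C).
have [N' HN'] := lam_large 1.
apply: (limn_esup_le (N := maxn N N')) => n; rewrite geq_max => /andP[Nn N'n].
apply: ge_ereal_sup => _ [z Kz <-]; rewrite lee_fin nth_growthE.
  by apply: HN => //; exact: HM.
exact: lt_le_trans (HN' _ N'n).
Qed.

Let mu := growth_function f lam.

Lemma growth_function_le z : (mu z <= (Num.max 1 (rho^-1 * w z))%:E)%E.
Proof.
apply/lee_addgt0Pr => e e0; set m := Num.max _ _.
have m1 : 1 <= m by rewrite /m le_max lexx.
have me0 : 0 < m + e by lra.
have L0 : 0 < ln (m + e) by rewrite ln_gt0//; lra.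
have [|N HN] := @f_growth_le z _ L0.
  rewrite lnK ?posrE// -ltr_pdivrMl//.
  have : rho^-1 * w z <= m by rewrite /m le_max lexx orbT.
  lra.
have [N' HN'] := lam_large 1.
apply: (limn_esup_le (N := maxn N N')) => n; rewrite geq_max => /andP[Nn N'n].
rewrite -EFinD lee_fin -[leRHS]lnK ?posrE// nth_growthE ?HN//.
exact: lt_le_trans (HN' _ N'n).
Qed.

Let growth_lt z (q : R) : 0 < q -> (mu z < q%:E)%E ->
  exists N, forall n, (N <= n)%N -> normc (f n z) <= expR (lam n * ln q).
Proof.
move=> q0 /limn_esup_lt[N HN]; have [N' HN'] := lam_large 1.
exists (maxn N N') => n; rewrite geq_max => /andP[Nn N'n].
rewrite -nth_growthE ?(lt_le_trans ltr01 (HN' _ N'n))// lnK ?posrE//.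
by have := HN _ Nn; rewrite lte_fin => /ltW.
Qed.

(** For [w z <= rho], a value of mu below 1 forces exponential decay in [lam n], hence convergence
    to 0, which is the excluded case. Above rho, a value below [rho^-1 * w z] contradicts
    [f_growth_ge] at a height q chosen between the two. *)
Lemma growth_functionE z :
  ~ ((fun n => f n z) @ \oo --> (0 : R[i]) /\ w z <= rho) -> ~ S z ->
  mu z = maxe 1%E (rho^-1 * w z)%:E.
Proof.
move=> nz nS; rewrite -EFin_max; apply/eqP; rewrite eq_le growth_function_le/=.
rewrite leNgt; apply/negP => mum; set m := Num.max 1 _ in mum.
have mu0 : (0 <= mu z)%E.
  apply: limf_esup_ge0.
    by move=> [N _ /(_ N (leqnn _))].
  by move=> n; rewrite lee_fin powR_ge0.
have [q0 q0E] : exists q0 : R, mu z = q0%:E.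
  move: mu0 mum; case: (mu z) => // x _ _; by exists x.
rewrite q0E in mum mu0; rewrite lee_fin in mu0; rewrite lte_fin in mum.
have [wr|rw] := leP (w z) rho.
  have m1 : m = 1.
    by apply/max_idPl; rewrite ler_pdivrMl// mulr1.
  rewrite m1 in mum; apply: nz; split=> //.
  pose q := (q0 + 1) / 2; have qgt0 : 0 < q by rewrite /q; lra.
  have [|N HN] := @growth_lt z q qgt0; first by rewrite q0E lte_fin /q; lra.
  have lnq : 0 < - ln q by rewrite oppr_gt0 ln_lt0// qgt0 /q; lra.
  apply/cvgc_normcP => e e0.
  have [N' HN'] := bounded_growth e^-1 lnq.
  exists (maxn N N') => n; rewrite geq_max => /andP[Nn N'n]; rewrite subr0.
  apply: le_trans (HN _ Nn) _; have := HN' _ N'n.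
  by rewrite mulrN expRN lef_pV2 ?posrE ?expR_gt0.
have m1 : 1 < rho^-1 * w z by rewrite ltr_pdivlMl// mulr1.
have mE : m = rho^-1 * w z by apply/max_idPr/ltW.
pose q := (Num.max q0 1 + m) / 2.
have [Mq0 M1 Mm] : [/\ q0 <= Num.max q0 1, 1 <= Num.max q0 1 & Num.max q0 1 < m].
  by rewrite !le_max !lexx orbT gt_max mum mE m1.
have q1 : 1 < q by rewrite /q; lra.
have [|N HN] := @growth_lt z q (lt_trans ltr01 q1).
  by rewrite q0E lte_fin /q; lra.
apply: (@f_growth_ge z (ln q)) => //; first by rewrite ln_gt0.
  rewrite lnK ?posrE ?(lt_trans ltr01)// -ltr_pdivlMl// -mE /q; lra.
by exists N.
Qed.

Lemma growth_gt1 : [set z | rho < w z] `<=` [set z | (1 < mu z)%E] `|` [set z | w z = 1].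
Proof.
move=> z /= rz; have [Sz|nS] := pselect (S z); first by right; exact: S_height1.
left; rewrite /= growth_functionE//; last by case=> _; rewrite leNgt rz.
by rewrite lt_max !lte_fin ltr_pdivlMl// mulr1 rz orbT.
Qed.

Lemma sections_convergence_level : convergence_level f w = rho%:E.
Proof.
apply/eqP; rewrite eq_le; apply/andP; split.
  rewrite ge_max lee_fin ltW//=; apply: ge_ereal_sup => _ [r /= [r0 [h fh]] <-].
  rewrite lee_fin leNgt; apply/negP => rr.
  (* A point of height exactly rho lies in the larger sublevel set, and arbitrarily near it there
     are points of divergence. *)
  have [z0 wz0] := w_onto.
  have [||y /= wy [ry Sy]] := @height_above z0 (sublevel w r) (open_sublevel w_cont).
  - by rewrite /sublevel /= wz0.
  - by rewrite wz0.
  apply: (no_cvg_above ry Sy); apply/cvg_ex; exists (h y).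
  apply/cvgc_normcP => e e0.
  have /compact_cvgP/(_ [set y] (@compact_set1 _ y)) := fh.
  move=> /(_ _ _ e0)[|N HN]; first by move=> _ ->.
  by exists N => n Nn; apply: HN.
rewrite le_max; apply/orP; right; apply: ereal_sup_ubound.
by exists rho => //; split=> //; exists g; exact: sections_compact_cvg.
Qed.

Lemma pointwise_cvg_maximal (U : set R[i]) : open U -> pointwise_cvg f U -> U `<=` D.
Proof.
move=> oU fU z Uz; rewrite /D /sublevel /= ltNge; apply/negP => rz.
have [y Uy [ry Sy]] := height_above oU Uz rz.
exact: no_cvg_above ry Sy (fU _ Uy).
Qed.

(** A limit vanishing on an open part of the connected set D would vanish on D, against
    non-constancy. This provides a centre at which |f_n| stays away from 0. *)
Let g_neq0 (U : set R[i]) z : open U -> U z -> D z -> exists2 y, U y & D y /\ g y != 0.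
Proof.
move=> oU Uz Dz; apply: contrapT => H.
apply: (f_nonconstant (c := 0)) => y Dy; rewrite -(_ : g y = 0); first exact: f_cvg.
apply: (identity_theorem D_open D_connected (fun z Q _ h => g_approx h) Dz) => //.
have : nbhs z (U `&` D) by apply: open_nbhs_nbhs; split=> //; exact: openI.
apply: filterS => x [Ux Dx] /=; apply: contrapT => /eqP gx; apply: H; by exists x.
Qed.

Lemma boundary_zero_cluster z0 : boundary D z0 -> zero_cluster_point f z0.
Proof.
rewrite /boundary => -[clz0]; rewrite (interior_id D).1// => nDz0 U oU Uz0 n0.
apply: contrapT => nozero.
have fU n z : (n0 <= n)%N -> U z -> f n z != 0.
  move=> nn0 Uz; apply/negP => /eqP fz; apply: nozero.
  by exists n; split=> //; exists z.
have rz0 : rho <= w z0 by rewrite leNgt; apply/negP => h; exact: nDz0 h.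
have /nbhs_normc[e e0 eU] : nbhs z0 U by exact: open_nbhs_nbhs.
(* Both z1 and z2 will lie within r of z0. The disc of radius 4r around z1 then stays within e of
   z0, where f_n has no zeros, and the disc of radius 2r reaches z2. *)
pose r := e / 8; have r0 : 0 < r by rewrite divr_gt0.
pose B := [set y | normc (y - z0) < r].
have oB : open B by exact: open_disc.
have Bz0 : B z0 by rewrite /B /= subrr normc0.
have [z' [Dz' Bz']] := clz0 _ (open_nbhs_nbhs (conj oB Bz0)).
have [z1 Bz1 [Dz1 gz1]] := g_neq0 oB Bz' Dz'.
have [z2 Bz2 [rz2 Sz2]] := height_above oB Bz0 rz0.
have [r1' r1'0 r1'D] := disc_in_open D_open Dz1.
pose r1 := Num.min r1' r.
have r10 : 0 < r1 by rewrite lt_min r1'0.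
have r1r : r1 <= r by rewrite ge_min lexx orbT.
have r1D x : normc x <= r1 -> D (z1 + x).
  by move=> xr; apply: r1'D; apply: le_trans xr _; rewrite ge_min lexx.
pose L0 := ln (w z2 / rho) / 2.
have wr : 1 < w z2 / rho by rewrite ltr_pdivlMr// mul1r.
have L00 : 0 < L0 by rewrite divr_gt0// ln_gt0.
have rL : rho * expR L0 < w z2.
  rewrite mulrC -ltr_pdivlMr// -[ltRHS]lnK ?posrE ?(lt_trans ltr01)//.
  by rewrite ltr_expR /L0 ltr_pdivrMr// ltr_pMr ?ltr1n// ln_gt0.
apply: (f_growth_ge Sz2 L00 rL).
have M0 : 0 <= normc z0 + e by rewrite addr_ge0 ?normc_ge0// ltW.
have [C C0 [N1 HN1]] := f_exp_bound M0.
have r4 : 0 < 4 * r by rewrite mulr_gt0.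
have [||||| d d0 Hd] := @zerofree_growth R r1 (2 * r) (4 * r) (C + 1) (L0 / 2) r10.
- by apply: le_lt_trans r1r _; lra.
- lra.
- lra.
- lra.
- exact: half_gt0.
pose G := normc (g z1); have G0 : 0 < G by rewrite normc_gt0.
have [B1 B10 HB1] := poly_approx_bounded (g_approx r1D).
have K1D : [set y | normc (y - z1) <= r1] `<=` D.
  by move=> y /= /r1D; rewrite addrC subrK.
have [N2 HN2] := f_cvg_on (@compact_closed_disc R z1 r1) K1D (half_gt0 G0).
have [N3 HN3] := bounded_growth (2 / G) ltr01.
have [N4 HN4] := bounded_growth ((B1 + G / 2) / (G / 2)) d0.
have [N5 HN5] := bounded_growth (2 * G) (half_gt0 L00).
have [N6 HN6] := lam_large 1.
exists (maxn n0 (maxn N1 (maxn N2 (maxn N3 (maxn N4 (maxn N5 N6)))))) => n.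
rewrite !geq_max => /and5P[nn0 nN1 nN2 nN3 /and3P[nN4 nN5 nN6]].
have z1U x : normc x <= 4 * r -> normc (z1 + x - z0) < e.
  move=> xr; rewrite addrAC; apply: le_lt_trans (normcD _ _) _.
  by move: Bz1; rewrite /B /= /r; move: xr; rewrite /r; lra.
have fz1 : G / 2 <= normc (f n z1).
  have := HN2 _ nN2 z1; rewrite /= subrr normc0 => /(_ (ltW r10)).
  by have := normcBl (g z1) (f n z1); rewrite normcBC -/G; lra.
have fz1' : normc (f n z1) <= 2 * G.
  have := HN2 _ nN2 z1; rewrite /= subrr normc0 => /(_ (ltW r10)).
  by have := normcBl (f n z1) (g z1); rewrite -/G; lra.
have -> : z2 = z1 + (z2 - z1) by rewrite addrC subrK.
have l0 : 0 < lam n by exact: lt_le_trans (HN6 _ nN6).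
have -> : lam n * L0 = lam n * (L0 / 2) + lam n * (L0 / 2) by field.
rewrite expRD.
apply: (@le_trans _ _ (expR (lam n * (L0 / 2)) * normc (f n z1))); last first.
  by rewrite ler_pM2l ?expR_gt0//; apply: le_trans fz1' _; exact: HN5.
apply: (Hd (f n) z1 (5 * r) (lam n) l0) => //.
- by rewrite ltr_pM2r// ltr_nat.
- by move=> x xr; apply: fU => //; apply: eU; exact: z1U.
- move=> x xr; rewrite mulrDr mulr1 expRD.
  apply: (@le_trans _ _ (expR (lam n * C))).
    apply: HN1 => //; have := z1U x xr; have := normcBl (z1 + x) z0; lra.
  rewrite -mulrA ler_peMr ?expR_ge0//.
  have := HN3 _ nN3; rewrite mulr1 => h.
  have : 2 / G * (G / 2) <= expR (lam n) * normc (f n z1).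
    by rewrite ler_pM// ?divr_ge0// ltW.
  by rewrite mulrA divfK ?gt_eqF// divff.
- move=> x xr.
  have h1 : normc (f n (z1 + x)) <= B1 + G / 2.
    have := HN2 _ nN2 (z1 + x); rewrite /= addrAC subrr add0r => /(_ xr).
    by have := HB1 x xr; have := normcBl (f n (z1 + x)) (g (z1 + x)); lra.
  apply: le_trans h1 _; have := HN4 _ nN4; rewrite ler_pdivrMr ?half_gt0// => h.
  by apply: le_trans h _; rewrite ler_pM2l ?expR_gt0.
- have -> : z2 - z1 = (z2 - z0) - (z1 - z0) by ring.
  apply: le_trans (normcB _ _) _; move: Bz1 Bz2; rewrite /B /=; lra.
Qed.

Theorem growth_theorem : growth_conclusion f lam w rho S.
Proof.
split=> //; split; first exact: sections_admissible.
split; first exact: sections_convergence_level.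
split.
  exists g; split; [exact: sections_compact_cvg|exact: limit_holomorphic|].
  exact: limit_not_constant.
split; first exact: growth_functionE.
split; first exact: growth_gt1.
split; first exact: boundary_zero_cluster.
split=> //; split; last exact: pointwise_cvg_maximal.
by move=> z Dz; apply/cvg_ex; exists (g z); exact: f_cvg.
Qed.

End GrowthTheorem.

(** * Series in functions comparable to [beta n * w z ^+ n] *)

Section PowerTypeSeries.
Context {R : realType}.

(** Any gap between the exponents absorbs the factor n + 1, which is the number of terms of a
    section, or the loss in the lower bound for phi_n. *)
Lemma linear_exp_le (B m L : R) : m < L -> exists N, forall n, (N <= n)%N ->
  B * n.+1%:R * expR (n%:R * m) <= expR (n%:R * L).
Proof.
move=> mL; pose d := (L - m) / 2; have d0 : 0 < d by rewrite /d; lra.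
pose B' := `|B| * expR d / d.
have B'0 : 0 <= B'.
  by apply: divr_ge0; [rewrite mulr_ge0 ?expR_ge0|exact: ltW].
pose N := Num.bound (B' / d); exists N => n Nn.
have Bn : B' <= expR (n%:R * d).
  apply: le_trans (expR_ge1Dx _).
  have : B' / d <= n%:R.
    apply: le_trans (ltW (archi_boundP _)) _; first by rewrite divr_ge0// ltW.
    by rewrite ler_nat.
  by rewrite ler_pdivrMr// => h; apply: le_trans h _; rewrite lerDr.
have n1 : n.+1%:R <= expR d * expR (n%:R * d) / d.
  rewrite ler_pdivlMr// -expRD -{2}[d]mul1r -mulrDl addrC natr1.
  by apply: le_trans (expR_ge1Dx _); rewrite lerDr.
have -> : n%:R * L = n%:R * d + (n%:R * d + n%:R * m) by rewrite /d; field.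
rewrite expRD [expR (_ + n%:R * m)]expRD mulrA ler_wpM2r ?expR_ge0//.
apply: (@le_trans _ _ (`|B| * (expR d * expR (n%:R * d) / d))).
  apply: le_trans (ler_norm _) _; rewrite normrM ler_wpM2l// ger0_norm//.
have -> : `|B| * (expR d * expR (n%:R * d) / d) = B' * expR (n%:R * d) by rewrite /B'; ring.
by rewrite ler_wpM2r ?expR_ge0.
Qed.

Lemma geometric_tail (t e A : R) : 0 <= t -> t < 1 -> 0 < e ->
  exists N, forall m n, (N <= n)%N -> (n <= m)%N -> A * \sum_(n <= k < m) t ^+ k <= e.
Proof.
move=> t0 t1 e0.
have /cvgR_normP H : (fun n => `|A| / (1 - t) * t ^+ n) @ \oo --> `|A| / (1 - t) * 0.
  by apply: cvgMr; apply: cvg_expr; rewrite ger0_norm.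
have [N HN] := H _ e0; exists N => m n Nn nm.
have := HN _ Nn; rewrite mulr0 subr0 => /(le_trans (ler_norm _)); apply: le_trans.
have S0 : 0 <= \sum_(n <= k < m) t ^+ k by apply: sumr_ge0 => k _; rewrite exprn_ge0.
apply: (@le_trans _ _ (`|A| * \sum_(n <= k < m) t ^+ k)).
  by rewrite ler_wpM2r// ler_norm.
rewrite -!mulrA ler_wpM2l// -{1}(add0n n) big_addn big_mkord.
under eq_bigr => i _ do rewrite exprD mulrC.
rewrite -mulr_sumr [leRHS]mulrC ler_wpM2l ?exprn_ge0//.
have := subrX1 t (m - n); rewrite -[_ - 1]opprB -[t - 1]opprB mulNr.
move=> /oppr_inj /esym E; rewrite -[leRHS]mul1r ler_pdivlMr ?subr_gt0//.
by rewrite mulrC E gerBl exprn_ge0.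
Qed.

Context (phi : nat -> R[i] -> R[i]) (beta : nat -> R) (w : R[i] -> R).
Context (beta_ge0 : forall n, 0 <= beta n) (w_ge0 : forall z, 0 <= w z).
Context (w_bounded : forall M : R, 0 <= M ->
  exists2 W : R, 0 <= W & forall z, normc z <= M -> w z <= W).
Context (phi_le : forall M : R, 0 <= M -> exists2 C : R, 0 <= C &
  forall n z, normc z <= M -> normc (phi n z) <= C * (beta n * w z ^+ n)).

Let sect (a : nat -> R[i]) n z := \sum_(k < n.+1) a k * phi k z.

Lemma sect_diff_le a (A q C r : R) m n z : 0 <= A -> 0 <= q -> 0 <= C -> w z <= r ->
  (forall k, normc (a k) * beta k <= A * q ^+ k) ->
  (forall k, normc (phi k z) <= C * (beta k * w z ^+ k)) ->
  (n <= m)%N -> normc (sect a m z - sect a n z) <= A * C * \sum_(n.+1 <= k < m.+1) (q * r) ^+ k.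
Proof.
move=> A0 q0 C0 zr aq ph nm.
rewrite /sect -!(big_mkord predT (fun k => a k * phi k z)).
rewrite (big_cat_nat (leq0n n.+1) (nm : n.+1 <= m.+1)%N)/= [X in X - _]addrC addrK.
apply: le_trans (normc_sum _ _ _) _; rewrite mulr_sumr; apply: ler_sum => k _.
rewrite normcM exprMn.
apply: (@le_trans _ _ (normc (a k) * (C * (beta k * w z ^+ k)))).
  by rewrite ler_wpM2l ?normc_ge0.
rewrite [leLHS](_ : _ = (normc (a k) * beta k) * (C * w z ^+ k)); last by ring.
rewrite [leRHS](_ : _ = (A * q ^+ k) * (C * r ^+ k)); last by ring.
rewrite ler_pM ?mulr_ge0 ?normc_ge0 ?exprn_ge0//.
by rewrite ler_wpM2l// lerXn2r ?nnegrE// (le_trans _ zr).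
Qed.

Lemma sect_le a (A q C x : R) n z : 0 <= A -> 0 <= q -> 0 <= C ->
  (forall k, normc (a k) * beta k <= A * q ^+ k) ->
  (forall k, normc (phi k z) <= C * (beta k * w z ^+ k)) ->
  0 <= x -> q * w z <= expR x ->
  normc (sect a n z) <= A * C * n.+1%:R * expR (n%:R * x).
Proof.
move=> A0 q0 C0 aq ph x0 qx.
apply: le_trans (normc_sum _ _ _) _.
rewrite [leRHS](_ : _ = \sum_(k < n.+1) A * C * expR (n%:R * x)); last first.
  by rewrite sumr_const card_ord -mulr_natl; ring.
apply: ler_sum => -[k /= kn] _; rewrite normcM.
apply: (@le_trans _ _ (normc (a k) * (C * (beta k * w z ^+ k)))).
  by rewrite ler_wpM2l ?normc_ge0.
rewrite [leLHS](_ : _ = (normc (a k) * beta k) * (C * w z ^+ k)); last by ring.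
apply: (@le_trans _ _ ((A * q ^+ k) * (C * w z ^+ k))).
  by rewrite ler_wpM2r ?mulr_ge0 ?exprn_ge0.
rewrite [leLHS](_ : _ = A * C * (q * w z) ^+ k); last by rewrite exprMn; ring.
rewrite ler_wpM2l ?mulr_ge0//.
apply: (@le_trans _ _ (expR x ^+ k)).
  by rewrite lerXn2r ?nnegrE ?mulr_ge0 ?expR_ge0.
by rewrite -expRM_natl ler_expR ler_wpM2r// ler_nat.
Qed.

Section Coefficients.
Context (w_lin : exists2 B : R, 0 <= B & forall z, normc z <= 1 -> w z <= B * normc z).
Context (phi_ge0 : forall m, exists2 c : R, 0 < c & exists2 d : R, 0 < d &
  forall z, normc z <= d -> c * normc z ^+ m <= normc (phi m z)).

(** Once the coefficients before m vanish, [a m * phi m z] is cancelled in the limit by the later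
    terms, which are of order |z|^(m+1), whereas |phi_m| is at least c |z|^m; let z tend to 0. *)
Lemma coefficients_eq0 (a : nat -> R[i]) (A q d : R) : 0 <= A -> 0 <= q -> 0 < d ->
  (forall k, normc (a k) * beta k <= A * q ^+ k) ->
  (forall z, normc z <= d -> (fun n => sect a n z) @ \oo --> (0 : R[i])) ->
  forall k, a k = 0.
Proof.
move=> A0 q0 d0 aq a0 m; elim/ltn_ind: m => m IH.
have [B B0 HB] := w_lin; have [c c0 [d1 d10 Hc]] := phi_ge0 m.
have [C C0 HC] := phi_le (@ler01 R).
pose K := 2 * (A * C * (q * B) ^+ m.+1) / c.
have K0 : 0 <= K by rewrite divr_ge0 ?mulr_ge0 ?exprn_ge0 ?mulr_ge0// ltW.
(* The last bound keeps the ratio [q * (B * t)] of the tail at most 1/2, so the tail is at most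
   twice its first term. *)
pose d2 := Num.min (Num.min d d1) (Num.min 1 (2^-1 / (q * B + 1))).
have qB1 : 0 < q * B + 1 by rewrite ltr_wpDl ?mulr_ge0.
have d20 : 0 < d2 by rewrite !lt_min d0 d10 ltr01 divr_gt0.
have small t : 0 < t -> t <= d2 -> normc (a m) <= K * t.
  move=> t0; rewrite !le_min => /andP[/andP[td td1] /andP[t1 tq]].
  pose z : R[i] := t%:C; have nz : normc z = t by rewrite normcR gtr0_norm.
  have wz : w z <= B * t by rewrite -nz HB ?nz.
  have qt : q * (B * t) <= 2^-1.
    rewrite ler_pdivlMr// mulrDr mulr1 in tq.
    by apply: le_trans tq; rewrite -[leLHS]addr0 lerD ?(ltW t0)//; lra.
  have qt0 : 0 <= q * (B * t) by rewrite !mulr_ge0// ltW.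
  have E n : (m <= n)%N -> sect a n z - a m * phi m z =
      sect a n z - sect a m z.
    move=> mn; congr (_ - _); rewrite /sect big_ord_recr/= big1 ?add0r// => -[k km] _ /=.
    by rewrite IH// mul0r.
  have h : normc (a m * phi m z) <= A * C * (2 * (q * (B * t)) ^+ m.+1).
    apply/ler_addgt0Pr => e e0.
    have /cvgc_normcP/(_ _ e0)[N HN] := a0 z (eq_ind_r (fun x => x <= d) td nz).
    set n := maxn N m; have := HN n (leq_maxl _ _); rewrite subr0 => h1.
    have : normc (sect a n z - sect a m z) <= A * C * (2 * (q * (B * t)) ^+ m.+1).
      apply: le_trans (sect_diff_le A0 q0 C0 wz aq _ (leq_maxr N m)) _.
        by move=> k; apply: HC; rewrite nz.
      rewrite ler_wpM2l ?mulr_ge0// -{1}(add0n m.+1) big_addn big_mkord.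
      under eq_bigr => i _ do rewrite exprD mulrC.
      rewrite -mulr_sumr [leRHS]mulrC ler_wpM2l ?exprn_ge0//.
      set u := q * (B * t) in qt qt0 *.
      have := subrX1 u (maxn N m).+1; set p := (_ - _)%N => _.
      have := subrX1 u p; set Su := (\sum_(i < p) _) => h2.
      have up : 0 <= u ^+ p by rewrite exprn_ge0.
      have Su0 : 0 <= Su by apply: sumr_ge0 => i _; rewrite exprn_ge0.
      nra.
    rewrite -(E n (leq_maxr _ _)) => h2.
    have -> : a m * phi m z = sect a n z - (sect a n z - a m * phi m z) by ring.
    by apply: le_trans (normcB _ _) _; rewrite addrC lerD.
  have h3 := Hc z (eq_ind_r (fun x => x <= d1) td1 nz); rewrite nz in h3.
  have h4 : normc (a m) * (c * t ^+ m) <= A * C * (2 * (q * (B * t)) ^+ m.+1).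
    by apply: le_trans h; rewrite normcM ler_wpM2l ?normc_ge0.
  rewrite -(@ler_pM2r _ (c * t ^+ m)) ?mulr_gt0 ?exprn_gt0//.
  apply: le_trans h4 _; rewrite /K.
  rewrite [leRHS](_ : _ = 2 * (A * C * (q * B) ^+ m.+1) * (t * t ^+ m)); last first.
    by field; rewrite gt_eqF.
  rewrite -exprS (mulrA q) [(q * B * t) ^+ _]exprMn [leLHS](_ : _ =
    2 * (A * C * (q * B) ^+ m.+1) * t ^+ m.+1)//; ring.
apply/eqP; rewrite -normc_eq0 eq_le normc_ge0 andbT.
apply/ler_addgt0Pr => e e0; rewrite add0r.
pose t := Num.min d2 (e / (K + 1)).
have K1 : 0 < K + 1 by lra.
have t0 : 0 < t by rewrite lt_min d20 divr_gt0.
have td2 : t <= d2 by rewrite ge_min lexx.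
apply: le_trans (small t t0 td2) _.
have : t <= e / (K + 1) by rewrite ge_min lexx orbT.
rewrite ler_pdivlMr// => h; apply: le_trans h; rewrite mulrC ler_wpM2l//.
  exact: ltW.
by rewrite lerDl.
Qed.

End Coefficients.

Context (a : nat -> R[i]) (rho : R) (S : set R[i]).
Let D := sublevel w rho.
Let lam (n : nat) : R := n%:R.
Context (rho_gt0 : 0 < rho).
Context (phi_entire : forall n z Q, poly_approx z Q (phi n)).
Context (w_height : proper_height w).
Context (coef_le : forall L, - ln rho < L -> exists N, forall n, (N <= n)%N ->
  normc (a n) * beta n <= expR (n%:R * L)).
Context (coef_ge : forall L, L < - ln rho -> ~ exists N, forall n, (N <= n)%N ->
  normc (a n) * beta n <= expR (n%:R * L)).
Context (phi_ge : forall z, ~ S z -> 0 < w z -> exists2 c : R, 0 < c & exists N,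
  forall n, (N <= n)%N -> c / n.+1%:R * (beta n * w z ^+ n) <= normc (phi n z)).
Context (S_interior : forall U : set R[i], open U -> U !=set0 -> U `\` S !=set0).
Context (S_height1 : forall z, S z -> w z = 1).
Context (D_connected : connected D).
Context (f_nonconstant : forall c, ~ forall z, D z ->
  (fun n => sect a n z) @ \oo --> (c : R[i])).
Context (w_onto : exists z, w z = rho).

Lemma coef_le_all L : - ln rho < L -> exists2 A : R, 0 <= A & forall n,
  normc (a n) * beta n <= A * expR L ^+ n.
Proof.
move=> /coef_le[N HN].
exists (1 + \sum_(k < N) normc (a k) * beta k / expR L ^+ k).
  by rewrite addr_ge0// sumr_ge0// => k _; rewrite divr_ge0 ?mulr_ge0 ?normc_ge0 ?exprn_ge0 ?expR_ge0.
move=> n; have [Nn|nN] := leqP N n.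
  apply: le_trans (HN _ Nn) _; rewrite expRM_natl ler_peMl ?exprn_ge0 ?expR_ge0//.
  by rewrite lerDl sumr_ge0// => k _; rewrite divr_ge0 ?mulr_ge0 ?normc_ge0 ?exprn_ge0 ?expR_ge0.
rewrite -ler_pdivrMr ?exprn_gt0 ?expR_gt0// (bigD1 (Ordinal nN))//=.
rewrite addrCA lerDl addr_ge0// sumr_ge0// => k _.
by rewrite divr_ge0 ?mulr_ge0 ?normc_ge0 ?exprn_ge0 ?expR_ge0.
Qed.

Theorem power_type_theorem : growth_conclusion (sect a) lam w rho S.
Proof.
apply: growth_theorem => //.
- split; first by move=> m n mn; rewrite ltr_nat.
  by apply/cvgryPge => A; exists (Num.bound `|A|) => // n /= An;
    apply: le_trans (ler_norm A) _; apply: le_trans (ltW (archi_boundP (normr_ge0 A))) _;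
    rewrite ler_nat.
- by move=> n z Q; apply: poly_approx_sum => i; exact: poly_approxZ.
- move=> M M0; have [C C0 HC] := phi_le M0; have [W W0 HW] := w_bounded M0.
  have L0 : - ln rho < 1 - ln rho by lra.
  have [A A0 HA] := coef_le_all L0.
  pose x := expR (1 - ln rho) * W.
  have x0 : 0 <= x by rewrite mulr_ge0 ?expR_ge0.
  exists (x + 1); first by lra.
  have [|N HN] := @linear_exp_le (A * C) x (x + 1); first by rewrite ltrDl.
  exists N => n Nn z zM; apply: le_trans (HN _ Nn).
  have HCz k : normc (phi k z) <= C * (beta k * w z ^+ k) by exact: HC.
  apply: (@sect_le a A (expR (1 - ln rho)) C x n z A0 (expR_ge0 _) C0 HA HCz x0).
  apply: le_trans (expR_ge1Dx _); apply: (@le_trans _ _ x); last by lra.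
  by rewrite ler_wpM2l ?expR_ge0// HW.
- move=> M r M0 rr e e0; have [C C0 HC] := phi_le M0.
  pose r' := Num.max r (rho / 2).
  have r'0 : 0 < r' by rewrite lt_max half_gt0// orbT.
  have r'r : r' < rho by rewrite gt_max rr/= ltr_pdivrMr// ltr_pMr// ltr1n.
  pose L := (- ln rho - ln r') / 2.
  have lnr : ln r' < ln rho by rewrite ltr_ln ?posrE.
  have L0 : - ln rho < L by rewrite /L; lra.
  have [A A0 HA] := coef_le_all L0.
  have t1 : expR L * r' < 1.
    have -> : expR L * r' = expR (L + ln r') by rewrite expRD lnK ?posrE.
    by rewrite expR_lt1 /L; lra.
  have t0 : 0 <= expR L * r' by rewrite mulr_ge0 ?expR_ge0// ltW.
  have [N HN] := @geometric_tail _ _ (A * C) t0 t1 e0.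
  have main m n z : (N <= n)%N -> (n <= m)%N -> normc z <= M -> w z <= r ->
      normc (sect a m z - sect a n z) <= e.
    move=> Nn nm zM zr.
    have zr' : w z <= r' by rewrite le_max zr.
    apply: le_trans (sect_diff_le A0 (expR_ge0 _) C0 zr' HA _ nm) _ => [k|].
      exact: HC.
    by apply: HN => //; exact: leqW.
  exists N => m n Nm Nn z zM zr.
  have [nm|mn] := leqP n m; first exact: main.
  by rewrite normcBC; apply: main => //; exact: ltnW.
- move=> z L L0 wL; have [C C0 HC] := phi_le (normc_ge0 z).
  (* The exponent must be nonnegative for the n-th power to dominate all earlier ones, hence the
     maximum with 0; this is the 1 in the formula for mu. *)
  have [x x0 [xL wx]] : exists2 x : R, 0 <= x & x < L /\ w z <= rho * expR x.
    have [wz0|wz] := eqVneq (w z) 0.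
      by exists 0 => //; rewrite wz0 mulr_ge0 ?expR_ge0// ltW.
    have wz0 : 0 < w z by rewrite lt_def wz w_ge0.
    have lnE : expR (ln (w z / rho)) = w z / rho by rewrite lnK// posrE divr_gt0.
    exists (Num.max 0 (ln (w z / rho))); first by rewrite le_max lexx.
    rewrite gt_max L0 /= -ltr_expR lnE ltr_pdivrMr// mulrC wL; split=> //.
    have : expR (ln (w z / rho)) <= expR (Num.max 0 (ln (w z / rho))).
      by rewrite ler_expR le_max lexx orbT.
    by rewrite {1}lnE ler_pdivrMr// mulrC.
  pose d := (L - x) / 2; have d0 : 0 < d by rewrite /d; lra.
  have Ld : - ln rho < d - ln rho by lra.
  have [A A0 HA] := coef_le_all Ld.
  have [|N HN] := @linear_exp_le (A * C) (x + d) L; first by rewrite /d; lra.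
  exists N => n Nn; apply: le_trans (HN _ Nn).
  have HCz k : normc (phi k z) <= C * (beta k * w z ^+ k) by exact: HC.
  apply: (@sect_le a A (expR (d - ln rho)) C (x + d) n z A0 (expR_ge0 _) C0 HA HCz).
    by rewrite addr_ge0// ltW.
  rewrite expRB lnK ?posrE// expRD mulrAC ler_pdivrMr// [leRHS]mulrAC.
  by rewrite mulrC ler_wpM2r ?expR_ge0// mulrC.
(* The difference of consecutive sections is [a n * phi n z]. Dividing by the lower bound for phi_n
   bounds the coefficients by the exponent L - ln (w z), up to a factor n + 1; it lies below - ln
   rho, against [coef_ge]. The [N.+1] below makes the previous section available. *)
- move=> z L nS L0 wL [N HN].
  have w0 : 0 < w z by apply: le_lt_trans wL; rewrite mulr_ge0 ?expR_ge0// ltW.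
  have [c c0 [N' HN']] := phi_ge nS w0.
  pose m := L - ln (w z).
  have mr : m < - ln rho.
    rewrite /m ltrBlDr -ltrBlDl opprK -[L]expRK -lnM ?posrE ?expR_gt0//.
    by rewrite ltr_ln ?posrE ?mulr_gt0 ?expR_gt0// mulrC.
  pose L' := (m - ln rho) / 2.
  have mL' : m < L' by rewrite /L'; lra.
  have [N'' HN''] := linear_exp_le (2 / c) mL'.
  apply: (@coef_ge L'); first by rewrite /L'; lra.
  exists (maxn N.+1 (maxn N' N'')) => n; rewrite !geq_max => /and3P[Nn N'n N''n].
  apply: le_trans (HN'' _ N''n).
  case: n Nn N'n N''n => [//|n] Nn N'n N''n.
  have h1 : normc (a n.+1 * phi n.+1 z) <= 2 * expR (n.+1%:R * L).
    have -> : a n.+1 * phi n.+1 z = sect a n.+1 z - sect a n z.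
      by rewrite /sect [X in _ = X - _]big_ord_recr/= [X in _ = X - _]addrC addrK.
    apply: le_trans (normcB _ _) _; rewrite mulr_natl mulr2n lerD//.
      by apply: HN; exact: ltnW.
    apply: (le_trans (HN _ _)) => //.
    by rewrite ler_expR ler_wpM2r ?ler_nat// ltW.
  have h2 := HN' _ N'n.
  rewrite normcM in h1.
  have h3 : normc (a n.+1) * (c / n.+2%:R * (beta n.+1 * w z ^+ n.+1)) <=
      2 * expR (n.+1%:R * L).
    by apply: le_trans h1; rewrite ler_wpM2l ?normc_ge0.
  rewrite /m mulrBr expRB [expR (_ * ln _)]expRM_natl lnK ?posrE//.
  rewrite mulrA ler_pdivlMr ?exprn_gt0//.
  rewrite [leRHS](_ : _ = (2 * expR (n.+1%:R * L)) * (n.+2%:R / c)); last by ring.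
  rewrite -ler_pdivrMr ?divr_gt0//; apply: le_trans h3.
  rewrite [leLHS](_ : _ = normc (a n.+1) * (c / n.+2%:R * (beta n.+1 * w z ^+ n.+1)))//.
  have : (n.+2%:R : R) != 0 by rewrite pnatr_eq0.
  by move: (n.+2%:R : R) => N2 N20; field; rewrite N20 gt_eqF.
Qed.

End PowerTypeSeries.

(** The root formula for rho, split into an upper and a lower statement on coefficients. The
    relation between x and y starts at n = 1, as the root of order 0 is a default value. *)
Lemma limn_esup_root_growth {R : realType} (x y : nat -> R) (rho : R) : 0 < rho ->
  (forall n, 0 <= x n) -> (forall n, (0 < n)%N -> x n ^+ n = y n) ->
  (rho%:E^-1)%E = limn_esup (fun n => (x n)%:E) ->
  (forall L, - ln rho < L -> exists N, forall n, (N <= n)%N -> y n <= expR (n%:R * L)) /\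
  (forall L, L < - ln rho -> ~ exists N, forall n, (N <= n)%N -> y n <= expR (n%:R * L)).
Proof.
move=> r0 x0 xy; have -> : (rho%:E^-1 = (expR (- ln rho))%:E)%E.
  by rewrite inver gt_eqF// expRN lnK.
move=> E; split=> L hL.
  have /limn_esup_lt[N HN] : (limn_esup (fun n => (x n)%:E) < (expR L)%:E)%E.
    by rewrite -E lte_fin ltr_expR.
  exists (maxn N 1) => n; rewrite geq_max => /andP[/HN Nn n1].
  rewrite -xy// expRM_natl lerXn2r ?nnegrE ?expR_ge0//.
  by move: Nn; rewrite lte_fin => /ltW.
move=> [N HN].
have : (limn_esup (fun n => (x n)%:E) <= (expR L)%:E)%E.
  apply: (limn_esup_le (N := maxn N 1)) => n; rewrite geq_max => /andP[Nn n1].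
  have := HN _ Nn; rewrite -xy// expRM_natl lee_fin.
  by rewrite ler_pXn2r ?nnegrE ?expR_ge0.
by rewrite -E lee_fin ler_expR leNgt hL.
Qed.

(** * Curves in the complex plane and the exponential *)

Section ComplexCurve.
Context {R : realType}.
Implicit Types (g h : R -> R[i]) (x : R) (a b : R[i]).
Local Notation Re := (@complex.Re R).
Local Notation Im := (@complex.Im R).

(** Differentiation is used along real curves only; the componentwise form gives access to the real
    mean value theorem. *)
Definition has_cderiv g x a :=
  has_deriv (fun t => Re (g t)) x (Re a) /\ has_deriv (fun t => Im (g t)) x (Im a).

Lemma has_cderiv_eq g x a b : has_cderiv g x a -> a = b -> has_cderiv g x b.
Proof. by move=> ga <-. Qed.

Lemma has_cderivD g h x a b : has_cderiv g x a -> has_cderiv h x b ->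
  has_cderiv (fun t => g t + h t) x (a + b).
Proof.
move=> [ga ga'] [hb hb']; split; rewrite ?ReD ?ImD.
  by under [fun t => Re _]eq_fun do rewrite ReD; exact: has_derivD.
by under [fun t => Im _]eq_fun do rewrite ImD; exact: has_derivD.
Qed.

Lemma has_cderivN g x a : has_cderiv g x a -> has_cderiv (fun t => - g t) x (- a).
Proof.
move=> [ga ga']; split; rewrite ?ReN ?ImN.
  by under [fun t => Re _]eq_fun do rewrite ReN; exact: has_derivN.
by under [fun t => Im _]eq_fun do rewrite ImN; exact: has_derivN.
Qed.

Lemma has_cderivB g h x a b : has_cderiv g x a -> has_cderiv h x b ->
  has_cderiv (fun t => g t - h t) x (a - b).
Proof. by move=> ga hb; apply: has_cderivD => //; exact: has_cderivN. Qed.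

Lemma has_cderivM g h x a b : has_cderiv g x a -> has_cderiv h x b ->
  has_cderiv (fun t => g t * h t) x (a * h x + g x * b).
Proof.
move=> [ga ga'] [hb hb']; split.
  under [fun t => Re _]eq_fun do rewrite ReM.
  apply: has_deriv_eq (has_derivB (has_derivM ga hb) (has_derivM ga' hb')) _.
  by rewrite ReD !ReM; ring.
under [fun t => Im _]eq_fun do rewrite ImM.
apply: has_deriv_eq (has_derivD (has_derivM ga hb') (has_derivM ga' hb)) _.
by rewrite ImD !ImM; ring.
Qed.

Lemma has_cderiv_cst a x : has_cderiv (fun=> a) x 0.
Proof. by split; exact: has_deriv_cst. Qed.

Lemma has_cderivR (f : R -> R) x (l : R) : has_deriv f x l ->
  has_cderiv (fun t => (f t)%:C) x l%:C.
Proof. by move=> fl; split => //=; exact: has_deriv_cst. Qed.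

Lemma has_cderivZ g x a b : has_cderiv g x a -> has_cderiv (fun t => b * g t) x (b * a).
Proof.
move=> ga; apply: has_cderiv_eq (has_cderivM (has_cderiv_cst b x) ga) _.
by rewrite mul0r add0r.
Qed.

Lemma has_cderiv_id x : has_cderiv (fun t => t%:C) x 1.
Proof. exact: has_cderivR (has_deriv_id x). Qed.

Lemma has_cderivX g x a n : has_cderiv g x a ->
  has_cderiv (fun t => g t ^+ n) x (n%:R * g x ^+ n.-1 * a).
Proof.
move=> ga; elim: n => [|n IH].
  by rewrite mul0r mul0r; exact: has_cderiv_cst.
under [fun t => _]eq_fun do rewrite exprS.
apply: has_cderiv_eq (has_cderivM ga IH) _.
case: n {IH} => [|n]; first by rewrite !expr0; ring.
by rewrite /= exprS -[in RHS]natr1; ring.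
Qed.

Lemma has_cderiv_comp g (f : R -> R) x (l : R) a : has_cderiv g (f x) a ->
  has_deriv f x l -> has_cderiv (fun t => g (f t)) x (l%:C * a).
Proof.
move=> [ga ga'] fl; split; rewrite ?ReRM ?ImRM mulrC.
  exact: (has_deriv_comp ga fl).
exact: (has_deriv_comp ga' fl).
Qed.

Lemma has_cderiv_cexp g x a : has_cderiv g x a ->
  has_cderiv (fun t => cexp (g t)) x (cexp (g x) * a).
Proof.
move=> [ga ga']; rewrite /cexp; split.
  under [fun t => Re _]eq_fun do rewrite ReRM /=.
  apply: has_deriv_eq (has_derivM (has_deriv_expR ga) (has_deriv_cos ga')) _.
  by rewrite !(ReM, ImM) /=; ring.
under [fun t => Im _]eq_fun do rewrite ImRM /=.
apply: has_deriv_eq (has_derivM (has_deriv_expR ga) (has_deriv_sin ga')) _.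
by rewrite !(ReM, ImM) /=; ring.
Qed.

Lemma has_cderiv_sum (I : Type) (s : seq I) (P : pred I) (F : I -> R -> R[i])
    (dF : I -> R[i]) x : (forall i, P i -> has_cderiv (F i) x (dF i)) ->
  has_cderiv (fun t => \sum_(i <- s | P i) F i t) x (\sum_(i <- s | P i) dF i).
Proof.
move=> H; elim: s => [|i s IH].
  rewrite big_nil; under [fun t => _]eq_fun do rewrite big_nil.
  exact: has_cderiv_cst.
rewrite big_cons; under [fun t => _]eq_fun do rewrite big_cons.
by case: ifP => Pi //; apply: has_cderivD => //; exact: H.
Qed.

Lemma has_deriv_sqr_normc g x a : has_cderiv g x a ->
  has_deriv (fun t => normc (g t) ^+ 2) x (2 * Re (a * (g x)^*)).
Proof.
move=> [ga ga']; under [fun t => _]eq_fun do rewrite sqr_normc_ReIm.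
apply: has_deriv_eq (has_derivD (has_derivX 2 ga) (has_derivX 2 ga')) _.
by rewrite Re_mulJ /= !expr1; ring.
Qed.

Lemma has_deriv_quotient (f : R -> R) x (l : R) :
  (forall e : R, 0 < e -> exists2 d : R, 0 < d & forall t, `|t| < d ->
    `|f (x + t) - f x - t * l| <= e * `|t|) -> has_deriv f x l.
Proof.
move=> H.
suff fl : h^-1 *: (f (h *: 1 + x) - f x) @[h --> 0^'] --> l.
  apply: DeriveDef; first by apply/cvg_ex; exists l.
  exact: cvg_lim fl.
apply/cvgrPdist_le => e e0; have [d d0 Hd] := H _ e0.
near=> h; have h0 : h != 0 by near: h; exact: nbhs_dnbhs_neq.
have hd : `|h| < d by near: h; apply: dnbhs0_lt.
rewrite /GRing.scale/= mulr1 [h + x]addrC.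
have -> : l - h^-1 * (f (x + h) - f x) = - (h^-1 * (f (x + h) - f x - h * l)) by field.
rewrite normrN normrM normfV ler_pdivrMl ?normr_gt0// [leRHS]mulrC.
exact: Hd.
Unshelve. all: by end_near. Qed.

Lemma has_cderiv_quotient g x a :
  (forall e : R, 0 < e -> exists2 d : R, 0 < d & forall t, `|t| < d ->
    normc (g (x + t) - g x - t%:C * a) <= e * `|t|) -> has_cderiv g x a.
Proof.
move=> H; split; apply: has_deriv_quotient => e /H[d d0 Hd]; exists d => // t /Hd.
  by apply: le_trans; rewrite -ReRM -!(ReN, ReD) Re_le_normc.
by apply: le_trans; rewrite -ImRM -!(ImN, ImD) Im_le_normc.
Qed.

(** The factor 2 comes from separate mean value points for the real and the imaginary part. *)
Lemma curve_bound g (dg : R -> R[i]) (B : R) :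
  (forall t, 0 <= t <= 1 -> has_cderiv g t (dg t)) ->
  (forall t, 0 <= t <= 1 -> normc (dg t) <= B) -> normc (g 1 - g 0) <= 2 * B.
Proof.
move=> gd dB; apply: le_trans (normc_ReIm_le _) _.
have [c /andP[/ltW c0 /ltW c1]] := mean_value ltr01 (fun t ht => (gd t ht).1).
have [d /andP[/ltW d0 /ltW d1]] := mean_value ltr01 (fun t ht => (gd t ht).2).
rewrite subr0 !mulr1 ReD ReN ImD ImN => -> ->; rewrite mulr_natl mulr2n lerD//.
  by apply: le_trans (Re_le_normc _) (dB _ _); rewrite c0 c1.
by apply: le_trans (Im_le_normc _) (dB _ _); rewrite d0 d1.
Qed.

End ComplexCurve.

(** * Truncated exponential series *)

Section ExponentialSums.
Context {R : realType}.
Implicit Types (z a b : R[i]).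

Lemma expR_sum_le (x : R) n : 0 <= x -> \sum_(k < n) x ^+ k / k`!%:R <= expR x.
Proof.
move=> x0; rewrite -(big_mkord predT (fun k => x ^+ k / k`!%:R)).
have -> : \sum_(0 <= k < n) x ^+ k / k`!%:R = series (exp_coeff x) n by [].
apply: nondecreasing_cvgn_le (is_cvg_series_exp_coeff x) _.
apply/nondecreasing_seqP => m; rewrite /series/= big_nat_recr//= lerDl.
by rewrite divr_ge0// exprn_ge0.
Qed.

Lemma expR_ge_term (x : R) k : 0 <= x -> x ^+ k / k`!%:R <= expR x.
Proof.
move=> x0; apply: le_trans (expR_sum_le k.+1 x0).
by rewrite big_ord_recr/= lerDr sumr_ge0// => i _; rewrite divr_ge0// exprn_ge0.
Qed.

Lemma exp_term_small (B x e : R) : 0 <= B -> 0 <= x -> 0 < e -> exists N, forall n, (N <= n)%N ->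
  B * (x ^+ n / n`!%:R) <= e.
Proof.
move=> B0 x0 e0; have B1 : 0 < B + 1 by lra.
have /cvgR_normP/(_ _ (divr_gt0 e0 B1))[N HN] := cvg_series_cvg_0 (is_cvg_series_exp_coeff x).
exists N => n /HN; rewrite subr0 => /(le_trans (ler_norm _)).
rewrite /exp_coeff/= => h.
have t0 : 0 <= x ^+ n / n`!%:R by rewrite divr_ge0// exprn_ge0.
move: h; rewrite ler_pdivlMr// => h; apply: le_trans h.
by rewrite mulrC ler_wpM2l//; lra.
Qed.

Lemma exp_tail_small (X e : R) : 0 <= X -> 0 < e -> exists N, forall m n, (N <= n)%N ->
  (n <= m)%N -> forall x, 0 <= x <= X -> \sum_(n <= k < m) x ^+ k / k`!%:R <= e.
Proof.
move=> X0 e0.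
have /cvg_ex[l /cvgR_normP/(_ _ (half_gt0 e0))[N HN]] := is_cvg_series_exp_coeff X.
exists N => m n Nn nm x /andP[x0 xX].
apply: (@le_trans _ _ (\sum_(n <= k < m) X ^+ k / k`!%:R)).
  by apply: ler_sum => k _; rewrite ler_wpM2r// lerXn2r ?nnegrE.
have -> : \sum_(n <= k < m) X ^+ k / k`!%:R = series (exp_coeff X) m - series (exp_coeff X) n.
  by rewrite /series/= (big_cat_nat (leq0n n) nm)/= [X in _ = X - _]addrC addrK.
have := HN m (leq_trans Nn nm); have := HN n Nn.
rewrite !ler_norml; lra.
Qed.

Definition exp_sum n a : R[i] := \sum_(k < n) a ^+ k / k`!%:R.

Lemma normc_exp_sum_le n a : normc (exp_sum n a) <= expR (normc a).
Proof.
apply: le_trans (normc_sum _ _ _) _; apply: le_trans (expR_sum_le n (normc_ge0 a)).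
by apply: ler_sum => k _; rewrite normcM normcX normcV normc_nat.
Qed.

Lemma cexp0 : cexp (0 : R[i]) = 1.
Proof. by rewrite /cexp /= expR0 cos0 sin0 mul1r. Qed.

Lemma cexpD a b : cexp (a + b) = cexp a * cexp b.
Proof.
rewrite /cexp ReD ImD expRD cosD sinD; apply: complexP; rewrite !(ReM, ImM) /=; ring.
Qed.

Lemma cexp_neq0 a : cexp a != 0.
Proof. by rewrite -normc_gt0 normc_cexp expR_gt0. Qed.

Lemma cexpN a : cexp (- a) = (cexp a)^-1.
Proof.
apply: (mulIf (cexp_neq0 a)); rewrite -cexpD addNr cexp0 mulVf//.
exact: cexp_neq0.
Qed.

(* [cexp (-a t) (1 + a t + ... + (a t)^n / n!)] has derivative
   [- a cexp (-a t) (a t)^n / n!]. *)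
Lemma exp_sum_approx n a : normc (exp_sum n.+1 a - cexp a) <=
  2 * expR (2 * normc a) * (normc a * (normc a ^+ n / n`!%:R)).
Proof.
pose g t := cexp (- a * t%:C) * exp_sum n.+1 (a * t%:C).
pose dg t := - a * (cexp (- a * t%:C) * ((a * t%:C) ^+ n / n`!%:R)).
have Hlin b t : has_cderiv (fun t => b * t%:C) t b.
  by apply: has_cderiv_eq (has_cderivZ b (has_cderiv_id t)) _; rewrite mulr1.
have Hg t : has_cderiv g t (dg t).
  have HS : has_cderiv (fun t => exp_sum n.+1 (a * t%:C)) t (a * exp_sum n (a * t%:C)).
    apply: has_cderiv_eq.
      apply: has_cderiv_sum => k _.
      apply: has_cderivM (has_cderiv_cst _ _).
      exact: has_cderivX (Hlin a t).
    rewrite big_ord_recl/= mul0r mul0r mul0r mulr0 addr0 add0r /exp_sum mulr_sumr.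
    apply: eq_bigr => k _; rewrite /bump/= add1n mulr0 addr0 factS natrM.
    have k0 : (k.+1%:R : R[i]) != 0 by rewrite pnatr_eq0.
    have f0 : (k`!%:R : R[i]) != 0 by rewrite pnatr_eq0 -lt0n fact_gt0.
    by move: (k.+1%:R : R[i]) (k`!%:R : R[i]) k0 f0 => u v u0 v0; field; rewrite u0 v0.
  apply: has_cderiv_eq.
    by apply: has_cderivM HS; exact: has_cderiv_cexp (Hlin (- a) t).
  rewrite /dg /exp_sum big_ord_recr/=; ring.
have E : normc (g 1 - g 0) <= 2 * (normc a * (expR (normc a) * (normc a ^+ n / n`!%:R))).
  apply: (curve_bound (dg := dg)) => [t _|t /andP[t0 t1]]; first exact: Hg.
  rewrite /dg normcM normcNE ler_wpM2l ?normc_ge0// normcM normc_cexp normcM normcV normc_nat.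
  have nt : normc (a * t%:C) <= normc a by rewrite normcM normcR ger0_norm// ler_piMr// normc_ge0.
  rewrite ler_pM ?expR_ge0 ?mulr_ge0 ?normc_ge0 ?invr_ge0//.
    rewrite ler_expR; apply: le_trans (Re_le _) _.
    by rewrite mulNr normcNE.
  by rewrite normcX ler_wpM2r// lerXn2r ?nnegrE ?normc_ge0.
have g0 : g 0 = 1.
  rewrite /g !mulr0 cexp0 mul1r /exp_sum big_ord_recl/= expr0 divr1 big1 ?addr0// => k _.
  by rewrite /bump/= add1n exprS !mul0r.
have g1 : g 1 = cexp (- a) * exp_sum n.+1 a by rewrite /g !mulr1.
have -> : exp_sum n.+1 a - cexp a = cexp a * (g 1 - g 0).
  by rewrite g1 g0 cexpN mulrBr mulrA divff ?cexp_neq0// mul1r mulr1.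
rewrite normcM normc_cexp.
have ea : expR (complex.Re a) <= expR (normc a) by rewrite ler_expR Re_le.
apply: le_trans (ler_pM (expR_ge0 _) (normc_ge0 _) ea E) _.
rewrite (_ : 2 * normc a = normc a + normc a); last by rewrite mulr_natl mulr2n.
rewrite expRD le_eqVlt; apply/orP; left; apply/eqP; ring.
Qed.

Lemma exp_sum_uniform (A e : R) : 0 <= A -> 0 < e -> exists N, forall n a, (N <= n)%N ->
  normc a <= A -> normc (exp_sum n a - cexp a) <= e.
Proof.
move=> A0 e0.
have B0 : 0 <= 2 * expR (2 * A) * A by rewrite !mulr_ge0 ?expR_ge0.
have [N HN] := exp_term_small B0 A0 e0; exists N.+1 => -[//|n] a Nn aA.
apply: le_trans (exp_sum_approx n a) _; apply: le_trans (HN n Nn).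
rewrite -!mulrA ler_wpM2l// ler_pM ?expR_ge0 ?mulr_ge0 ?normc_ge0 ?exprn_ge0 ?normc_ge0//.
  by rewrite ler_expR ler_wpM2l.
by rewrite ler_pM ?mulr_ge0 ?normc_ge0 ?exprn_ge0 ?normc_ge0// ler_wpM2r// lerXn2r ?nnegrE ?normc_ge0.
Qed.

Lemma cexp_entire a z Q : poly_approx z Q (fun x => cexp (a * x)).
Proof.
have H n : poly_approx z Q (fun x => exp_sum n (a * x)).
  apply: (@poly_approx_sum _ _ _ _ (fun k x => (a * x) ^+ k / k`!%:R)) => k.
  move=> e e0; exists ((a *: ('X + z%:P)) ^+ k * (k`!%:R^-1)%:P) => w _.
  rewrite !(hornerM, horner_exp, hornerZ, hornerD, hornerX, hornerC) [w + z]addrC.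
  by rewrite subrr normc0 ltW.
apply: poly_approx_uniform_limit H _ => e e0.
have A0 : 0 <= normc a * (normc z + `|Q|) by rewrite mulr_ge0 ?addr_ge0 ?normc_ge0.
have [N HN] := exp_sum_uniform A0 e0; exists N => w wQ; apply: HN => //.
rewrite normcM ler_wpM2l ?normc_ge0//; apply: le_trans (normcD _ _) _.
by rewrite lerD2l (le_trans wQ)// ler_norm.
Qed.

End ExponentialSums.

(** * Bessel functions *)

Section Bessel.
Context {R : realType}.
Implicit Types (x z u : R[i]).
Local Notation Re := (@complex.Re R).

Definition bes_coef n k : R[i] := (-1) ^+ k / (k`! * (n + k)`!)%:R.

Definition bes_sum n K x := \sum_(k < K) bes_coef n k * x ^+ k.

(** The Bessel-Clifford function at -x: J_n(z) is (z/2)^n times its value at (z/2)^2. Without that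
    factor it is nonzero at 0 and its derivative in x is - [bes n.+1]. *)
Definition bes n x : R[i] := limn (series (fun k => bes_coef n k * x ^+ k)).

Lemma leq_fact_mul_exp n k : (n`! * n.+1 ^ k <= (n + k)`!)%N.
Proof.
elim: k => [|k IH]; first by rewrite addn0 expn0 muln1.
rewrite addnS factS expnS mulnCA [X in (_ <= X)%N]mulnC mulnC leq_mul//.
by rewrite ltnS leq_addr.
Qed.

Lemma fact_gt0R n : 0 < (n`!%:R : R).
Proof. by rewrite ltr0n fact_gt0. Qed.

Lemma normc_bes_coef n k : normc (bes_coef n k) = (k`!%:R * (n + k)`!%:R)^-1.
Proof.
rewrite /bes_coef normcM normcV normc_nat normcX normcNE normc1 expr1n mul1r.
by rewrite natrM.
Qed.

(** Since (n + k)! >= n! (n + 1)^k, the argument gets divided by n + 1. This makes the later bounds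
    uniform in n, even for x of size n / 4. *)
Lemma bes_term_le n k x : normc (bes_coef n k * x ^+ k) <=
  n`!%:R^-1 * ((normc x / n.+1%:R) ^+ k / k`!%:R).
Proof.
rewrite normcM normc_bes_coef normcX expr_div_n.
have nk : (n`!%:R * n.+1%:R ^+ k : R) <= (n + k)`!%:R.
  by rewrite -natrX -natrM ler_nat leq_fact_mul_exp.
have p0 : 0 < (n`!%:R * n.+1%:R ^+ k : R) by rewrite mulr_gt0 ?fact_gt0R// exprn_gt0.
rewrite [leRHS](_ : _ = (k`!%:R * (n`!%:R * n.+1%:R ^+ k))^-1 * normc x ^+ k); last first.
  by rewrite !invfM; ring.
rewrite ler_wpM2r ?exprn_ge0 ?normc_ge0// lef_pV2 ?posrE ?mulr_gt0 ?fact_gt0R//.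
by rewrite ler_wpM2l// ltW ?fact_gt0R.
Qed.

Lemma bes_sum_diff n K K' x : (K <= K')%N -> normc (bes_sum n K' x - bes_sum n K x) <=
  n`!%:R^-1 * \sum_(K <= k < K') (normc x / n.+1%:R) ^+ k / k`!%:R.
Proof.
move=> KK'; rewrite /bes_sum -!(big_mkord predT (fun k => bes_coef n k * x ^+ k)).
rewrite (big_cat_nat (leq0n K) KK')/= [X in X - _]addrC addrK.
apply: le_trans (normc_sum _ _ _) _; rewrite mulr_sumr; apply: ler_sum => k _.
exact: bes_term_le.
Qed.

Lemma bes_sum_cauchy n (A e : R) : 0 <= A -> 0 < e -> exists N, forall K K' x, (N <= K)%N ->
  (K <= K')%N -> normc x <= A -> normc (bes_sum n K' x - bes_sum n K x) <= e.
Proof.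
move=> A0 e0; have f0 := fact_gt0R n.
have n1 : (0 : R) < n.+1%:R by rewrite ltr0n.
have [N HN] := exp_tail_small (divr_ge0 A0 (ltW n1)) (mulr_gt0 f0 e0).
exists N => K K' x NK KK' xA; apply: le_trans (bes_sum_diff _ _ KK') _.
rewrite ler_pdivrMl//; apply: HN => //.
by rewrite divr_ge0 ?normc_ge0//= ler_pM2r ?invr_gt0.
Qed.

Lemma bes_cvg n x : bes_sum n ^~ x @ \oo --> bes n x.
Proof.
have E : bes_sum n ^~ x = series (fun k => bes_coef n k * x ^+ k).
  by apply/funext => K; rewrite /bes_sum /series/= big_mkord.
rewrite /bes -E; suff : cvgn (bes_sum n ^~ x) by [].
apply: cauchyc_cvg => e e0; have [N HN] := bes_sum_cauchy n (normc_ge0 x) e0.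
exists N => i j Ni Nj; have [ij|/ltnW ji] := leqP i j.
  by rewrite normcBC HN.
exact: HN.
Qed.

Lemma bes_sum_uniform n (A e : R) : 0 <= A -> 0 < e -> exists N, forall K x, (N <= K)%N ->
  normc x <= A -> normc (bes_sum n K x - bes n x) <= e.
Proof.
move=> A0 e0; have [N HN] := bes_sum_cauchy n A0 (half_gt0 e0); exists N => K x NK xA.
have /cvgc_normcP/(_ _ (half_gt0 e0))[N' HN'] := bes_cvg (n := n) (x := x).
apply: le_trans (normcBD _ (bes_sum n (maxn K N') x) _) _.
rewrite (splitr e) lerD ?HN' ?leq_maxr// normcBC.
by apply: HN => //; exact: leq_maxl.
Qed.

Lemma normc_bes_le n x : normc (bes n x) <= n`!%:R^-1 * expR (normc x / n.+1%:R).
Proof.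
apply: (cvgc_normc_le (N := 0) (bes_cvg (n := n) (x := x))) => K _.
have := bes_sum_diff n x (leq0n K); rewrite /bes_sum big_ord0 subr0 big_mkord => h.
apply: le_trans h _; rewrite ler_wpM2l ?invr_ge0//; apply: expR_sum_le.
by rewrite divr_ge0 ?normc_ge0.
Qed.

Lemma normc_bes_sub_le n x :
  normc (bes n x - n`!%:R^-1) <= n`!%:R^-1 * (expR (normc x / n.+1%:R) - 1).
Proof.
have /cvgc_normcP cb := bes_cvg (n := n) (x := x).
have : (fun K => bes_sum n K x - n`!%:R^-1) @ \oo --> bes n x - n`!%:R^-1.
  apply/cvgc_normcP => e /cb[N HN]; exists N => K /HN.
  by rewrite opprB addrA subrK.
move=> /(cvgc_normc_le (N := 1%N)); apply => K K1.
have := bes_sum_diff n x K1; rewrite {2}/bes_sum big_ord1 /bes_coef fact0 addn0 mul1n !expr0 mul1r mulr1 => h.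
apply: le_trans h _; rewrite ler_wpM2l ?invr_ge0//.
have y0 : 0 <= normc x / n.+1%:R by rewrite divr_ge0 ?normc_ge0.
have := expR_sum_le K y0; rewrite -(big_mkord predT (fun k => _ ^+ k / k`!%:R)).
by rewrite big_ltn// expr0 fact0 divr1 lerBrDl.
Qed.

Lemma normc_bes_ge n x : normc x <= n.+1%:R / 4 -> 2^-1 * n`!%:R^-1 <= normc (bes n x).
Proof.
move=> xn; have n1 : (0 : R) < n.+1%:R by rewrite ltr0n.
have y4 : normc x / n.+1%:R <= 4^-1 by rewrite ler_pdivrMr// mulrC.
(* From exp (-1/4) >= 3/4. The terms after the first then amount to at most half of 1 / n!. *)
have e2 : expR (normc x / n.+1%:R) <= 3 / 2.
  apply: (@le_trans _ _ (expR 4^-1)); first by rewrite ler_expR.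
  have := expR_ge1Dx (- 4^-1 : R); rewrite expRN => h.
  have E0 := expR_gt0 (4^-1 : R).
  by move: h; rewrite -(ler_pM2l E0) mulfV ?gt_eqF// => h; lra.
have := normc_bes_sub_le n x.
have : n`!%:R^-1 * (expR (normc x / n.+1%:R) - 1) <= n`!%:R^-1 * 2^-1 :> R.
  by rewrite ler_wpM2l ?invr_ge0//; lra.
have := normcBl (n`!%:R^-1) (bes n x); rewrite normcV normc_nat normcBC.
lra.
Qed.

Lemma besselJE n z : besselJ n z = (z / 2) ^+ n * bes n ((z / 2) ^+ 2).
Proof.
apply: cvg_lim => //.
have /cvgc_normcP cb := bes_cvg (n := n) (x := (z / 2) ^+ 2).
have E K : series (fun k : nat => (-1) ^+ k / (k`! * (n + k)`!)%:R * (z / 2) ^+ (2 * k + n)) K =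
    (z / 2) ^+ n * bes_sum n K ((z / 2) ^+ 2).
  rewrite /series/= big_mkord /bes_sum mulr_sumr; apply: eq_bigr => k _.
  by rewrite /bes_coef exprD exprM; ring.
apply/cvgc_normcP => e e0.
have c1 : 0 < normc ((z / 2) ^+ n) + 1 by rewrite ltr_wpDl ?normc_ge0.
have [N HN] := cb _ (divr_gt0 e0 c1); exists N => K /HN h.
rewrite E -mulrBr normcM; move: h; rewrite ler_pdivlMr// => h.
apply: le_trans h; rewrite mulrC ler_wpM2l ?normc_ge0//.
by rewrite lerDl.
Qed.

Lemma besselJ_entire n c z Q : poly_approx z Q (fun x => besselJ n (c * x)).
Proof.
pose p K : {poly R[i]} := (c / 2) ^+ n *: ('X ^+ n *
  \sum_(k < K) (bes_coef n k * ((c / 2) ^+ 2) ^+ k) *: 'X ^+ (2 * k)).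
have pE K x : (p K).[x] = (c * x / 2) ^+ n * bes_sum n K ((c * x / 2) ^+ 2).
  rewrite hornerZ hornerM horner_exp hornerX horner_sum mulrA -exprMn mulrAC.
  congr (_ * _); apply: eq_bigr => k _.
  rewrite hornerZ hornerXn exprM.
  have -> : (c * x / 2) ^+ 2 ^+ k = (c / 2) ^+ 2 ^+ k * x ^+ 2 ^+ k.
    by rewrite -!exprMn mulrAC.
  by rewrite mulrA.
apply: poly_approx_uniform_limit (fun K => poly_approx_horner z Q (p K)) _ => e e0.
pose A := normc c * (normc z + `|Q|) / 2.
have A0 : 0 <= A by rewrite divr_ge0 ?mulr_ge0 ?addr_ge0 ?normc_ge0.
have A1 : 0 < A ^+ n + 1 by rewrite ltr_wpDl ?exprn_ge0.
have [N HN] := bes_sum_uniform n (exprn_ge0 2 A0) (divr_gt0 e0 A1).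
exists N => w wQ; rewrite pE besselJE -mulrBr normcM.
have nA : normc (c * (z + w) / 2) <= A.
  rewrite normcM normcV (normc_nat 2) normcM ler_wpM2r ?invr_ge0// ler_wpM2l ?normc_ge0//.
  by apply: le_trans (normcD _ _) _; rewrite lerD2l (le_trans wQ)// ler_norm.
have h : normc (bes_sum n N ((c * (z + w) / 2) ^+ 2) - bes n ((c * (z + w) / 2) ^+ 2)) <=
    e / (A ^+ n + 1).
  by apply: HN => //; rewrite normcX lerXn2r ?nnegrE ?normc_ge0.
move: h; rewrite ler_pdivlMr// => h; apply: le_trans h.
rewrite mulrC ler_wpM2l ?normc_ge0// normcX.
by apply: (@le_trans _ _ (A ^+ n)); [rewrite lerXn2r ?nnegrE ?normc_ge0|rewrite lerDl].
Qed.

Lemma bes_coefS n k : k.+1%:R * bes_coef n k.+1 = - bes_coef n.+1 k.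
Proof.
rewrite /bes_coef addnS -addSn; move: (n.+1 + k)%N => m; rewrite exprS factS !natrM.
have k0 : (k.+1%:R : R[i]) != 0 by rewrite pnatr_eq0.
have f0 : (k`!%:R : R[i]) != 0 by rewrite pnatr_eq0 -lt0n fact_gt0.
have g0 : (m`!%:R : R[i]) != 0 by rewrite pnatr_eq0 -lt0n fact_gt0.
move: (k.+1%:R : R[i]) (k`!%:R : R[i]) (m`!%:R : R[i]) k0 f0 g0 => a b c a0 b0 c0.
by field; rewrite a0 b0 c0.
Qed.

(** The coefficients satisfy (n+1) c_(n+1,k) = c_(n,k) - k c_(n+1,k), and [bes_coefS] shifts the
    last term to [bes n.+2]. Together with the derivative rule this is Bessel's differential
    equation. *)
Lemma bes_rec n x : n.+1%:R * bes n.+1 x = bes n x + x * bes n.+2 x.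
Proof.
have S K : n.+1%:R * bes_sum n.+1 K.+1 x = bes_sum n K.+1 x + x * bes_sum n.+2 K x.
  have E k : n.+1%:R * bes_coef n.+1 k = bes_coef n k - k%:R * bes_coef n.+1 k.
    rewrite /bes_coef addSn factS !natrM -addSn [(n.+1 + k)%:R]natrD.
    have f0 : (k`!%:R : R[i]) != 0 by rewrite pnatr_eq0 -lt0n fact_gt0.
    have g0 : ((n + k)`!%:R : R[i]) != 0 by rewrite pnatr_eq0 -lt0n fact_gt0.
    have h0 : (n.+1%:R + k%:R : R[i]) != 0 by rewrite -natrD pnatr_eq0.
    move: (n.+1%:R : R[i]) (k%:R : R[i]) (k`!%:R : R[i]) ((n + k)`!%:R : R[i]) h0 f0 g0.
    by move=> a b c d h0 c0 d0; field; rewrite h0 c0 d0.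
  rewrite /bes_sum !mulr_sumr.
  under eq_bigr => k _ do rewrite mulrA E mulrBl.
  rewrite sumrB; congr (_ + _).
  rewrite big_ord_recl/= mul0r mul0r add0r -sumrN; apply: eq_bigr => k _.
  by rewrite /bump/= add1n bes_coefS exprS; ring.
pose l1 := fun K => n.+1%:R * bes_sum n.+1 K.+1 x.
have h1 : l1 @ \oo --> n.+1%:R * bes n.+1 x.
  apply/cvgc_normcP => e e0.
  have n0 : 0 < (n.+1%:R : R) by rewrite ltr0n.
  have /cvgc_normcP/(_ _ (divr_gt0 e0 n0))[N HN] := bes_cvg (n := n.+1) (x := x).
  exists N => K NK; rewrite /l1 -mulrBr normcM normc_nat mulrC -ler_pdivlMr//.
  by apply: HN; exact: leqW.
apply: (cvgc_unique h1); apply/cvgc_normcP => e e0.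
have /cvgc_normcP/(_ _ (half_gt0 e0))[N HN] := bes_cvg (n := n) (x := x).
have x1 : 0 < normc x + 1 by rewrite ltr_wpDl ?normc_ge0.
have /cvgc_normcP/(_ _ (divr_gt0 (half_gt0 e0) x1))[N' HN'] := bes_cvg (n := n.+2) (x := x).
exists (maxn N N') => K; rewrite geq_max => /andP[NK N'K]; rewrite /l1 S.
rewrite opprD addrACA -mulrBr; apply: le_trans (normcD _ _) _.
rewrite (splitr e) lerD//; first by apply: HN; exact: leqW.
have := HN' _ N'K; rewrite ler_pdivlMr// => h; apply: le_trans h.
by rewrite normcM mulrC ler_wpM2l ?normc_ge0// lerDl.
Qed.

(** On a line through 0, [Re (v * bes n _)] is a real power series, which may be differentiated
    termwise. The factors v = 1 and v = -i recover both components. *)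
Lemma has_deriv_Re_bes v n u (t : R) :
  has_deriv (fun s => Re (v * bes n (u * s%:C))) t (Re (v * (- u * bes n.+1 (u * t%:C)))).
Proof.
pose c v' n' (k : nat) : R := Re (v' * (bes_coef n' k * u ^+ k)).
have cE v' n' (s : R) : pseries (c v' n') s = (fun K => Re (v' * bes_sum n' K (u * s%:C))).
  apply/funext => K; rewrite /pseries /series/= big_mkord /bes_sum mulr_sumr Re_sum.
  apply: eq_bigr => k _; rewrite /c mulrC -ReRM rmorphXn exprMn; congr Re; ring.
have cC v' n' (s : R) : pseries (c v' n') s @ \oo --> Re (v' * bes n' (u * s%:C)).
  rewrite cE; apply: cvgc_cvg_Re; apply/cvgc_normcP => e e0.
  have c1 : 0 < normc v' + 1 by rewrite ltr_wpDl ?normc_ge0.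
  have /cvgc_normcP/(_ _ (divr_gt0 e0 c1))[N HN] := bes_cvg (n := n') (x := u * s%:C).
  exists N => K /HN; rewrite ler_pdivlMr// -mulrBr normcM => h; apply: le_trans h.
  by rewrite mulrC ler_wpM2l ?normc_ge0// lerDl.
have cd v' n' : pseries_diffs (c v' n') = c (- u * v') n'.+1.
  apply/funext => k; rewrite /pseries_diffs /c -ReRM rmorph_nat exprS.
  rewrite (_ : _ * _ = v' * ((k.+1%:R * bes_coef n' k.+1) * (u * u ^+ k))); last by ring.
  by rewrite bes_coefS; congr Re; ring.
have cv v' n' s : cvgn (pseries (c v' n') s) by apply/cvg_ex; eexists; exact: cC.
have H : is_derive t 1 (fun s => limn (pseries (c v n) s)) (limn (pseries (pseries_diffs (c v n)) t)).
  apply: (@pseries_snd_diffs _ (c v n) (`|t| + 1)); rewrite ?cd//.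
  by rewrite [ltRHS]ger0_norm ?ltrDl// addr_ge0.
rewrite /has_deriv (_ : (fun s => _) = (fun s => limn (pseries (c v n) s))); last first.
  by apply/funext => s; apply/esym/cvg_lim => //; exact: cC.
apply: (is_derive_eq H); rewrite cd.
have -> : v * (- u * bes n.+1 (u * t%:C)) = - u * v * bes n.+1 (u * t%:C) by ring.
by apply: cvg_lim => //; exact: cC.
Qed.

Lemma has_cderiv_bes n u (t : R) :
  has_cderiv (fun s => bes n (u * s%:C)) t (- u * bes n.+1 (u * t%:C)).
Proof.
split.
  have := has_deriv_Re_bes 1 n u t; rewrite mul1r.
  by under [fun s => _]eq_fun do rewrite mul1r.
have := has_deriv_Re_bes (- 'i%C) n u t.
have ImE y : Re (- 'i%C * y) = complex.Im y.
  by case: y => a b /=; rewrite oppr0 mul0r mulN1r opprK add0r.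
by rewrite ImE; under [fun s => _]eq_fun do rewrite ImE.
Qed.

End Bessel.

(** * Height functions *)

Section HeightFunctions.
Context {R : realType}.
Implicit Types (x z s : R[i]).
Local Notation Re := (@complex.Re R).
Local Notation Im := (@complex.Im R).

Lemma Re_sqrtc_ge0 x : 0 <= Re (sqrtc x).
Proof. by case: x => a b; exact: sqrtr_ge0. Qed.

Lemma sqrtc_unique s x : s ^+ 2 = x -> 0 < Re s -> sqrtc x = s.
Proof.
move=> sx s0; have /eqP := sqr_sqrtc x; rewrite -{2}sx eqf_sqr => /orP[/eqP//|/eqP E].
by exfalso; have := Re_sqrtc_ge0 x; rewrite E ReN; lra.
Qed.

Definition halfsqrt z : R[i] := sqrtc (1 - z ^+ 2).

Lemma sqr_halfsqrt z : halfsqrt z ^+ 2 = 1 - z ^+ 2.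
Proof. exact: sqr_sqrtc. Qed.

Lemma Re_halfsqrt_ge0 z : 0 <= Re (halfsqrt z).
Proof. exact: Re_sqrtc_ge0. Qed.

Lemma Re_halfsqrt_gt0 z : ~ realS z -> 0 < Re (halfsqrt z).
Proof.
move=> nS; rewrite lt_def Re_halfsqrt_ge0 andbT; apply/negP => /eqP u0.
apply: nS; have := sqr_halfsqrt z; move: u0; case: (halfsqrt z) => u v /= ->.
case: z => a b /eqP; rewrite !expr2 eq_complex /= => /andP[/eqP r /eqP i].
have b0 : b = 0.
  have /eqP : a * b = 0 by lra.
  rewrite mulf_eq0 => /orP[/eqP a0|/eqP//].
  by move: r; rewrite a0; have := sqr_ge0 b; have := sqr_ge0 v; rewrite !expr2; lra.
split=> //; rewrite -(@ler_pXn2r _ 2) ?nnegrE//; rewrite expr1n real_normK ?num_real//.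
by move: r; rewrite b0 /= expr2; have := sqr_ge0 v; rewrite expr2; lra.
Qed.

Lemma one_plus_neq0 s : 0 <= Re s -> 1 <= normc (1 + s).
Proof. by move=> s0; apply: le_trans (Re_le _); rewrite ReD /=; lra. Qed.

(* [Omega z ^ 2 = |z ^ 2| |exp s| ^ 2 / |1 + s| ^ 2] with [z ^ 2 = (1 - s) (1 + s)]. *)
Definition Phi s : R := normc (1 - s) / normc (1 + s) * expR (2 * Re s).

Lemma Omega_ge0 z : 0 <= Omega z.
Proof. exact: normc_ge0. Qed.

Lemma OmegaE z : Omega z = normc z * expR (Re (halfsqrt z)) / normc (1 + halfsqrt z).
Proof. by rewrite /Omega normcM normcV normcM normc_cexp. Qed.

Lemma sqr_Omega z : Omega z ^+ 2 = Phi (halfsqrt z).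
Proof.
have n0 : normc (1 + halfsqrt z) != 0.
  by rewrite gt_eqF// (lt_le_trans ltr01)// one_plus_neq0// Re_halfsqrt_ge0.
rewrite OmegaE expr_div_n exprMn -expRM_natl -normcX.
have -> : z ^+ 2 = (1 - halfsqrt z) * (1 + halfsqrt z).
  by rewrite mulrBl mul1r mulrDr mulr1 -expr2 sqr_halfsqrt; ring.
by rewrite normcM /Phi; field.
Qed.

(** From |1 - s|^2 = |1 + s|^2 - 4 Re s. In this form Phi visibly increases with |Im s| when Re s >
    0. *)
Lemma Phi_sqr s : 0 < normc (1 + s) ->
  Phi s ^+ 2 = (1 - 4 * Re s / ((1 + Re s) ^+ 2 + Im s ^+ 2)) * expR (4 * Re s).
Proof.
move=> n0; rewrite /Phi exprMn expr_div_n -expRM_natl.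
have N : (1 + Re s) ^+ 2 + Im s ^+ 2 = normc (1 + s) ^+ 2.
  by rewrite sqr_normc_ReIm ReD ImD /= add0r.
have -> : normc (1 - s) ^+ 2 = (1 - Re s) ^+ 2 + Im s ^+ 2.
  by rewrite sqr_normc_ReIm ReD ImD ReN ImN /= add0r sqrrN.
rewrite -N; have N0 : (1 + Re s) ^+ 2 + Im s ^+ 2 != 0 by rewrite N expf_neq0// gt_eqF.
rewrite mulrA -natrM; congr (_ * _).
by field.
Qed.

Lemma Phi_imaginary s : Re s = 0 -> Phi s = 1.
Proof.
move=> s0; rewrite /Phi s0 mulr0 expR0 mulr1.
have -> : normc (1 - s) = normc (1 + s).
  by apply/eqP; rewrite -(@eqrXn2 _ 2) ?normc_ge0// !sqr_normc_ReIm !ReD !ImD ReN ImN s0/= oppr0 !add0r sqrrN.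
rewrite divff// gt_eqF// (lt_le_trans ltr01)// one_plus_neq0// s0//.
Qed.

Lemma lipschitz_continuous (h : R[i] -> R) :
  (forall x y, `|h x - h y| <= normc (x - y)) -> continuous h.
Proof.
move=> H z A /nbhs_ballP[e /= e0 eA]; apply/nbhs_normc; exists e => // y yz.
by apply: eA; rewrite -ball_normE /=; apply: le_lt_trans (H _ _) _; rewrite normcBC.
Qed.

Lemma Phi_continuous s : 0 <= Re s -> {for s, continuous Phi}.
Proof.
move=> s0; have n0 : normc (1 + s) != 0 by rewrite gt_eqF// (lt_le_trans ltr01)// one_plus_neq0.
have nc c (b : R[i]) : normc b = 1 -> continuous (fun s => normc (c + b * s)).
  move=> b1; apply: lipschitz_continuous => x y.
  have -> : normc (x - y) = normc ((c + b * x) - (c + b * y)).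
    have -> : c + b * x - (c + b * y) = b * (x - y) by ring.
    by rewrite normcM b1 mul1r.
  by rewrite ler_norml; have := normcBl (c + b * x) (c + b * y);
    have := normcBl (c + b * y) (c + b * x); rewrite (normcBC (c + b * y)); lra.
have E1 : Phi = (fun s => normc (1 + (-1) * s) * (normc (1 + 1 * s))^-1 * expR (2 * Re s)).
  by apply/funext => y; rewrite /Phi mulN1r mul1r.
have cRe : continuous Re.
  apply: lipschitz_continuous => x y; rewrite -ReN -ReD; exact: Re_le_normc.
rewrite E1; apply: (@continuousM _ _ (fun s => normc (1 + (-1) * s) * (normc (1 + 1 * s))^-1)).
  apply: (@continuousM _ _ (fun s => normc (1 + (-1) * s)) (fun s => (normc (1 + 1 * s))^-1)).
    by apply: nc; rewrite normcNE normc1.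
  apply: (@continuousV _ _ (fun s => normc (1 + 1 * s))); first by rewrite mul1r.
  by apply: nc; rewrite normc1.
apply: (@continuous_comp _ _ _ (fun s => 2 * Re s) expR); last exact: continuous_expR.
apply: (@continuousM _ _ (fun=> 2) Re); last exact: cRe.
exact: cst_continuous.
Qed.

Lemma sqr_close (a b : R[i]) (d : R) : 0 < d -> normc (a ^+ 2 - b ^+ 2) < d ^+ 2 ->
  normc (a - b) < d \/ normc (a + b) < d.
Proof.
move=> d0; rewrite subr_sqr normcM => h.
have [|h1] := ltP (normc (a - b)) d; first by left.
right; rewrite ltNge; apply/negP => h2.
by move: h; rewrite ltNge expr2 ler_pM// ltW.
Qed.

Lemma sqr_continuous_normc z (e : R) : 0 < e ->
  exists2 d : R, 0 < d & forall y, normc (y - z) < d -> normc (y ^+ 2 - z ^+ 2) < e.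
Proof.
move=> e0; have c0 : 0 < 1 + 2 * normc z by have := normc_ge0 z; lra.
exists (Num.min 1 (e / (1 + 2 * normc z))); first by rewrite lt_min ltr01 divr_gt0.
move=> y; rewrite lt_min => /andP[y1]; rewrite ltr_pdivlMr// => ye.
apply: le_lt_trans ye; rewrite subr_sqr normcM ler_wpM2l ?normc_ge0//.
have -> : y + z = (y - z) + 2 * z by ring.
apply: le_trans (normcD _ _) _; rewrite normcM (normc_nat 2); lra.
Qed.

(** Near z the root is close to s or to -s. The second can occur only if Re s = 0, and then Phi
    equals 1 at both, so the jump of the principal root across S is invisible. *)
Lemma sqr_Omega_continuous : continuous (fun z => (@Omega R z) ^+ 2).
Proof.
move=> z; set s := halfsqrt z.
rewrite /continuous_at sqr_Omega => A /nbhs_ballP[e /= e0 eA].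
have near_s b : 0 <= Re b -> Phi b = Phi s -> exists2 d : R, 0 < d &
    forall t, normc (t - b) < d -> A (Phi t).
  move=> b0 bs; have /nbhs_normc[d d0 Hd] : nbhs b (Phi @^-1` A).
    by apply: (Phi_continuous b0); rewrite bs; apply/nbhs_ballP; exists e.
  by exists d.
have [d1 d10 H1] := near_s s (Re_halfsqrt_ge0 z) (erefl _).
have [s0|s0] := eqVneq (Re s) 0.
  have [||d2 d20 H2] := near_s (- s).
  - by rewrite ReN s0 oppr0.
  - by rewrite !Phi_imaginary ?ReN ?s0 ?oppr0.
  pose d := Num.min d1 d2; have d0 : 0 < d by rewrite lt_min d10.
  have [r r0 Hr] := sqr_continuous_normc z (exprn_gt0 2 d0).
  apply/nbhs_normc; exists r => // y /Hr yr /=; rewrite sqr_Omega.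
  have : normc (halfsqrt y ^+ 2 - s ^+ 2) < d ^+ 2.
    have -> : halfsqrt y ^+ 2 - s ^+ 2 = - (y ^+ 2 - z ^+ 2) by rewrite !sqr_halfsqrt; ring.
    by rewrite normcNE.
  move=> /(sqr_close d0)[]; rewrite lt_min => /andP[h1 h2]; first exact: H1.
  by apply: H2; rewrite opprK.
have sgt : 0 < Re s by rewrite lt_def s0 Re_halfsqrt_ge0.
have d0 : 0 < Num.min d1 (Re s) by rewrite lt_min d10.
have [r r0 Hr] := sqr_continuous_normc z (exprn_gt0 2 d0).
apply/nbhs_normc; exists r => // y /Hr yr /=; rewrite sqr_Omega.
have : normc (halfsqrt y ^+ 2 - s ^+ 2) < (Num.min d1 (Re s)) ^+ 2.
  have -> : halfsqrt y ^+ 2 - s ^+ 2 = - (y ^+ 2 - z ^+ 2) by rewrite !sqr_halfsqrt; ring.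
  by rewrite normcNE.
move=> /(sqr_close d0)[]; rewrite lt_min => /andP[h1 h2]; first exact: H1.
have := Re_le (halfsqrt y + s); rewrite ReD; have := Re_halfsqrt_ge0 y; lra.
Qed.

Lemma Omega_continuous : continuous (@Omega R).
Proof.
have -> : @Omega R = Num.sqrt \o (fun z => (Omega z) ^+ 2).
  by apply/funext => z /=; rewrite sqrtr_sqr ger0_norm ?Omega_ge0.
by move=> z; apply: continuous_comp; [exact: sqr_Omega_continuous|exact: sqrt_continuous].
Qed.

(* Moving [s] away from the real axis, and off the imaginary axis when [Re s = 0]. *)
Lemma Phi_increase s (d : R) : 0 <= Re s -> 0 < Phi s -> 0 < d ->
  exists s', [/\ normc (s' - s) < d, 0 < Re s' & Phi s < Phi s'].
Proof.
move=> u0 P0 d0; set u := Re s in u0; set v := Im s.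
pose h := Num.min (d / 4) 1.
have h0 : 0 < h by rewrite lt_min divr_gt0//= ltr01.
have hd : h <= d / 4 by rewrite ge_min lexx.
have h1 : h <= 1 by rewrite ge_min lexx orbT.
pose v' := if 0 <= v then v + h else v - h.
have vv' : `|v' - v| = h.
  rewrite /v'; case: ifP => _; rewrite addrAC subrr add0r ?normrN gtr0_norm//.
have v2 : v ^+ 2 + h ^+ 2 <= v' ^+ 2.
  by rewrite /v'; case: (leP 0 v) => vs; rewrite !expr2; nra.
(* On the imaginary axis Phi is constantly 1, so u must move too. With u' = h^2 / 4 the denominator
   (1 + u')^2 + v'^2 exceeds 1 + 4 u', and then 1 + 4 u' <= exp (4 u') makes the new value larger
   than 1. *)
pose u' := if u == 0 then h ^+ 2 / 4 else u.
have hh : h ^+ 2 <= h by rewrite expr2 ler_piMl// ltW.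
have h20 : 0 < h ^+ 2 by rewrite exprn_gt0.
have uu' : `|u' - u| <= h.
  rewrite /u'; case: eqVneq => [->|_]; last by rewrite subrr normr0 ltW.
  by rewrite subr0 ger0_norm ?divr_ge0//; lra.
have u'0 : 0 < u' by rewrite /u'; case: eqVneq => [_|un0]; [rewrite divr_gt0|rewrite lt_def un0].
exists (u' +i* v'); split => //.
  apply: le_lt_trans (normc_ReIm_le _) _.
  by rewrite ReD ImD ReN ImN /= -/u -/v; lra.
have n1 t : 0 <= Re t -> 0 < normc (1 + t).
  by move=> t0; rewrite (lt_le_trans ltr01)// one_plus_neq0.
have P'0 : 0 <= Phi (u' +i* v').
  by rewrite /Phi mulr_ge0 ?divr_ge0 ?normc_ge0 ?expR_ge0.
rewrite -(@ltr_pXn2r _ 2) ?nnegrE ?(ltW P0)// Phi_sqr ?n1// Phi_sqr ?n1 ?ltW//=.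
rewrite -/u -/v.
have D0 : 0 < (1 + u') ^+ 2 + v' ^+ 2.
  by rewrite ltr_pwDl ?sqr_ge0// exprn_gt0//; lra.
have [un0|un0] := eqVneq u 0.
  rewrite un0 mulr0 mul0r subr0 mul1r expR0.
  have u'E : u' = h ^+ 2 / 4 by rewrite /u' un0 eqxx.
  have h4 : 1 - 4 * u' / ((1 + u') ^+ 2 + v' ^+ 2) > (1 + 4 * u')^-1.
    have -> : (1 + 4 * u')^-1 = 1 - 4 * u' / (1 + 4 * u').
      by field; rewrite gt_eqF//; lra.
    rewrite ltrD2l ltrN2 ltr_pM2l ?mulr_gt0// ltf_pV2 ?posrE//; last by lra.
    have : 0 <= v ^+ 2 by exact: sqr_ge0.
    have : 0 <= u' ^+ 2 by exact: sqr_ge0.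
    rewrite (_ : (1 + u') ^+ 2 = 1 + 2 * u' + u' ^+ 2); last by ring.
    by rewrite u'E; lra.
  have e4 : 1 + 4 * u' <= expR (4 * u') by exact: expR_ge1Dx.
  have i0 : 0 < (1 + 4 * u')^-1 by rewrite invr_gt0; lra.
  rewrite -[ltLHS](@mulVf _ (1 + 4 * u')); last by rewrite gt_eqF//; lra.
  apply: (@lt_le_trans _ _ ((1 - 4 * u' / ((1 + u') ^+ 2 + v' ^+ 2)) * (1 + 4 * u'))).
    by rewrite ltr_pM2r//; lra.
  by rewrite ler_wpM2l//; lra.
have ugt : 0 < u by rewrite lt_def un0.
have -> : u' = u by rewrite /u' (negbTE un0).
rewrite ltr_pM2r ?expR_gt0// ltrD2l ltrN2 ltr_pM2l ?mulr_gt0//.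
have D1 : 0 < (1 + u) ^+ 2 + v ^+ 2 by rewrite ltr_pwDl ?sqr_ge0// exprn_gt0//; lra.
rewrite ltf_pV2 ?posrE//; last by rewrite ltr_pwDl ?sqr_ge0// exprn_gt0//; lra.
lra.
Qed.

Lemma OmegaN z : Omega (- z) = Omega z.
Proof. by rewrite !OmegaE /halfsqrt sqrrN normcNE. Qed.

(** An s' near s with a larger Phi is pulled back through 1 - y^2 = s'^2; Re s' > 0 makes s' the
    principal root. Either y or -y is near z, and Omega is even. *)
Lemma Omega_proper : proper_height (@Omega R).
Proof.
split; [exact: Omega_ge0|exact: Omega_continuous| |].
  by move=> r r0; exists 0; rewrite /sublevel /= OmegaE normc0 !mul0r.
move=> z Oz /nbhs_normc[d d0 Hd].
set s := halfsqrt z; have P0 : 0 < Phi s by rewrite -sqr_Omega exprn_gt0.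
have [r r0 Hr] := sqr_continuous_normc s (exprn_gt0 2 d0).
have [s' [s's s'0 Ps']] := Phi_increase (Re_halfsqrt_ge0 z) P0 r0.
have [y yE] : exists y, 1 - y ^+ 2 = s' ^+ 2.
  by exists (sqrtc (1 - s' ^+ 2)); rewrite sqr_sqrtc opprB addrC subrK.
have Oy : Omega z < Omega y.
  rewrite -(@ltr_pXn2r _ 2) ?nnegrE ?Omega_ge0// !sqr_Omega.
  by rewrite [halfsqrt y](_ : _ = s')//; apply: sqrtc_unique => //; rewrite yE.
have : normc (y ^+ 2 - z ^+ 2) < d ^+ 2.
  have -> : y ^+ 2 - z ^+ 2 = - (s' ^+ 2 - s ^+ 2) by rewrite -yE sqr_halfsqrt; ring.
  by rewrite normcNE; exact: Hr.
move=> /(sqr_close d0)[/Hd|h]; first by rewrite leNgt Oy.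
have /Hd : normc (- y - z) < d by rewrite -opprD normcNE.
by rewrite OmegaN leNgt Oy.
Qed.

Lemma normc_halfsqrt_le z : normc (halfsqrt z) <= 1 + normc z ^+ 2.
Proof.
have h : normc (halfsqrt z) ^+ 2 <= 1 + normc z ^+ 2.
  rewrite -normcX sqr_halfsqrt; apply: le_trans (normcB _ _) _.
  by rewrite normc1 normcX.
have := normc_ge0 (halfsqrt z); have := sqr_ge0 (normc z); move: h.
move: (normc z ^+ 2) (normc _) => b a; nra.
Qed.

Lemma Omega_le z : Omega z <= normc z * expR (1 + normc z ^+ 2).
Proof.
have n1 := one_plus_neq0 (Re_halfsqrt_ge0 z).
rewrite OmegaE ler_pdivrMr ?(lt_le_trans ltr01)//.
rewrite -mulrA ler_wpM2l ?normc_ge0//.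
apply: (@le_trans _ _ (expR (1 + normc z ^+ 2))).
  by rewrite ler_expR; apply: le_trans (Re_le _) (normc_halfsqrt_le z).
by rewrite ler_peMr ?expR_ge0.
Qed.

(** On the imaginary axis Omega (i r) >= r, because exp s >= 1 + s for the real root s; apply the
    intermediate value theorem from 0. *)
Lemma Omega_onto (r : R) : 0 < r -> exists z, @Omega R z = r.
Proof.
move=> r0; pose h (t : R) := Omega (t *i : R[i]).
have ch : continuous h.
  move=> t; apply: (@continuous_comp _ _ _ (fun t : R => t *i) (@Omega R)).
    move=> A /nbhs_normc[e e0 eA]; apply/nbhs_ballP; exists e => //= y.
    rewrite -ball_normE /= distrC => ye; apply: eA.
    by apply: le_lt_trans (normc_ReIm_le _) _ => /=; rewrite subrr normr0 add0r.
  exact: Omega_continuous.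
have h0 : h 0 = 0 by rewrite /h OmegaE normc0 !mul0r.
have hr : r <= h r.
  have sE : halfsqrt (r *i) = (Num.sqrt (1 + r ^+ 2))%:C.
    apply: sqrtc_unique; last by rewrite /= sqrtr_gt0 ltr_wpDr ?sqr_ge0.
    rewrite -rmorphXn sqr_sqrtr ?addr_ge0 ?sqr_ge0//.
    by apply: complexP; rewrite !expr2 /=; ring.
  rewrite /h OmegaE sE -[X in _ / normc X]rmorphD/= !(expr0n, add0r, addr0)/=.
  rewrite !sqrtr_sqr (gtr0_norm r0) ger0_norm ?addr_ge0 ?sqrtr_ge0//.
  rewrite ler_pdivlMr; last by rewrite ltr_wpDr ?sqrtr_ge0.
  by rewrite ler_pM2l// expR_ge1Dx.
have [||c _ hc] := @IVT R h 0 r r (ltW r0); first exact: continuous_subspaceT.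
  by rewrite h0 ge_min le_max hr ltW ?orbT.
by exists (c *i).
Qed.

Lemma star_connected (D : set R[i]) p :
  (forall z (t : R), D z -> 0 <= t <= 1 -> D (p + t%:C * (z - p))) -> connected D.
Proof.
move=> H; have [->|/set0P[z0 Dz0]] := eqVneq D set0; first exact: connected0.
have Dp : D p by have := H z0 0 Dz0; rewrite rmorph0 mul0r addr0 lexx ler01; apply.
pose A z := (fun t : R => p + t%:C * (z - p)) @` `[0, 1].
have -> : D = \bigcup_(z in D) A z.
  apply/seteqP; split=> z => [Dz|[y Dy [t]]].
    exists z => //; exists 1; first by rewrite /= in_itv/= ler01 lexx.
    by rewrite rmorph1 mul1r addrC subrK.
  by rewrite /= in_itv/= => t01 <-; exact: H.
apply: bigcup_connected.
  exists p => z _; exists 0; first by rewrite /= in_itv/= ler01 lexx.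
  by rewrite rmorph0 mul0r addr0.
move=> z _; apply: connected_continuous_connected; first exact: segment_connected.
apply: continuous_subspaceT => t B /nbhs_normc[e e0 eB].
have c0 : 0 < normc (z - p) + 1 by rewrite ltr_wpDl ?normc_ge0.
apply/nbhs_ballP; exists (e / (normc (z - p) + 1)) => /=; first by rewrite divr_gt0.
move=> y; rewrite -ball_normE /= distrC ltr_pdivlMr// => yt; apply: eB.
have -> : p + y%:C * (z - p) - (p + t%:C * (z - p)) = (y - t)%:C * (z - p).
  by rewrite rmorphB/=; ring.
rewrite normcM normcR; apply: le_lt_trans yt.
by rewrite ler_wpM2l// lerDl.
Qed.

Lemma realS_interior (U : set R[i]) : open U -> U !=set0 -> U `\` @realS R !=set0.
Proof.
move=> oU [z Uz]; have [[z0 _]|] := pselect (realS z); last by exists z.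
have /nbhs_normc[e e0 eU] : nbhs z U by exact: open_nbhs_nbhs.
exists (z + (e / 2) *i); split.
  apply: eU; rewrite addrAC subrr add0r.
  apply: le_lt_trans (normc_ReIm_le _) _ => /=.
  by rewrite normr0 add0r gtr0_norm ?half_gt0// ltr_pdivrMr// ltr_pMr// ltr1n.
by move=> [+ _]; rewrite ImD z0/= add0r => /eqP; rewrite gt_eqF// half_gt0.
Qed.

Lemma normc_proper : proper_height (@normc R : R[i] -> R).
Proof.
split; [exact: normc_ge0|exact: continuous_normc| |].
  by move=> r r0; exists 0; rewrite /sublevel /= -{1}(@normc0 R) in r0 *.
move=> z z0 /nbhs_normc[d d0 Hd].
pose t := 1 + d / (2 * normc z).
have dz : 0 < d / (2 * normc z) by rewrite divr_gt0// mulr_gt0.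
have /Hd : normc (t%:C * z - z) < d.
  rewrite -{2}[z]mul1r -mulrBl -(rmorph1 (real_complex R)) -rmorphB normcM normcR /t.
  rewrite [1 + _]addrC addrK gtr0_norm// invfM mulrA divfK ?gt_eqF//.
  by rewrite ltr_pdivrMr// ltr_pMr// ltr1n.
rewrite normcM normcR gtr0_norm; last by rewrite /t; lra.
by rewrite leNgt ltr_pMl// /t ltrDl dz.
Qed.

Lemma expRe_proper : proper_height (fun z : R[i] => expR (- Re z)).
Proof.
have cRe : continuous Re.
  by apply: lipschitz_continuous => x y; rewrite -ReN -ReD; exact: Re_le_normc.
split.
- by move=> z; exact: expR_ge0.
- move=> z; apply: (@continuous_comp _ _ _ (fun z => - Re z) expR); last exact: continuous_expR.
  by apply: (@continuousN _ _ _ Re); exact: cRe.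
- move=> r r0; exists ((1 - ln r)%:C); rewrite /sublevel /= -{2}[r]lnK ?posrE// ltr_expR; lra.
- move=> z _ /nbhs_normc[d d0 Hd].
  have /Hd : normc (z - (d / 2)%:C - z) < d.
    rewrite addrAC subrr add0r normcNE normcR gtr0_norm ?half_gt0//.
    by rewrite ltr_pdivrMr// ltr_pMr// ltr1n.
  by rewrite ler_expR ReD ReN /=; have := half_gt0 d0; lra.
Qed.

End HeightFunctions.

(** * Kapteyn's inequality and its converse *)

Section KapteynInequality.
Context {R : realType}.
Implicit Types (x z t w : R[i]).
Local Notation Re := (@complex.Re R).
Local Notation Im := (@complex.Im R).

Lemma prim_root_inv N w j : N.+1.-primitive_root w -> (w ^+ j)^-1 = (w ^+ j) ^+ N.
Proof.
move=> wN; have wj : (w ^+ j) ^+ N.+1 = 1.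
  by rewrite exprAC (prim_expr_order wN) expr1n.
have w0 : w ^+ j != 0 by apply: contra_eq_neq wj => ->; rewrite expr0n/= eq_sym oner_eq0.
by apply: (mulfI w0); rewrite mulfV// -exprS wj.
Qed.

(* The average over the N-th roots of unity of
   [exp (x tau / 2) exp (- x / (2 tau)) tau ^- n], tau = t w ^ j, with truncated
   exponentials: a truncation of Bessel's integral. *)
Lemma bessel_average n m x t w : t != 0 -> (2 * (m + n) + n).+1.-primitive_root w ->
  \sum_(j < (2 * (m + n) + n).+1)
     exp_sum (m + n) (x / 2 * (t * w ^+ j)) * exp_sum (m + n) (- (x / 2) * (t * w ^+ j)^-1) *
     (t * w ^+ j)^-1 ^+ n =
  (2 * (m + n) + n).+1%:R * ((x / 2) ^+ n * bes_sum n m ((x / 2) ^+ 2)).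
Proof.
set M := (m + n)%N; set N := (2 * M + n)%N => t0 wN.
pose c k : R[i] := (x / 2) ^+ k / k`!%:R * t ^+ k.
pose d l : R[i] := (- (x / 2)) ^+ l / l`!%:R * t^-1 ^+ (l + n).
transitivity (\sum_(j < N.+1) \sum_(k < M) \sum_(l < M)
    c k * d l * (w ^+ j) ^+ (k + N * (l + n))).
  apply: eq_bigr => j _; rewrite -mulrA mulr_suml; apply: eq_bigr => k _.
  rewrite [X in _ * X = _]mulr_suml mulr_sumr; apply: eq_bigr => l _.
  rewrite /c /d invfM (prim_root_inv _ wN) exprMn exprD [X in _ = _ * X]exprD.
  rewrite [(w ^+ j) ^+ (N * _)]exprM !exprMn [X in _ = _ * (_ * X)]exprD; ring.
rewrite exchange_big/=.
transitivity (\sum_(k < M) \sum_(l < M) c k * d l * (if k == (l + n)%N :> nat then N.+1%:R else 0)).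
  apply: eq_bigr => k _; rewrite exchange_big/=; apply: eq_bigr => l _.
  rewrite -mulr_sumr (sum_prim_root _ wN).
  (* The exponent N acts as -1 modulo the number N + 1 of nodes; k and l + n are both smaller than N
     + 1, so congruence means equality. *)
  suff -> : (N.+1 %| k + N * (l + n))%N = (k == (l + n)%N :> nat) by [].
  have kM := ltn_ord k; have lM := ltn_ord l.
  apply/idP/eqP => [/dvdnP[q E]|->]; last first.
    by apply/dvdnP; exists (l + n)%N; rewrite mulnS [(N * _)%N]mulnC.
  have E2 : (k + (l + n) * N.+1 = q * N.+1 + (l + n))%N.
    by rewrite mulnS -E [(N * _)%N]mulnC; lia.
  have : (k = l + n %[mod N.+1])%N.
    by rewrite -(modnMDl (l + n) k) addnC E2 modnMDl.
  by rewrite !modn_small//; rewrite /N; lia.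
rewrite exchange_big/= /bes_sum mulr_sumr mulr_sumr.
rewrite -(big_mkord predT (fun l => \sum_(k < M) c k * d l * (if k == (l + n)%N :> nat then N.+1%:R else 0))).
(* An index l >= m would pair with k = l + n >= m + n, beyond the truncation; exactly m terms of the
   Bessel series survive. *)
rewrite (big_cat_nat (leq0n m) (leq_addr n m))/= [X in _ + X]big_nat_cond.
rewrite [X in _ + X]big1 ?addr0 => [|l]; last first.
  rewrite andbT => /andP[ml lM]; apply: big1 => k _; case: eqP => [E|_]; last by rewrite mulr0.
  by have := ltn_ord k; rewrite E /M; lia.
rewrite big_mkord; apply: eq_bigr => l _.
have lM : (l + n < M)%N by rewrite /M ltn_add2r.
rewrite (bigD1 (Ordinal lM))//= eqxx big1 ?addr0 => [|k kl]; last first.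
  case: eqP => [E|_]; last by rewrite mulr0.
  by move: kl; rewrite -val_eqE/= E eqxx.
have tt : t ^+ (l + n) * t^-1 ^+ (l + n) = 1 by rewrite -exprMn mulfV// expr1n.
rewrite /c /d /bes_coef (addnC n l) natrM invfM -exprM mulnC exprM.
rewrite [(- (x / 2)) ^+ l]exprNn.
transitivity ((x / 2) ^+ (l + n) / (l + n)`!%:R * ((-1) ^+ l * (x / 2) ^+ l / l`!%:R) *
  (t ^+ (l + n) * t^-1 ^+ (l + n)) * N.+1%:R); first by ring.
rewrite tt mulr1 [(x / 2) ^+ (l + n)]exprD; ring.
Qed.

(** The trivial bound for Bessel's integral over the circle of radius |t|. Truncating the
    exponentials costs an error uniform on the circle, and the number of nodes cancels in the
    average. *)
Lemma normc_besselJ_le n x t (b : R) : t != 0 ->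
  (forall w, normc w = 1 -> Re (x / 2 * (t * w) - x / 2 * (t * w)^-1) <= b) ->
  normc (besselJ n x) <= (normc t)^-1 ^+ n * expR b.
Proof.
move=> t0 H; have nt : 0 < normc t by rewrite normc_gt0.
have T0 : 0 < (normc t)^-1 ^+ n by rewrite exprn_gt0// invr_gt0.
apply/ler_addgt0Pr => e e0.
pose A := normc (x / 2) * (normc t + (normc t)^-1).
have A0 : 0 <= A by rewrite mulr_ge0 ?addr_ge0 ?normc_ge0 ?invr_ge0 ?normc_ge0.
have e1 : 0 < e / 2 / (normc t)^-1 ^+ n by rewrite !divr_gt0.
pose d := Num.min 1 (e / 2 / (normc t)^-1 ^+ n / (2 * expR A + 1)).
have EA := expR_gt0 A.
have d0 : 0 < d by rewrite lt_min ltr01 divr_gt0//; lra.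
have d1 : d <= 1 by rewrite ge_min lexx.
have dE : d * (2 * expR A + 1) <= e / 2 / (normc t)^-1 ^+ n.
  by rewrite -ler_pdivlMr ?ge_min ?lexx ?orbT//; lra.
have [N1 HN1] := exp_sum_uniform A0 d0.
have nx : 0 < normc ((x / 2) ^+ n) + 1 by rewrite ltr_wpDl ?normc_ge0.
have A20 : 0 <= normc ((x / 2) ^+ 2) by exact: normc_ge0.
have [m1 Hm1] := bes_sum_uniform n A20 (divr_gt0 (half_gt0 e0) nx).
pose m := maxn N1 m1.
rewrite besselJE -[bes _ _](subrK (bes_sum n m ((x / 2) ^+ 2))) mulrDr addrC.
apply: le_trans (normcD _ _) _; rewrite (splitr e) addrA lerD//; last first.
  rewrite normcM normcBC; have := Hm1 m _ (leq_maxr _ _) (lexx _).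
  rewrite ler_pdivlMr// => h; apply: le_trans h.
  by rewrite mulrC ler_wpM2l ?normc_ge0// lerDl.
have [w wN w1] := @exists_prim_root R (2 * (m + n) + n).+1 (ltn0Sn _).
have NR : (0 : R) < (2 * (m + n) + n).+1%:R by rewrite ltr0n.
rewrite -(ler_pM2l NR) -{1}(normc_nat (2 * (m + n) + n).+1) -normcM.
rewrite -(@bessel_average n m x t w t0 wN).
apply: le_trans (normc_sum _ _ _) _.
rewrite mulr_natl -[leRHS](_ : \sum_(j < (2 * (m + n) + n).+1)
  ((normc t)^-1 ^+ n * expR b + e / 2) = _); last by rewrite sumr_const card_ord.
apply: ler_sum => j _; set y := t * w ^+ j.
have wj1 : normc (w ^+ j) = 1 by rewrite normcX w1 expr1n.
have ny : normc y = normc t by rewrite normcM wj1 mulr1.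
rewrite normcM normcX normcV ny mulrC.
have -> : (normc t)^-1 ^+ n * expR b + e / 2 =
    (normc t)^-1 ^+ n * (expR b + e / 2 / (normc t)^-1 ^+ n).
  by field; rewrite expf_neq0// invr_neq0// gt_eqF.
rewrite ler_pM2l//.
have Nm : (N1 <= m + n)%N by rewrite (leq_trans (leq_maxl N1 m1))// leq_addr.
set a := x / 2 * y; set a' := - (x / 2) * y^-1.
have aA : normc a <= A.
  by rewrite normcM ny /A ler_wpM2l ?normc_ge0// lerDl invr_ge0 normc_ge0.
have aA' : normc a' <= A.
  by rewrite normcM normcNE normcV ny /A ler_wpM2l ?normc_ge0// lerDr normc_ge0.
have h1 := HN1 _ _ Nm aA; have h2 := HN1 _ _ Nm aA'.
set p := exp_sum _ a in h1 *; set q := exp_sum _ a' in h2 *.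
have pA : normc p <= expR A by apply: le_trans (normc_exp_sum_le _ _) _; rewrite ler_expR.
have qA : normc (cexp a') <= expR A.
  by rewrite normc_cexp ler_expR; apply: le_trans (Re_le _) _.
have -> : p * q = cexp (a + a') + (p * (q - cexp a') + (p - cexp a) * cexp a').
  by rewrite cexpD; ring.
apply: le_trans (normcD _ _) _; rewrite lerD//.
  rewrite normc_cexp ler_expR /a /a' mulNr; exact: H.
apply: le_trans (normcD _ _) _; rewrite (normcM p) (normcM _ (cexp a')).
apply: le_trans dE.
apply: (@le_trans _ _ (expR A * d + d * expR A)).
  by rewrite lerD// ler_pM ?normc_ge0.
by rewrite mulrDr mulr1 [d * (2 * _)]mulrCA (mulrC d); lra.
Qed.

(** As w^-1 is the conjugate of w, the left side equals 2 Re s Re w. *)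
Lemma Re_unit_average s w : normc w = 1 -> 0 <= Re s ->
  Re ((1 + s) * w - (1 - s) * w^-1) <= 2 * Re s.
Proof.
move=> w1 s0; have wJ : w^-1 = w^* by rewrite invc_norm normr_normc w1 expr1n invr1 mul1r.
have := Re_le w; rewrite w1 wJ.
case: w s {w1 wJ} s0 => a b [u v] /= u0 a1; nra.
Qed.

(* On the circle through the saddle point [t = (1 + s) / z], where
   [z (t - t^-1) / 2 = s], the real part of the exponent is maximal at [t]. *)
Lemma kapteyn_scaled n z (r : R) : z != 0 -> 0 <= r <= 1 ->
  normc (besselJ n (n%:R * (r%:C * z))) <= Omega z ^+ n.
Proof.
move=> z0 /andP[r0 r1]; set s := halfsqrt z.
have s0 : 0 <= Re s by exact: Re_halfsqrt_ge0.
have n1 : 1 + s != 0 by rewrite -normc_gt0 (lt_le_trans ltr01)// one_plus_neq0.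
pose t := (1 + s) / z.
have t0 : t != 0 by rewrite mulf_neq0// invr_neq0.
have zt : z * t = 1 + s by rewrite mulrC divfK.
have zt' : z * t^-1 = 1 - s.
  rewrite /t invf_div mulrA -expr2; have -> : z ^+ 2 = (1 - s) * (1 + s).
    by rewrite mulrBl mul1r mulrDr mulr1 -expr2 sqr_halfsqrt; ring.
  by rewrite mulfK.
apply: le_trans (@normc_besselJ_le n _ t (n%:R * Re s) t0 _) _.
  move=> w w1.
  have -> : n%:R * (r%:C * z) / 2 * (t * w) - n%:R * (r%:C * z) / 2 * (t * w)^-1 =
      (n%:R * r / 2)%:C * ((1 + s) * w - (1 - s) * w^-1).
    rewrite -zt -zt' invfM !rmorphM/= rmorph_nat fmorphV/= rmorph_nat; ring.
  rewrite ReRM; have h := Re_unit_average w1 s0.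
  have nr : 0 <= n%:R * r / 2 by rewrite divr_ge0// mulr_ge0.
  apply: le_trans (ler_wpM2l nr h) _.
  rewrite (_ : n%:R * r / 2 * (2 * Re s) = r * (n%:R * Re s)); last by field.
  by rewrite ler_piMl// mulr_ge0.
rewrite expRM_natl -exprMn OmegaE -/s /t normcM normcV invfM invrK.
rewrite le_eqVlt; apply/orP; left; apply/eqP; congr (_ ^+ _); ring.
Qed.

Lemma besselJ0 n : besselJ n (0 : R[i]) = (n == 0)%:R.
Proof.
rewrite besselJE mul0r; case: n => [|n]; last by rewrite expr0n mul0r.
rewrite expr0 mul1r expr0n; apply/eqP; rewrite -subr_eq0 -normc_eq0 eq_le normc_ge0 andbT.
have := normc_bes_sub_le 0 (0 : R[i]); rewrite normc0 mul0r expR0 subrr mulr0 fact0 invr1.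
exact.
Qed.

Lemma kapteyn_inequality n z : normc (besselJ n (n%:R * z)) <= Omega z ^+ n.
Proof.
have [->|z0] := eqVneq z 0.
  rewrite mulr0 besselJ0 OmegaE normc0 !mul0r expr0n; case: n => [|n].
    by have -> : (0%N == 0%N)%:R = 1 :> R[i] by []; rewrite normc1.
  by have -> : (n.+1 == 0%N)%:R = 0 :> R[i] by []; rewrite normc0.
have := @kapteyn_scaled n z 1 z0; rewrite rmorph1 mul1r; apply.
by rewrite ler01 lexx.
Qed.

End KapteynInequality.

(** A weak Stirling bound; the induction step is (1 - 1/(n+2))^(n+2) <= exp (-1). *)
Lemma expR_fact_le {R : realType} n : n.+1`!%:R * expR n%:R <= n.+1%:R ^+ n.+2 :> R.
Proof.
elim: n => [|n IH]; first by rewrite expR0 !mul1r expr1n.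
have n2 : (0 : R) < n.+2%:R by rewrite ltr0n.
have n1 : (0 : R) < n.+1%:R by rewrite ltr0n.
have -> : n.+2`!%:R * expR n.+1%:R = n.+2%:R * (expR 1 * (n.+1`!%:R * expR n%:R)) :> R.
  by rewrite factS natrM -[n.+1%:R in LHS]natr1 expRD; ring.
rewrite [leRHS]exprS ler_wpM2l//; apply: (@le_trans _ _ (expR 1 * n.+1%:R ^+ n.+2)).
  by rewrite ler_wpM2l ?expR_ge0.
rewrite -ler_pdivlMl ?expR_gt0// -expRN.
have : (n.+1%:R / n.+2%:R) ^+ n.+2 <= expR (- 1) :> R.
  have -> : expR (- 1) = expR (- n.+2%:R^-1) ^+ n.+2 :> R.
    by rewrite -expRM_natl mulrN mulfV// gt_eqF.
  rewrite lerXn2r ?nnegrE ?expR_ge0 ?divr_ge0//.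
  apply: le_trans (expR_ge1Dx _); rewrite ler_pdivrMr// mulrDl mul1r mulNr mulVf ?gt_eqF//.
  by rewrite -[n.+2%:R]natr1 addrK.
by rewrite expr_div_n ler_pdivrMr// exprn_gt0.
Qed.

Lemma fact_le_exp {R : realType} n : (0 < n)%N ->
  n`!%:R <= expR 1 * n%:R * (n%:R / expR 1) ^+ n :> R.
Proof.
case: n => // n _; have := @expR_fact_le R n; set m := n.+1.
rewrite expr_div_n -expRM_natl mulr1 => h.
rewrite mulrA ler_pdivlMr ?expR_gt0// -[m%:R]natr1 expRD natr1 mulrA mulrC -/m.
apply: le_trans (ler_wpM2l (expR_ge0 1) h) _.
by rewrite exprS -mulrA.
Qed.

Lemma exp_le_fact {R : realType} n : (n%:R / expR 1) ^+ n <= n`!%:R :> R.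
Proof.
rewrite expr_div_n -expRM_natl mulr1 ler_pdivrMr ?expR_gt0//.
have f0 : (0 : R) < n`!%:R by rewrite ltr0n fact_gt0.
by rewrite mulrC -ler_pdivrMr//; exact: expR_ge_term.
Qed.

(** * Lower bounds for Bessel functions by a Riccati comparison *)

Section LiouvilleGreen.
Context {R : realType}.
Implicit Types (z : R[i]) (t : R).
Local Notation Re := (@complex.Re R).
Local Notation Im := (@complex.Im R).

Lemma Re_mulJ_le (x y : R[i]) : `|Re (x * y^*)| <= normc x * normc y.
Proof.
apply: le_trans (Re_le_normc _) _; rewrite normcM.
by have -> : normc y^* = normc y by case: y => a b /=; rewrite sqrrN.
Qed.

Lemma ReRMr (a : R) (x : R[i]) : Re (x * a%:C) = Re x * a.
Proof. by rewrite mulrC ReRM mulrC. Qed.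

Section Ode.
(** In the application Y t is J_n(n z t) divided by (n z t / 2)^n / n!, V is t Y', and s is the
    square root of 1 - z^2 t^2; [Y1], [V1], [s1] are derivatives in t. The equations are kept
    multiplied by t, so that they hold at the singular point 0. *)
Context (n : nat) (z : R[i]) (Y V s Y1 V1 s1 : R -> R[i]) (sigma : R).
Let C := normc z ^+ 2 / sigma.
Let M := C / sigma.
Context (n_gt0 : (0 < n)%N) (sigma_gt0 : 0 < sigma) (n_large : C <= n%:R * sigma ^+ 2).
Context (dY : forall t, 0 <= t <= 1 -> has_cderiv Y t (Y1 t))
  (dV : forall t, 0 <= t <= 1 -> has_cderiv V t (V1 t))
  (ds : forall t, 0 <= t <= 1 -> has_cderiv s t (s1 t)).
Context (YV : forall t, t%:C * Y1 t = V t)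
  (ode : forall t, t%:C * V1 t = - (2 * n%:R * V t + n%:R ^+ 2 * (z ^+ 2 * t%:C ^+ 2) * Y t))
  (s1E : forall t, 0 <= t <= 1 -> t%:C * s1 t * s t = - (z ^+ 2 * t%:C ^+ 2))
  (s2E : forall t, s t ^+ 2 = 1 - z ^+ 2 * t%:C ^+ 2)
  (s_ge : forall t, 0 <= t <= 1 -> sigma <= Re (s t))
  (Y0 : Y 0 = 1) (s0 : s 0 = 1).

(* The Riccati remainder: [x y' = n s y + x ^ n E] for the solution [y = x ^ n Y]
   of Bessel's equation. *)
Let E t := V t + n%:R * (1 - s t) * Y t.
Let E1 t := V1 t + n%:R * ((0 - s1 t) * Y t + (1 - s t) * Y1 t).

Let dE t : 0 <= t <= 1 -> has_cderiv E t (E1 t).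
Proof.
move=> t01; apply: has_cderivD; first exact: dV.
have h := has_cderivM (has_cderivB (has_cderiv_cst 1 t) (ds t01)) (dY t01).
have := has_cderivZ n%:R h; by under eq_fun do rewrite mulrA.
Qed.

Let C_ge0 : 0 <= C. Proof. by rewrite divr_ge0 ?sqr_ge0// ltW. Qed.
Let M_ge0 : 0 <= M. Proof. by rewrite divr_ge0// ltW. Qed.
Let sigma_M : sigma * M = C. Proof. by rewrite mulrC divfK// gt_eqF. Qed.
Let M_le : M ^+ 2 <= n%:R * C.
Proof.
by rewrite /M expr_div_n ler_pdivrMr ?exprn_gt0// [leRHS]mulrAC (expr2 C) ler_wpM2r.
Qed.

Let s_neq0 t : 0 <= t <= 1 -> s t != 0.
Proof.
move=> t01; apply/negP => /eqP st; have := s_ge t01; rewrite st /= => h.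
by have := lt_le_trans sigma_gt0 h; rewrite ltxx.
Qed.

Let q t := - (t%:C * s1 t).

Let q_le t : 0 <= t <= 1 -> normc (q t) <= C * t ^+ 2.
Proof.
move=> t01; have st := s_neq0 t01.
have -> : q t = z ^+ 2 * t%:C ^+ 2 / s t.
  by rewrite /q -[t%:C * s1 t](mulfK st) s1E// mulNr opprK.
rewrite normcM normcV normcM !normcX normcR.
have -> : `|t| ^+ 2 = t ^+ 2 by rewrite real_normK ?num_real.
have zt0 : 0 <= normc z ^+ 2 * t ^+ 2 by apply: mulr_ge0; exact: sqr_ge0.
rewrite /C [leRHS]mulrAC ler_wpM2l//.
rewrite lef_pV2 ?posrE ?normc_gt0//; apply: le_trans (s_ge t01) (Re_le _).
Qed.

Let tE1 t : t%:C * E1 t = - (n%:R * (1 + s t) * E t) + n%:R * (q t * Y t).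
Proof.
have h : n%:R ^+ 2 * (z ^+ 2 * t%:C ^+ 2) * Y t = n%:R ^+ 2 * (1 - s t ^+ 2) * Y t.
  by rewrite s2E opprB addrC subrK.
rewrite /E1 mulrDr ode h.
have -> : t%:C * (n%:R * ((0 - s1 t) * Y t + (1 - s t) * Y1 t)) =
    n%:R * (q t * Y t + (1 - s t) * (t%:C * Y1 t)) by rewrite /q; ring.
rewrite YV /E; ring.
Qed.

(** A barrier: F >= 0 says |E| <= M t |Y|. The weight t^(2n) turns the terms of order n in t F' into
    2 n Re s (M^2 t^2 |Y|^2 + |E|^2), which is positive because Re s >= sigma. *)
Let F t := (t ^+ n) ^+ 2 * (M ^+ 2 * t ^+ 2 * normc (Y t) ^+ 2 - normc (E t) ^+ 2).
Let F1 t := (2 * t ^+ n * (n%:R * t ^+ n.-1)) *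
    (M ^+ 2 * t ^+ 2 * normc (Y t) ^+ 2 - normc (E t) ^+ 2) +
  (t ^+ n) ^+ 2 * (M ^+ 2 * (2 * t) * normc (Y t) ^+ 2 +
    M ^+ 2 * t ^+ 2 * (2 * Re (Y1 t * (Y t)^*)) - 2 * Re (E1 t * (E t)^*)).

Let dF t : 0 <= t <= 1 -> has_deriv F t (F1 t).
Proof.
move=> t01.
have tn k : has_deriv (fun t => t ^+ k) t (k%:R * t ^+ k.-1).
  by apply: has_deriv_eq (has_derivX k (has_deriv_id t)) _; rewrite mulr1.
have h1 := has_derivX 2 (tn n).
have h2 := has_derivM (has_derivZ (M ^+ 2) (tn 2)) (has_deriv_sqr_normc (dY t01)).
have h3 := has_deriv_sqr_normc (dE t01).
by apply: has_deriv_eq (has_derivM h1 (has_derivB h2 h3)) _; rewrite /F1 /= !expr1.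
Qed.

(** By the arithmetic-geometric mean inequality the main term is at least 4 n sigma M t |Y| |E| = 4
    n C t |Y| |E|. Half of it pays for the source term q Y, as |q| <= C t^2; the other half pays for
    the coupling of Y and E, as M^2 <= n C by [n_large]. *)
Let F1_ge0 t : 0 < t < 1 -> 0 <= F1 t.
Proof.
move=> /andP[t0 t1]; have t01 : 0 <= t <= 1 by rewrite !ltW.
rewrite -(pmulr_rge0 _ t0).
set y := normc (Y t); set e := normc (E t).
have y0 : 0 <= y by exact: normc_ge0.
have e0 : 0 <= e by exact: normc_ge0.
pose r := Re (E t * (Y t)^*).
pose k := Re (q t * Y t * (E t)^*).
have RV : t * Re (Y1 t * (Y t)^*) = r - n%:R * (1 - Re (s t)) * y ^+ 2.
  rewrite -ReRM mulrA YV.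
  have -> : V t = E t - n%:R * (1 - s t) * Y t by rewrite /E addrK.
  rewrite mulrBl ReD ReN -/r /y sqr_normc_ReIm.
  have -> : n%:R * (1 - s t) * Y t * (Y t)^* = (n%:R)%:C * ((1 - s t) * (Y t * (Y t)^*)).
    by rewrite rmorph_nat; ring.
  rewrite ReRM; have -> : Y t * (Y t)^* = (Re (Y t) ^+ 2 + Im (Y t) ^+ 2)%:C.
    by case: (Y t) => a b; apply: complexP => /=; ring.
  by rewrite ReRMr ReD ReN /=; ring.
have RE : t * Re (E1 t * (E t)^*) = - (n%:R * (1 + Re (s t)) * e ^+ 2) + n%:R * k.
  rewrite -ReRM mulrA tE1 mulrDl mulNr ReD ReN /e sqr_normc_ReIm.
  have -> : n%:R * (1 + s t) * E t * (E t)^* = (n%:R)%:C * ((1 + s t) * (E t * (E t)^*)).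
    by rewrite rmorph_nat; ring.
  have -> : n%:R * (q t * Y t) * (E t)^* = (n%:R)%:C * (q t * Y t * (E t)^*).
    by rewrite rmorph_nat; ring.
  rewrite !ReRM -/k; have -> : E t * (E t)^* = (Re (E t) ^+ 2 + Im (E t) ^+ 2)%:C.
    by case: (E t) => a b; apply: complexP => /=; ring.
  by rewrite ReRMr ReD /=; ring.
have tn : t * t ^+ n.-1 = t ^+ n by rewrite -exprS prednK.
have -> : t * F1 t = (t ^+ n) ^+ 2 * (2 * n%:R * Re (s t) * (M ^+ 2 * t ^+ 2 * y ^+ 2 + e ^+ 2) +
    2 * M ^+ 2 * t ^+ 2 * y ^+ 2 + 2 * M ^+ 2 * t ^+ 2 * r - 2 * n%:R * k).
  rewrite /F1 -/y -/e.
  transitivity ((2 * t ^+ n * (n%:R * (t * t ^+ n.-1))) * (M ^+ 2 * t ^+ 2 * y ^+ 2 - e ^+ 2) +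
    (t ^+ n) ^+ 2 * (2 * M ^+ 2 * t ^+ 2 * y ^+ 2 +
      2 * M ^+ 2 * t ^+ 2 * (t * Re (Y1 t * (Y t)^*)) - 2 * (t * Re (E1 t * (E t)^*)))).
    by ring.
  by rewrite tn RV RE; ring.
rewrite mulr_ge0 ?sqr_ge0//.
have r_le : `|r| <= e * y by exact: Re_mulJ_le.
have k_le : `|k| <= C * t ^+ 2 * (y * e).
  rewrite /k; apply: le_trans (Re_mulJ_le _ _) _; rewrite normcM -/y -/e -mulrA.
  by rewrite ler_wpM2r ?mulr_ge0// q_le.
have t2t : t ^+ 2 <= t by rewrite expr2 ler_piMr// ltW.
have ye : 0 <= y * e by rewrite mulr_ge0.
have n0 : (0 : R) <= n%:R by [].
have t20 : 0 <= t ^+ 2 by exact: sqr_ge0.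
have M20 : 0 <= M ^+ 2 by exact: sqr_ge0.
have h1 : 2 * n%:R * sigma * (2 * (M * t) * (y * e)) <=
    2 * n%:R * Re (s t) * (M ^+ 2 * t ^+ 2 * y ^+ 2 + e ^+ 2).
  have amgm : 2 * (M * t) * (y * e) <= M ^+ 2 * t ^+ 2 * y ^+ 2 + e ^+ 2.
    by have := sqr_ge0 (M * t * y - e); rewrite !expr2; lra.
  have Mt0 : 0 <= M * t by apply: mulr_ge0 => //; exact: ltW.
  have p0 : 0 <= 2 * (M * t) * (y * e) by apply: mulr_ge0 => //; exact: mulr_ge0.
  have a0 : 0 <= 2 * n%:R * sigma by apply: mulr_ge0; [exact: mulr_ge0|exact: ltW].
  by apply: ler_pM => //; apply: ler_wpM2l; [exact: mulr_ge0|exact: s_ge].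
have h2 : - (2 * M ^+ 2 * t * (y * e)) <= 2 * M ^+ 2 * t ^+ 2 * r.
  have : - (t ^+ 2 * (e * y)) <= t ^+ 2 * r.
    by rewrite -mulrN ler_wpM2l//; move: r_le; rewrite ler_norml => /andP[].
  have : t ^+ 2 * (e * y) <= t * (e * y) by rewrite ler_wpM2r// mulrC.
  move=> a1 a2; have : M ^+ 2 * - (t * (e * y)) <= M ^+ 2 * (t ^+ 2 * r).
    by rewrite ler_wpM2l//; lra.
  lra.
have h3 : - (2 * n%:R * C * t * (y * e)) <= - (2 * n%:R * k).
  have : k <= C * t * (y * e).
    apply: le_trans (ler_norm _) _; apply: le_trans k_le _.
    by rewrite ler_wpM2r// ler_wpM2l.
  move=> a1; have : n%:R * k <= n%:R * (C * t * (y * e)) by rewrite ler_wpM2l.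
  lra.
have h4 : 0 <= 2 * M ^+ 2 * t ^+ 2 * y ^+ 2.
  apply: mulr_ge0 (sqr_ge0 y); apply: mulr_ge0 (sqr_ge0 t).
  by apply: mulr_ge0 (sqr_ge0 M).
have h5 : 2 * n%:R * sigma * (2 * (M * t) * (y * e)) = 4 * (n%:R * C) * (t * (y * e)).
  by rewrite -sigma_M; ring.
have tye : 0 <= t * (y * e) by rewrite mulr_ge0// ltW.
have h6 : M ^+ 2 * (t * (y * e)) <= n%:R * C * (t * (y * e)) by rewrite ler_wpM2r.
rewrite h5 in h1; lra.
Qed.

Let E_le t : 0 < t <= 1 -> normc (E t) <= M * t * normc (Y t).
Proof.
move=> /andP[t0 t1].
have : F 0 <= F t.
  apply: (has_deriv_nondecreasing (df := F1)) (ltW t0) _ _ => x /andP[x0 xt].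
    by apply: dF; rewrite x0 (le_trans xt).
  by apply: F1_ge0; rewrite x0 (lt_le_trans xt).
have -> : F 0 = 0 by rewrite /F expr0n gtn_eqF// expr0n !mul0r.
rewrite /F pmulr_rge0 ?exprn_gt0// subr_ge0 -!exprMn => h.
have Mt0 : 0 <= M * t by apply: mulr_ge0 => //; exact: ltW.
rewrite -(@ler_pXn2r _ 2)// nnegrE ?normc_ge0//.
by apply: mulr_ge0 => //; exact: normc_ge0.
Qed.

(** kappa^(-n) is the Liouville-Green approximation of Y: t kappa' = (1 - s) kappa and kappa 0 = 1.
    In H = Y kappa^n the main terms cancel, leaving t H' = kappa^n E. *)
Let kappa t := cexp (1 - s t) * (1 + s t) / 2.
Let kappa1 t := - (cexp (1 - s t) * s t * s1 t / 2).

Let dkappa t : 0 <= t <= 1 -> has_cderiv kappa t (kappa1 t).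
Proof.
move=> t01.
have h1 := has_cderiv_cexp (has_cderivB (has_cderiv_cst 1 t) (ds t01)).
have h2 := has_cderivD (has_cderiv_cst 1 t) (ds t01).
have := has_cderivZ 2^-1 (has_cderivM h1 h2); under eq_fun do rewrite mulrC.
by move=> h; apply: has_cderiv_eq h _; rewrite /kappa1; field.
Qed.

Let H t := Y t * kappa t ^+ n.
Let H1 t := Y1 t * kappa t ^+ n + Y t * (n%:R * kappa t ^+ n.-1 * kappa1 t).

Let dH t : 0 <= t <= 1 -> has_cderiv H t (H1 t).
Proof.
by move=> t01; apply: has_cderivM (dY t01) _; apply: has_cderivX; exact: dkappa.
Qed.

Let tH1 t : 0 <= t <= 1 -> t%:C * H1 t = kappa t ^+ n * E t.
Proof.
move=> t01.
have k1 : t%:C * kappa1 t = (1 - s t) * kappa t.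
  have -> : t%:C * kappa1 t = - (cexp (1 - s t) * (t%:C * s1 t * s t) / 2).
    by rewrite /kappa1; ring.
  rewrite s1E// /kappa.
  have -> : z ^+ 2 * t%:C ^+ 2 = (1 - s t) * (1 + s t).
    by rewrite mulrBl mul1r mulrDr mulr1 -expr2 s2E; ring.
  by field.
have kn : kappa t * kappa t ^+ n.-1 = kappa t ^+ n by rewrite -exprS prednK.
transitivity ((t%:C * Y1 t) * kappa t ^+ n +
  Y t * n%:R * kappa t ^+ n.-1 * (t%:C * kappa1 t)); first by rewrite /H1; ring.
by rewrite k1 YV -kn /E; ring.
Qed.

Let Q t := normc (H t) ^+ 2 * expR (2 * M * t).

(** A Gronwall argument: |H'| <= M |H| makes |H|^2 exp (2 M t) nondecreasing, starting from 1. The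
    constant M does not depend on n. *)
Lemma liouville_green_bound : expR (- M) <= normc (Y 1) * normc (kappa 1) ^+ n.
Proof.
have dQ t : 0 <= t <= 1 -> has_deriv Q t
    (2 * Re (H1 t * (H t)^*) * expR (2 * M * t) + normc (H t) ^+ 2 * (expR (2 * M * t) * (2 * M))).
  move=> t01; apply: has_derivM; first exact: has_deriv_sqr_normc (dH t01).
  apply: has_deriv_expR; apply: has_deriv_eq (has_derivZ _ (has_deriv_id t)) _.
  by rewrite mulr1.
have : Q 0 <= Q 1.
  apply: has_deriv_nondecreasing ler01 dQ _ => t /andP[t0 t1].
  have t01 : 0 <= t <= 1 by rewrite !ltW.
  rewrite (_ : _ + _ = 2 * expR (2 * M * t) * (Re (H1 t * (H t)^*) + M * normc (H t) ^+ 2)); last by ring.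
  rewrite mulr_ge0 ?mulr_ge0 ?expR_ge0// -(pmulr_rge0 _ t0) mulrDr -ReRM mulrA tH1//.
  have h1 := Re_mulJ_le (kappa t ^+ n * E t) (H t).
  have t02 : 0 < t <= 1 by rewrite t0 ltW.
  have h2 : normc (kappa t ^+ n * E t) <= t * M * normc (H t).
    rewrite normcM /H normcM mulrA [t * M]mulrC [leRHS]mulrC ler_wpM2l ?normc_ge0//.
    exact: E_le.
  have h3 : normc (kappa t ^+ n * E t) * normc (H t) <= t * M * normc (H t) * normc (H t).
    by rewrite ler_wpM2r ?normc_ge0.
  move: h1; rewrite ler_norml => /andP[h1 _].
  by rewrite expr2; lra.
have k0 : kappa 0 = 1.
  by rewrite /kappa s0 subrr cexp0 mul1r divff// (_ : 1 + 1 = 2%:R) ?pnatr_eq0.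
have -> : Q 0 = 1 by rewrite /Q /H Y0 k0 expr1n mul1r normc1 expr1n mulr0 expR0 mulr1.
rewrite /Q mulr1 /H normcM normcX => h.
rewrite -(@ler_pXn2r _ 2)// ?nnegrE ?expR_ge0 ?mulr_ge0 ?exprn_ge0 ?normc_ge0//.
by rewrite -expRM_natl mulrN expRN -[leLHS]mul1r ler_pdivrMr ?expR_gt0.
Qed.

End Ode.

(** A difference of roots is the difference of their squares divided by their sum, and the sum keeps
    a real part at least Re s > 0, since principal roots have nonnegative real part. *)
Lemma halfsqrt_cderiv z t : ~ realS (t%:C * z) ->
  has_cderiv (fun x => halfsqrt (x%:C * z)) t (- (z ^+ 2 * t%:C) / halfsqrt (t%:C * z)).
Proof.
move=> nS; set s := halfsqrt (t%:C * z).
have s0 : 0 < Re s by exact: Re_halfsqrt_gt0.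
have sn0 : s != 0 by apply: contraTneq s0 => ->; rewrite /= ltxx.
have sR : Re s <= normc s by exact: Re_le.
pose D (h : R) := halfsqrt ((t + h)%:C * z) - s.
pose S (h : R) := halfsqrt ((t + h)%:C * z) + s.
have S_ge h : Re s <= normc (S h).
  by apply: le_trans (Re_le _); rewrite ReD lerDr Re_halfsqrt_ge0.
have Sn0 h : S h != 0 by rewrite -normc_gt0; apply: lt_le_trans (S_ge h).
have DS h : D h = - (z ^+ 2 * h%:C * (2 * t%:C + h%:C)) / S h.
  apply: (mulIf (Sn0 h)); rewrite mulfVK// -subr_sqr !sqr_halfsqrt rmorphD/=; ring.
pose A := normc z ^+ 2 * (2 * `|t| + 1) / Re s.
have A0 : 0 <= A by rewrite divr_ge0 ?mulr_ge0 ?normc_ge0 ?addr_ge0 ?mulr_ge0 ?(ltW s0).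
have D_le h : `|h| <= 1 -> normc (D h) <= A * `|h|.
  move=> h1; rewrite DS normcM normcNE normcV.
  rewrite (normcM _ (2 * _ + _)) (normcM _ h%:C) normcX normcR.
  have : normc (2 * t%:C + h%:C) <= 2 * `|t| + 1.
    by apply: le_trans (normcD _ _) _; rewrite normcM (normc_nat 2) !normcR lerD2l.
  have zh0 : 0 <= normc z ^+ 2 * `|h| by apply: mulr_ge0 => //; exact: sqr_ge0.
  move=> h2; rewrite /A [leRHS]mulrAC; apply: ler_pM; rewrite ?invr_ge0 ?normc_ge0//.
  - by apply: mulr_ge0 => //; exact: normc_ge0.
  - by rewrite [leRHS]mulrAC ler_wpM2l.
  by rewrite lef_pV2 ?posrE ?normc_gt0//; exact: S_ge.
pose K := normc z ^+ 2 * (`|t| * A + normc s) / (Re s * Re s).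
have K0 : 0 <= K.
  apply: divr_ge0; last by apply: mulr_ge0; exact: ltW.
  apply: mulr_ge0; first exact: sqr_ge0.
  by apply: addr_ge0; [apply: mulr_ge0|exact: normc_ge0].
apply: has_cderiv_quotient => e e0; have K1 : 0 < K + 1 by lra.
exists (Num.min 1 (e / (K + 1))); first by rewrite lt_min ltr01 divr_gt0.
move=> h; rewrite lt_min => /andP[h1 he]; rewrite -/s -/(D h).
have -> : D h - h%:C * (- (z ^+ 2 * t%:C) / s) =
    z ^+ 2 * h%:C * (t%:C * D h - h%:C * s) / (s * S h).
  have -> : D h = S h - 2 * s by rewrite /D /S; ring.
  have E : S h - 2 * s = - (z ^+ 2 * h%:C * (2 * t%:C + h%:C)) / S h.
    by rewrite -DS /D /S; ring.
  rewrite {1}E; move: (Sn0 h); move: (S h) => u u0; field.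
  by rewrite u0 sn0.
rewrite normcM normcV (normcM s) (normcM _ (_ - _)) (normcM _ h%:C) normcX normcR.
have h2 : normc (t%:C * D h - h%:C * s) <= (`|t| * A + normc s) * `|h|.
  apply: le_trans (normcB _ _) _; rewrite !normcM !normcR mulrDl [normc s * _]mulrC.
  by rewrite lerD2r -mulrA ler_wpM2l// D_le// ltW.
have h3 : (normc s * normc (S h))^-1 <= (Re s * Re s)^-1.
  rewrite lef_pV2 ?posrE ?mulr_gt0 ?normc_gt0//.
  by rewrite ler_pM ?(ltW s0).
apply: (@le_trans _ _ (normc z ^+ 2 * `|h| * ((`|t| * A + normc s) * `|h|) / (Re s * Re s))).
  have zh0 : 0 <= normc z ^+ 2 * `|h| by apply: mulr_ge0 => //; exact: sqr_ge0.
  apply: ler_pM; rewrite ?invr_ge0 ?mulr_ge0 ?normc_ge0//.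
  by rewrite ler_wpM2l.
rewrite [leLHS](_ : _ = K * `|h| * `|h|); last by rewrite /K; ring.
rewrite ler_wpM2r//; move: he; rewrite ltr_pdivlMr// => /ltW he; apply: le_trans he.
by rewrite mulrC ler_wpM2l// lerDl.
Qed.

Lemma realS_ray z t : 0 <= t <= 1 -> realS (t%:C * z) -> realS z.
Proof.
move=> /andP[t0 t1]; rewrite /realS /= ImRM ReRM => -[i r].
have tn0 : t != 0 by apply: contraTneq r => ->; rewrite mul0r normr0 -ltNge ltr01.
split; first by move/eqP: i; rewrite mulf_eq0 (negbTE tn0) => /eqP.
by apply: le_trans r _; rewrite normrM ger0_norm// ler_piMl.
Qed.

(** With Y 0 = 1 one has J_n(n z) = (n z / 2)^n / n! Y(1), and Omega z = |z| e / (2 |kappa(1)|); the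
    factor (n / e)^n / n! is what remains of the normalization. *)
Lemma besselJ_lower z : ~ realS z -> exists2 c : R, 0 < c & exists N, forall n, (N <= n)%N ->
  c * ((n%:R / expR 1) ^+ n / n`!%:R) * Omega z ^+ n <= normc (besselJ n (n%:R * z)).
Proof.
move=> nS; have nSt t : 0 <= t <= 1 -> ~ realS (t%:C * z) by move=> t01 /(realS_ray t01).
pose s t := halfsqrt (t%:C * z).
pose s1 t := - (z ^+ 2 * t%:C) / s t.
have ds t : 0 <= t <= 1 -> has_cderiv s t (s1 t).
  by move=> t01; apply: halfsqrt_cderiv; exact: nSt.
(* The segment from 0 to z avoids S, so Re s has a positive minimum sigma on it. *)
have [c0 c01 Hc] := EVT_min ler01 (has_deriv_within (fun t ht => (ds t ht).1)).
pose sigma := Re (s c0).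
have sigma0 : 0 < sigma.
  by apply: Re_halfsqrt_gt0; apply: nSt; move: c01; rewrite in_itv.
pose C := normc z ^+ 2 / sigma; pose M := C / sigma.
exists (expR (- M)); first exact: expR_gt0.
have C0 : 0 <= C by rewrite divr_ge0 ?sqr_ge0// ltW.
exists (maxn 1 (Num.bound (C / sigma ^+ 2))) => n; rewrite geq_max => /andP[n1 nC].
have nlarge : C <= n%:R * sigma ^+ 2.
  rewrite -ler_pdivrMr ?exprn_gt0//; apply: le_trans (ltW (archi_boundP _)) _.
    by rewrite divr_ge0// exprn_ge0// ltW.
  by rewrite ler_nat.
pose u := (n%:R * z / 2) ^+ 2.
pose f : R[i] := n`!%:R.
have tsq t : has_deriv (fun x => x ^+ 2) t (2 * t).
  by apply: has_deriv_eq (has_derivX 2 (has_deriv_id t)) _; rewrite expr1 mulr1.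
pose b m t := bes m (u * (t ^+ 2)%:C).
have db m t : has_cderiv (b m) t (- 2 * u * t%:C * b m.+1 t).
  have h : has_cderiv (b m) t ((2 * t)%:C * (- u * bes m.+1 (u * (t ^+ 2)%:C))).
    exact: (@has_cderiv_comp R (fun s => bes m (u * s%:C)) (fun x => x ^+ 2) t (2 * t) _
      (has_cderiv_bes m u (t ^+ 2)) (tsq t)).
  apply: has_cderiv_eq h _.
  by rewrite rmorphM/= rmorph_nat /b; ring.
pose Y t := f * b n t.
pose Y1 t := f * (- 2 * u * t%:C * b n.+1 t).
pose V t := - 2 * f * u * (t%:C ^+ 2 * b n.+1 t).
pose V1 t := - 2 * f * u * (2 * t%:C * b n.+1 t + t%:C ^+ 2 * (- 2 * u * t%:C * b n.+2 t)).
have dY t : 0 <= t <= 1 -> has_cderiv Y t (Y1 t) by move=> _; exact: has_cderivZ.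
have dV t : 0 <= t <= 1 -> has_cderiv V t (V1 t).
  move=> _; apply: has_cderivZ; apply: has_cderivM (db _ _).
  by apply: has_cderiv_eq (has_cderivX 2 (has_cderiv_id t)) _; rewrite expr1 mulr1.
have YV t : t%:C * Y1 t = V t by rewrite /Y1 /V; ring.
have uE : 4 * u = n%:R ^+ 2 * z ^+ 2 by rewrite /u; field.
(* Bessel's equation for x^n Y with x = n z t, rewritten for Y; it reduces to [bes_rec] because 4 u
   = n^2 z^2. *)
have ode t : t%:C * V1 t = - (2 * n%:R * V t + n%:R ^+ 2 * (z ^+ 2 * t%:C ^+ 2) * Y t).
  have rec := bes_rec n (u * (t ^+ 2)%:C); rewrite -!/(b _ t) rmorphXn/= in rec.
  rewrite -natr1 in rec.
  have h : u * t%:C ^+ 2 * b n.+2 t = (n%:R + 1) * b n.+1 t - b n t by rewrite rec; ring.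
  rewrite mulrA -uE /V1 /V /Y.
  transitivity (- 4 * f * u * t%:C ^+ 2 * (b n.+1 t - u * t%:C ^+ 2 * b n.+2 t)); first by ring.
  by rewrite h; ring.
have sn0 t : 0 <= t <= 1 -> s t != 0.
  move=> /nSt /Re_halfsqrt_gt0; rewrite -/(s t); apply: contraTneq => ->.
  by rewrite /= ltxx.
have s1E t : 0 <= t <= 1 -> t%:C * s1 t * s t = - (z ^+ 2 * t%:C ^+ 2).
  by move=> t01; rewrite /s1; have := sn0 t t01; move: (s t) => v v0; field.
have s2E t : s t ^+ 2 = 1 - z ^+ 2 * t%:C ^+ 2.
  by rewrite /s sqr_halfsqrt exprMn mulrC.
have s_ge t : 0 <= t <= 1 -> sigma <= Re (s t).
  by move=> t01; apply: Hc; rewrite in_itv.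
have bes0 m : bes m (0 : R[i]) = m`!%:R^-1.
  apply/eqP; rewrite -subr_eq0 -normc_eq0 eq_le normc_ge0 andbT.
  by have := normc_bes_sub_le m (0 : R[i]); rewrite normc0 mul0r expR0 subrr mulr0.
have f0 : f != 0 by rewrite pnatr_eq0 -lt0n fact_gt0.
have Y0 : Y 0 = 1.
  by rewrite /Y /b expr0n/= rmorph0 mulr0 bes0 mulfV.
have s0 : s 0 = 1.
  by rewrite /s rmorph0 mul0r /halfsqrt expr0n subr0 sqrtc1.
have := liouville_green_bound n1 sigma0 nlarge dY dV ds YV ode s1E s2E s_ge Y0 s0.
rewrite -/C -/M; have -> : Y 1 = f * bes n u by rewrite /Y /b expr1n mulr1.
have sz : s 1 = halfsqrt z by rewrite /s rmorph1 mul1r.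
have N0 : 0 < normc (1 + halfsqrt z).
  by rewrite (lt_le_trans ltr01)// one_plus_neq0// Re_halfsqrt_ge0.
rewrite sz (normcM f) (normcM _ 2^-1) normcV (normc_nat 2) (normcM (cexp _)) normc_cexp.
rewrite ReD ReN [complex.Re 1]/= => h.
set k := expR (1 - Re (halfsqrt z)) * normc (1 + halfsqrt z) / 2 in h.
have k0 : 0 < k by rewrite divr_gt0// mulr_gt0 ?expR_gt0.
have fR : (0 : R) < n`!%:R by rewrite ltr0n fact_gt0.
have OE : Omega z = normc z / 2 * expR 1 / k.
  rewrite OmegaE /k expRB; field.
  by rewrite !gt_eqF ?expR_gt0.
rewrite besselJE normcM normcX.
have -> : normc (n%:R * z / 2) = n%:R * (normc z / 2).
  by rewrite normcM normcV normcM !normc_nat mulrA.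
have nz : 0 <= n%:R * (normc z / 2) by rewrite mulr_ge0 ?divr_ge0 ?normc_ge0.
rewrite -/u; apply: (@le_trans _ _ ((n%:R * (normc z / 2)) ^+ n * (expR (- M) / k ^+ n / n`!%:R))).
  rewrite le_eqVlt; apply/orP; left; apply/eqP.
  have -> : n%:R * (normc z / 2) = n%:R / expR 1 * Omega z * k.
    by rewrite OE; field; rewrite !gt_eqF ?expR_gt0.
  rewrite !exprMn; field.
  by apply/and4P; split; rewrite ?expf_neq0// gt_eqF ?invr_gt0 ?expR_gt0.
rewrite ler_wpM2l ?exprn_ge0// ler_pdivrMr// ler_pdivrMr ?exprn_gt0//.
by apply: le_trans h _; rewrite normc_nat (mulrC n`!%:R).
Qed.

End LiouvilleGreen.

(** * Power, Neumann and Kapteyn series *)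

Section UnitExpansion.
Context {R : realType}.
Context (phi : nat -> R[i] -> R[i]) (beta : nat -> R) (w : R[i] -> R).
Context (beta_ge0 : forall n, 0 <= beta n) (w_ge0 : forall z, 0 <= w z).
Context (phi_le : forall M : R, 0 <= M -> exists2 C : R, 0 <= C &
  forall n z, normc z <= M -> normc (phi n z) <= C * (beta n * w z ^+ n)).
Context (w_lin : exists2 B : R, 0 <= B & forall z, normc z <= 1 -> w z <= B * normc z).
Context (phi_ge0 : forall m, exists2 c : R, 0 < c & exists2 d : R, 0 < d &
  forall z, normc z <= d -> c * normc z ^+ m <= normc (phi m z)).
Context (e : nat -> R[i]).
Context (unitE : forall z, normc z <= 1 ->
  (fun n => \sum_(k < n.+1) e k * phi k z) @ \oo --> (1 : R[i])).
Context (e_small : forall L : R, exists N, forall n, (N <= n)%N ->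
  normc (e n) * beta n <= expR (n%:R * L)).

(* Otherwise [a] is proportional to the coefficients [e] of an expansion of 1, by the
   uniqueness of expansions near 0, and these decay too fast. *)
Lemma sections_nonconstant (a : nat -> R[i]) (rho : R) : 0 < rho ->
  (forall L, - ln rho < L -> exists N, forall n, (N <= n)%N ->
    normc (a n) * beta n <= expR (n%:R * L)) ->
  (forall L, L < - ln rho -> ~ exists N, forall n, (N <= n)%N ->
    normc (a n) * beta n <= expR (n%:R * L)) ->
  forall c, ~ forall z, sublevel w rho z ->
    (fun n => \sum_(k < n.+1) a k * phi k z) @ \oo --> (c : R[i]).
Proof.
move=> r0 a_le a_ge c H.
have [B B0 HB] := w_lin.
have B1 : 0 < B + 1 by lra.
pose d := Num.min 1 (rho / 2 / (B + 1)).
have d0 : 0 < d by rewrite lt_min ltr01 divr_gt0// half_gt0.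
have dD z : normc z <= d -> normc z <= 1 /\ sublevel w rho z.
  rewrite le_min => /andP[z1]; rewrite ler_pdivlMr// => zr; split => //.
  rewrite /sublevel/=; apply: le_lt_trans (HB z z1) _.
  by have := normc_ge0 z; lra.
pose b k := a k - c * e k.
have b_le L : - ln rho < L -> exists N, forall n, (N <= n)%N ->
    normc (b n) * beta n <= expR (n%:R * L).
  move=> hL; pose L' := (L - ln rho) / 2.
  have [|N1 HN1] := a_le L'; first by rewrite /L'; lra.
  have [N2 HN2] := e_small L'.
  have [|N3 HN3] := @linear_exp_le R (1 + normc c) L' L; first by rewrite /L'; lra.
  exists (maxn N1 (maxn N2 N3)) => n; rewrite !geq_max => /and3P[n1 n2 n3].
  apply: le_trans (HN3 _ n3).
  have E0 := expR_ge0 (n%:R * L').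
  apply: (@le_trans _ _ ((1 + normc c) * expR (n%:R * L'))).
    apply: (@le_trans _ _ ((normc (a n) + normc c * normc (e n)) * beta n)).
      by rewrite ler_wpM2r// -normcM normcB.
    rewrite !mulrDl mul1r lerD ?HN1// -mulrA ler_wpM2l ?normc_ge0//; exact: HN2.
  rewrite ler_wpM2r// ler_peMr ?addr_ge0 ?normc_ge0// ler1n//.
have L1 : - ln rho < 1 - ln rho by lra.
have [A A0 HA] := coef_le_all beta_ge0 b_le L1.
have b0 : forall k, b k = 0.
  apply: (coefficients_eq0 beta_ge0 w_ge0 phi_le w_lin phi_ge0 A0 (expR_ge0 _) d0 HA) => z /dD[z1 Dz].
  have /cvgc_normcP h1 := H z Dz; have /cvgc_normcP h2 := unitE z1.
  apply/cvgc_normcP => x x0; have c1 : 0 < normc c + 1 by have := normc_ge0 c; lra.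
  have [N1 HN1] := h1 _ (half_gt0 x0).
  have [N2 HN2] := h2 _ (divr_gt0 (half_gt0 x0) c1).
  exists (maxn N1 N2) => n; rewrite geq_max => /andP[/HN1 n1 /HN2 n2].
  have -> : \sum_(k < n.+1) b k * phi k z - 0 =
      (\sum_(k < n.+1) a k * phi k z - c) - c * (\sum_(k < n.+1) e k * phi k z - 1).
    rewrite mulrBr mulr1 mulr_sumr subr0 [RHS](_ : _ = \sum_(k < n.+1) a k * phi k z - \sum_(k < n.+1) c * (e k * phi k z)); last by ring.
    by rewrite -sumrB; apply: eq_bigr => k _; rewrite /b; ring.
  apply: le_trans (normcB _ _) _; rewrite (splitr x) lerD// normcM.
  move: n2; rewrite ler_pdivlMr// => n2; apply: le_trans n2.
  by rewrite mulrC ler_wpM2l ?normc_ge0// lerDl.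
apply: (a_ge (- ln rho - 1)); first by lra.
have [N1 HN1] := e_small (- ln rho - 2).
have [|N2 HN2] := @linear_exp_le R (normc c) (- ln rho - 2) (- ln rho - 1); first by lra.
exists (maxn N1 N2) => n; rewrite geq_max => /andP[/HN1 n1 /HN2 n2].
apply: le_trans n2; have /eqP := b0 n; rewrite subr_eq0 => /eqP ->.
rewrite normcM -mulrA -[normc c * _ * _]mulrA ler_wpM2l ?normc_ge0//.
by apply: le_trans n1 _; rewrite ler_peMl ?expR_ge0// ler1n.
Qed.

End UnitExpansion.

(** * The three series of power type *)

Section Instances.
Context {R : realType}.
Implicit Types (z : R[i]) (a : nat -> R[i]).

Lemma powR_root_exp (x : R) n : 0 <= x -> (0 < n)%N -> (x `^ n%:R^-1) ^+ n = x.
Proof.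
move=> x0 n0; rewrite -powR_mulrn ?powR_ge0// -powRrM mulVf ?powRr1//.
by rewrite pnatr_eq0 -lt0n.
Qed.

Lemma normc_besselJ_ge n z : (normc z / 2) ^+ 2 <= n.+1%:R / 4 ->
  (normc z / 2) ^+ n * (2^-1 * n`!%:R^-1) <= normc (besselJ n z).
Proof.
have E : normc (z / 2) = normc z / 2 by rewrite normcM normcV (normc_nat 2).
move=> h; rewrite besselJE normcM normcX E ler_wpM2l ?exprn_ge0 ?divr_ge0 ?normc_ge0//.
by apply: normc_bes_ge; rewrite normcX E.
Qed.

Lemma normc_besselJ_le_exp n z : normc (besselJ n z) <=
  (normc z / 2) ^+ n * (n`!%:R^-1 * expR ((normc z / 2) ^+ 2)).
Proof.
have E : normc (z / 2) = normc z / 2 by rewrite normcM normcV (normc_nat 2).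
rewrite besselJE normcM normcX E ler_wpM2l ?exprn_ge0 ?divr_ge0 ?normc_ge0//.
apply: le_trans (normc_bes_le _ _) _; rewrite ler_wpM2l ?invr_ge0// ler_expR normcX E.
by rewrite ler_pdivrMr ?ltr0n// ler_peMr ?sqr_ge0// ler1n.
Qed.

(** Used with k = 1 for Neumann series and k = m for Kapteyn series, where m = 0 gives the constant
    J_0(0). *)
Lemma besselJ_near0 (k : nat) m : (m = 0%N \/ 0 < k)%N -> exists2 c : R, 0 < c & exists2 d : R, 0 < d &
  forall z, normc z <= d -> c * normc z ^+ m <= normc (besselJ m (k%:R * z)).
Proof.
move=> mk; pose c : R := (k%:R / 2) ^+ m * (2^-1 * m`!%:R^-1).
have c0 : 0 < c.
  rewrite mulr_gt0 ?mulr_gt0 ?invr_gt0 ?fact_gt0R//.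
  by case: mk => [->|k0]; rewrite ?expr0// exprn_gt0// divr_gt0// ltr0n.
exists c => //; have k1 : (0 : R) < k%:R + 1 by rewrite ltr_wpDl.
exists (k%:R + 1)^-1; first by rewrite invr_gt0.
move=> z; rewrite -[_^-1]mul1r ler_pdivlMr// => zk.
have kz : normc (k%:R * z) <= 1.
  by rewrite normcM normc_nat mulrC; have := normc_ge0 z; lra.
have E : c * normc z ^+ m = (normc (k%:R * z) / 2) ^+ m * (2^-1 * m`!%:R^-1).
  by rewrite /c normcM normc_nat !exprMn; ring.
rewrite E; apply: normc_besselJ_ge; apply: (@le_trans _ _ (4^-1 : R)).
  by have := normc_ge0 (k%:R * z); nra.
by rewrite ler_peMl ?invr_ge0// ler1n.
Qed.

Lemma unit_first (phi : nat -> R[i] -> R[i]) z : phi 0%N z = 1 ->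
  (fun n => \sum_(k < n.+1) (k == 0 :> nat)%:R * phi k z) @ \oo --> (1 : R[i]).
Proof.
move=> p0; apply/cvgc_normcP => e e0; exists 0%N => n _.
rewrite big_ord_recl/= p0 mul1r big1 ?addr0 ?subrr ?normc0 ?(ltW e0)// => i _.
by rewrite mul0r.
Qed.

Lemma unit_first_small (L : R) : exists N, forall n, (N <= n)%N ->
  normc ((n == 0%N)%:R : R[i]) * 1 <= expR (n%:R * L).
Proof.
exists 1%N => -[//|n] _; rewrite mulr1.
by have -> : (n.+1 == 0%N)%:R = 0 :> R[i] by []; rewrite normc0 expR_ge0.
Qed.

(** Obtained from Bessel functions: J_n(n t z) is at least of order Omega (t z)^n / n by
    [besselJ_lower] and at most Omega z^n by [kapteyn_scaled]; take n large. If t z lies in S then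
    so does z, and both values are 1. Sublevel sets of Omega are thus star-shaped about 0. *)
Lemma Omega_scaled_le z (t : R) : 0 <= t <= 1 -> Omega (t%:C * z) <= Omega z.
Proof.
move=> t01; have [->|z0] := eqVneq z 0; first by rewrite mulr0.
have [tS|tS] := pselect (realS (t%:C * z)).
  by rewrite !Omega_S//; exact: realS_ray tS.
have [c c0 [N HN]] := besselJ_lower tS.
rewrite leNgt; apply/negP => zt.
have x0 : 0 < Omega (t%:C * z) by apply: le_lt_trans zt; exact: Omega_ge0.
have key n : (N <= n)%N -> (0 < n)%N -> Omega (t%:C * z) ^+ n <= expR 1 / c * n%:R * Omega z ^+ n.
  move=> Nn n0; have := kapteyn_scaled n z0 t01; have := HN n Nn.
  set J := normc _; set x := Omega (t%:C * z) ^+ n => h1 h2.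
  have := @fact_le_exp R n n0; set p := (n%:R / expR 1) ^+ n in h1 * => h3.
  have f0 := @fact_gt0R R n.
  have x1 : 0 < x by rewrite exprn_gt0.
  have n1 : (0 : R) < n%:R by rewrite ltr0n.
  have e1 := expR_gt0 (1 : R).
  have h4 : (expR 1 * n%:R)^-1 <= p / n`!%:R.
    by rewrite ler_pdivlMr// ler_pdivrMl ?mulr_gt0.
  have h5 : c * (expR 1 * n%:R)^-1 * x <= Omega z ^+ n.
    apply: le_trans h2; apply: le_trans h1.
    by rewrite ler_wpM2r ?(ltW x1)// ler_wpM2l// ltW.
  rewrite [leLHS](_ : _ = expR 1 / c * n%:R * (c * (expR 1 * n%:R)^-1 * x)); last first.
    by field; rewrite !gt_eqF.
  by rewrite ler_wpM2l// mulr_ge0// divr_ge0 ?expR_ge0// ltW.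
have [y0|y0] := eqVneq (Omega z) 0.
  have := key (maxn N 1) (leq_maxl _ _) (leq_maxr _ _).
  rewrite y0 expr0n gtn_eqF ?leq_maxr// mulr0 leNgt exprn_gt0//.
have {}y0 : 0 < Omega z by rewrite lt_def y0 Omega_ge0.
have [|N' HN'] := @linear_exp_le R (2 * (expR 1 / c)) (ln (Omega z)) (ln (Omega (t%:C * z))).
  by rewrite ltr_ln ?posrE.
pose n := maxn N (maxn N' 1).
have := key n (leq_maxl _ _); rewrite /n !leq_max leqnn !orbT => /(_ isT); rewrite -/n.
have /HN' : (N' <= n)%N by rewrite /n !leq_max leqnn orbT.
rewrite !expRM_natl !lnK ?posrE//.
have P : 0 < expR 1 / c * n.+1%:R * Omega z ^+ n.
  by rewrite mulr_gt0 ?exprn_gt0// mulr_gt0 ?ltr0n// divr_gt0 ?expR_gt0.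
have : expR 1 / c * n%:R * Omega z ^+ n <= expR 1 / c * n.+1%:R * Omega z ^+ n.
  rewrite ler_wpM2r ?exprn_ge0 ?(ltW y0)// ler_wpM2l ?ler_nat//.
  by rewrite divr_ge0 ?expR_ge0// ltW.
rewrite -!(mulrA 2); lra.
Qed.

Lemma kapteyn_theorem a (rho : R) : 0 < rho -> is_rho Kapteyn a rho%:E ->
  growth_conclusion (sections Kapteyn a) (fun n => n%:R) (@Omega R) rho (@realS R).
Proof.
move=> r0 E.
have [||a_le a_ge] := limn_esup_root_growth (y := fun n => normc (a n) * 1) r0 _ _ E.
- by move=> n; exact: powR_ge0.
- by move=> n n0; rewrite mulr1 powR_root_exp ?normc_ge0.
have phi_le (M : R) : 0 <= M -> exists2 C : R, 0 <= C & forall n z, normc z <= M ->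
    normc (besselJ n (n%:R * z)) <= C * (1 * Omega z ^+ n).
  by move=> _; exists 1 => // n z _; rewrite !mul1r; exact: kapteyn_inequality.
apply: (power_type_theorem (beta := fun=> 1) _ (@Omega_ge0 R) _ phi_le r0 _ _ a_le a_ge) => //.
- move=> M M0; exists (M * expR (1 + M ^+ 2)); first by rewrite mulr_ge0 ?expR_ge0.
  move=> z zM; apply: le_trans (Omega_le z) _.
  rewrite ler_pM ?normc_ge0 ?expR_ge0// ler_expR lerD2l lerXn2r ?nnegrE ?normc_ge0//.
- by move=> n z Q; exact: besselJ_entire.
- exact: Omega_proper.
- move=> z nS z0; have [c c0 [N HN]] := besselJ_lower nS.
  (* By [fact_le_exp] the factor (n / e)^n / n! of [besselJ_lower] is at least 1 / (e n). *)
  exists (c / expR 1); first by rewrite divr_gt0 ?expR_gt0.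
  exists (maxn N 1) => n; rewrite geq_max => /andP[/HN Nn n1]; apply: le_trans Nn.
  rewrite mul1r ler_wpM2r ?exprn_ge0 ?Omega_ge0// -!mulrA ler_wpM2l ?(ltW c0)//.
  rewrite -invfM ler_pdivlMr ?fact_gt0R// ler_pdivrMl ?mulr_gt0 ?expR_gt0 ?ltr0n//.
  apply: le_trans (fact_le_exp n1) _.
  rewrite ler_wpM2r ?exprn_ge0 ?divr_ge0 ?expR_ge0// ler_wpM2l ?expR_ge0// ler_nat//.
- exact: realS_interior.
- by move=> z; exact: Omega_S.
- apply: (@star_connected R _ 0) => z t Dz t01; rewrite add0r subr0 /sublevel/=.
  exact: le_lt_trans (Omega_scaled_le z t01) Dz.
(* The Kapteyn function of index 0 is the constant J_0(0) = 1, so 1 is its own expansion. *)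
- apply: (sections_nonconstant (e := fun k => (k == 0%N)%:R) (beta := fun=> 1) _
    (@Omega_ge0 R) phi_le _ _ _ unit_first_small r0 a_le a_ge) => //.
  + exists (expR 2); first exact: expR_ge0.
    move=> z z1; apply: le_trans (Omega_le z) _; rewrite mulrC ler_wpM2r ?normc_ge0//.
    by rewrite ler_expR; have := normc_ge0 z; nra.
  + move=> m; apply: besselJ_near0; case: m => [|m]; [by left|by right].
  + by move=> z _; apply: (@unit_first (fun n z => besselJ n (n%:R * z))); rewrite mul0r besselJ0.
- exact: Omega_onto.
Qed.

Lemma connected_disc0 (r : R) : connected [set z : R[i] | normc z < r].
Proof.
apply: (@star_connected R _ 0) => z t /= zr /andP[t0 t1]; rewrite add0r subr0 normcM normcR.
by rewrite ger0_norm//; apply: le_lt_trans zr; rewrite ler_piMl ?normc_ge0.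
Qed.

Lemma normc_onto (r : R) : 0 < r -> exists z : R[i], normc z = r.
Proof. by move=> r0; exists r%:C; rewrite normcR gtr0_norm. Qed.

Lemma power_theorem a (rho : R) : 0 < rho -> is_rho Power a rho%:E ->
  growth_conclusion (sections Power a) (fun n => n%:R) (@normc R) rho set0.
Proof.
move=> r0 E.
have [||a_le a_ge] := limn_esup_root_growth (y := fun n => normc (a n) * 1) r0 _ _ E.
- by move=> n; exact: powR_ge0.
- by move=> n n0; rewrite mulr1 powR_root_exp ?normc_ge0.
have phi_le (M : R) : 0 <= M -> exists2 C : R, 0 <= C & forall n z, normc z <= M ->
    normc (z ^+ n) <= C * (1 * normc z ^+ n).
  by move=> _; exists 1 => // n z _; rewrite !mul1r normcX.
apply: (power_type_theorem (beta := fun=> 1) (phi := fun n z => z ^+ n) _ (@normc_ge0 R) _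
  phi_le r0 _ _ a_le a_ge) => //.
- by move=> M M0; exists M.
- move=> n z Q; have := poly_approx_horner z Q ('X^n : {poly R[i]}).
  by under eq_fun do rewrite hornerXn.
- exact: normc_proper.
- move=> z _ z0; exists 1 => //; exists 0%N => n _.
  rewrite mul1r normcX mul1r ler_piMl ?exprn_ge0 ?normc_ge0//.
  by rewrite invf_le1 ?ltr0n// ler1n.
- by move=> U _ U0; rewrite setD0.
- exact: connected_disc0.
- apply: (sections_nonconstant (e := fun k => (k == 0%N)%:R) (beta := fun=> 1)
    (phi := fun n z => z ^+ n) _
    (@normc_ge0 R) phi_le _ _ _ unit_first_small r0 a_le a_ge) => //.
  + by exists 1 => // z z1; rewrite mul1r.
  + by move=> m; exists 1 => //; exists 1 => // z _; rewrite mul1r normcX.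
  + by move=> z _; apply: (@unit_first (fun n z => z ^+ n)); rewrite expr0.
- exact: normc_onto.
Qed.

Lemma has_cderiv_besselJ n z (t : R) :
  has_cderiv (fun s => besselJ n (s%:C * z)) t
    (if n is m.+1 then z / 2 * (besselJ m (t%:C * z) - besselJ n.+1 (t%:C * z))
     else - z * besselJ 1 (t%:C * z)).
Proof.
pose u := (z / 2) ^+ 2.
have tsq x : has_deriv (fun x : R => x ^+ 2) x (2 * x).
  by apply: has_deriv_eq (has_derivX 2 (has_deriv_id x)) _; rewrite expr1 mulr1.
have db m : has_cderiv (fun s => bes m (u * (s ^+ 2)%:C)) t
    ((2 * t)%:C * (- u * bes m.+1 (u * (t ^+ 2)%:C))).
  exact: (@has_cderiv_comp R (fun s => bes m (u * s%:C)) (fun x => x ^+ 2) t (2 * t) _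
    (has_cderiv_bes m u (t ^+ 2)) (tsq t)).
have JE m (s : R) : besselJ m (s%:C * z) = (z / 2) ^+ m * (s%:C ^+ m * bes m (u * (s ^+ 2)%:C)).
  by rewrite besselJE -mulrA !exprMn rmorphXn/= /u (mulrC (s%:C ^+ 2)) exprMn; ring.
under eq_fun do rewrite JE.
have := has_cderivZ ((z / 2) ^+ n) (has_cderivM (has_cderivX n (has_cderiv_id t)) (db n)).
have -> : (2 * t)%:C = 2 * t%:C :> R[i] by rewrite rmorphM rmorph_nat.
move=> h; apply: has_cderiv_eq h _.
case: n {db} => [|n].
  by rewrite JE /u !expr0 !mul0r; field.
have := bes_rec n (u * (t ^+ 2)%:C); rewrite !JE.
move: (bes n _) (bes n.+1 _) (bes n.+2 _) => b0 b1 b2.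
rewrite rmorphXn/= mulr1 => rec.
have -> : n.+1%:R * t%:C ^+ n.+1.-1 * b1 = t%:C ^+ n * (n.+1%:R * b1) by rewrite /=; ring.
by rewrite rec /u !exprS; field.
Qed.

(* The expansion [1 = J_0 + 2 J_2 + 2 J_4 + ...]: the derivatives of its sections telescope. *)
Definition neumann_unit (k : nat) : R[i] :=
  if k == 0%N then 1 else if odd k then 0 else 2.

Lemma has_cderiv_neumann_unit n z (t : R) :
  has_cderiv (fun s => \sum_(k < n.+1) neumann_unit k * besselJ k (s%:C * z)) t
    (- z * besselJ (if odd n then n else n.+1) (t%:C * z)).
Proof.
elim: n => [|n IH].
  under eq_fun do rewrite big_ord1 mul1r.
  exact: (has_cderiv_besselJ 0).
under eq_fun do rewrite big_ord_recr/=.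
have h := has_cderivD IH (has_cderivZ (neumann_unit n.+1) (has_cderiv_besselJ n.+1 z t)).
apply: has_cderiv_eq h _; rewrite /neumann_unit /=; case: (odd n) => /=.
  by field.
by rewrite mul0r addr0.
Qed.

(** The section is 1 at 0, and its derivative along the segment to z is a single Bessel function of
    index at least n times -z, hence at most 2^(-n) e on the unit disc. *)
Lemma neumann_unitE z : normc z <= 1 ->
  (fun n => \sum_(k < n.+1) neumann_unit k * besselJ k z) @ \oo --> (1 : R[i]).
Proof.
move=> z1.
have J_le m (t : R) : 0 <= t <= 1 -> normc (besselJ m (t%:C * z)) <= 2^-1 ^+ m * expR 1.
  move=> /andP[t0 t1]; apply: le_trans (normc_besselJ_le_exp _ _) _.
  have n1 : normc (t%:C * z) <= 1.
    by rewrite normcM normcR ger0_norm// mulr_ile1 ?normc_ge0.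
  have n0 := normc_ge0 (t%:C * z).
  apply: ler_pM; rewrite ?exprn_ge0 ?divr_ge0 ?mulr_ge0 ?invr_ge0 ?expR_ge0//.
    by rewrite lerXn2r ?nnegrE ?divr_ge0// ler_piMl.
  rewrite -[leRHS]mul1r ler_pM ?invr_ge0 ?expR_ge0//.
    by rewrite invf_le1 ?fact_gt0R// ler1n fact_gt0.
  by rewrite ler_expR; nra.
have half_le m n : (n <= m)%N -> (2^-1 : R) ^+ m <= 2^-1 ^+ n.
  by move=> nm; apply: ler_wiXn2l nm; lra.
have bound n : normc (\sum_(k < n.+1) neumann_unit k * besselJ k z - 1) <= 2 * (2^-1 ^+ n * expR 1).
  pose g (s : R) := \sum_(k < n.+1) neumann_unit k * besselJ k (s%:C * z).
  have g1 : g 1 = \sum_(k < n.+1) neumann_unit k * besselJ k z by rewrite /g rmorph1 mul1r.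
  have g0 : g 0 = 1.
    rewrite /g rmorph0 mul0r big_ord_recl besselJ0 mul1r big1 => [|i _]; first by rewrite addr0.
    by rewrite besselJ0 mulr0.
  rewrite -g1 -g0.
  apply: (curve_bound (g := g)) => [t _|]; first exact: has_cderiv_neumann_unit.
  move=> t t01; rewrite normcM normcNE.
  apply: (@le_trans _ _ (normc (besselJ (if odd n then n else n.+1) (t%:C * z)))).
    by rewrite ler_piMl ?normc_ge0.
  apply: le_trans (J_le _ _ t01) _; apply: ler_wpM2r; first exact: expR_ge0.
  by apply: half_le; case: odd.
have /cvgR_normP c0 : (fun n => 2 * expR 1 * 2^-1 ^+ n : R) @ \oo --> 2 * expR 1 * 0.
  by apply: cvgMr; apply: cvg_expr; rewrite ger0_norm ?invr_ge0// invf_lt1 ?ltr1n.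
apply/cvgc_normcP => e /c0[N HN]; exists N => n /HN; rewrite mulr0 subr0 => h.
apply: le_trans (bound n) _; apply: le_trans (ler_norm _) _; apply: le_trans h.
by rewrite le_eqVlt; apply/orP; left; apply/eqP; congr `| _ |; ring.
Qed.

Lemma neumann_theorem a (rho : R) : 0 < rho -> is_rho Neumann a rho%:E ->
  growth_conclusion (sections Neumann a) (fun n => n%:R) (@normc R) rho set0.
Proof.
(* This replaces 2^(-n) / n!, from which it differs by a factor at most e n for n > 0. The exponent
   0 gives [beta 0 = 1], whatever the default value of the quotient. *)
pose beta n : R := (expR 1 / (2 * n%:R)) ^+ n.
have q0 n : 0 <= expR 1 / (2 * n%:R) :> R by rewrite divr_ge0 ?expR_ge0 ?mulr_ge0.
have beta0 n : 0 <= beta n by rewrite exprn_ge0.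
move=> r0 E.
have [||a_le a_ge] := limn_esup_root_growth (y := fun n => normc (a n) * beta n) r0 _ _ E.
- by move=> n; rewrite mulr_ge0 ?powR_ge0.
- by move=> n n0; rewrite exprMn powR_root_exp ?normc_ge0// mulrC.
have betaE n (x : R) : beta n * x ^+ n = (x / 2) ^+ n * (expR 1 / n%:R) ^+ n.
  rewrite /beta -!exprMn; congr (_ ^+ _); rewrite invfM; ring.
have phi_le (M : R) : 0 <= M -> exists2 C : R, 0 <= C & forall n z, normc z <= M ->
    normc (besselJ n z) <= C * (beta n * normc z ^+ n).
  move=> M0; exists (expR ((M / 2) ^+ 2)); first exact: expR_ge0.
  move=> n z zM; apply: le_trans (normc_besselJ_le_exp _ _) _.
  rewrite betaE [leRHS]mulrCA ler_wpM2l ?exprn_ge0 ?divr_ge0 ?normc_ge0// mulrC.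
  apply: ler_pM; rewrite ?invr_ge0 ?expR_ge0//.
    by rewrite ler_expR lerXn2r ?nnegrE ?divr_ge0 ?normc_ge0// ler_wpM2r.
  case: n => [|n]; first by rewrite fact0 invr1 expr0.
  rewrite -[expR 1 / _]invf_div exprVn lef_pV2 ?posrE ?fact_gt0R ?exp_le_fact//.
have phi_near m : exists2 c : R, 0 < c & exists2 d : R, 0 < d &
    forall z, normc z <= d -> c * normc z ^+ m <= normc (besselJ m z).
  have [|c c0 [d d0 H]] := @besselJ_near0 1 m; first by right.
  exists c; first exact: c0.
  exists d; first exact: d0.
  move=> z zd.
  have zE : 1%:R * z = z by rewrite mul1r.
  rewrite -[in leRHS]zE.
  exact: (H z zd).
have e_small (L : R) : exists N, forall n, (N <= n)%N ->
    normc (neumann_unit n) * beta n <= expR (n%:R * L).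
  (* As 2^n beta_n = (e / n)^n, it is enough that e / n <= exp L. *)
  exists (maxn 1 (Num.bound (expR 1 / expR L))) => n; rewrite geq_max => /andP[n1 nL].
  have n0 : (0 : R) < n%:R by rewrite ltr0n.
  have nu : normc (neumann_unit n) <= 2 ^+ n.
    have h2 : (2 : R) <= 2 ^+ n by rewrite -[leLHS]expr1 ler_weXn2l// ler1n.
    rewrite /neumann_unit gtn_eqF//; case: odd; first by rewrite normc0 exprn_ge0.
    by rewrite (normc_nat 2).
  apply: (@le_trans _ _ ((expR 1 / n%:R) ^+ n)).
    apply: le_trans (ler_wpM2r (beta0 n) nu) _; rewrite /beta -exprMn.
    have -> : 2 * (expR 1 / (2 * n%:R)) = expR 1 / n%:R :> R by field; rewrite gt_eqF.
    exact: lexx.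
  rewrite expRM_natl lerXn2r ?nnegrE ?expR_ge0 ?divr_ge0 ?expR_ge0//.
  rewrite ler_pdivrMr// mulrC -ler_pdivrMr ?expR_gt0//.
  apply: le_trans (ltW (archi_boundP _)) _; first by rewrite divr_ge0 ?expR_ge0.
  by rewrite ler_nat.
apply: (power_type_theorem beta0 (@normc_ge0 R) _
  phi_le r0 _ _ a_le a_ge) => //.
- by move=> M M0; exists M.
- move=> n z Q; have := besselJ_entire n 1 z Q.
  by under eq_fun do rewrite mul1r.
- exact: normc_proper.
(* The 2 comes from [normc_besselJ_ge], which applies once |z|^2 <= n, and e from the bound n! <= e
   n (n / e)^n. *)
- move=> z _ z0; exists (2 * expR 1)^-1; first by rewrite invr_gt0 mulr_gt0 ?expR_gt0.
  exists (maxn 1 (Num.bound (normc z ^+ 2))) => n; rewrite geq_max => /andP[n1 nz].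
  have n0 : (0 : R) < n%:R by rewrite ltr0n.
  have zn : normc z ^+ 2 <= n%:R.
    by apply: le_trans (ltW (archi_boundP (sqr_ge0 _))) _; rewrite ler_nat.
  apply: le_trans (normc_besselJ_ge (n := n) _); last first.
    have -> : (normc z / 2) ^+ 2 = normc z ^+ 2 / 4 by field.
    by rewrite ler_pM2r ?invr_gt0//; apply: le_trans zn _; rewrite ler_nat.
  rewrite betaE mulrCA ler_wpM2l ?exprn_ge0 ?divr_ge0 ?normc_ge0//.
  have e0 := expR_gt0 (1 : R).
  have h := @fact_le_exp R n n1.
  have p0 : 0 < (n%:R / expR 1) ^+ n :> R by rewrite exprn_gt0// divr_gt0.
  rewrite -[expR 1 / n%:R]invf_div exprVn.
  rewrite [leLHS](_ : _ = 2^-1 * (expR 1 * n.+1%:R * (n%:R / expR 1) ^+ n)^-1); last first.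
    by rewrite !invfM; ring.
  rewrite ler_wpM2l ?invr_ge0// lef_pV2 ?posrE ?fact_gt0R//; last first.
    by rewrite mulr_gt0// mulr_gt0 ?ltr0n.
  by apply: le_trans h _; rewrite ler_wpM2r ?(ltW p0)// ler_wpM2l ?(ltW e0)// ler_nat.
- by move=> U _ U0; rewrite setD0.
- exact: connected_disc0.
- apply: (sections_nonconstant (e := neumann_unit) beta0
    (@normc_ge0 R) phi_le _ _ _ e_small r0 a_le a_ge) => //.
  + by exists 1 => // z z1; rewrite mul1r.
  + exact: neumann_unitE.
- exact: normc_onto.
Qed.

End Instances.

(** * Dirichlet series *)

Section AbelSummation.
Context {R : realType}.
Implicit Types (w z : R[i]).
Local Notation Re := (@complex.Re R).

(** Projecting the curve on the direction of [g d - g 0] reduces the claim to a real function,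
    without the factor 2 of [curve_bound]. *)
Lemma curve_domination (g dg : R -> R[i]) (G dG : R -> R) (d : R) : 0 <= d ->
  (forall t, 0 <= t <= d -> has_cderiv g t (dg t)) ->
  (forall t, 0 <= t <= d -> has_deriv G t (dG t)) ->
  (forall t, 0 < t < d -> normc (dg t) <= dG t) -> normc (g d - g 0) <= G d - G 0.
Proof.
move=> d0 Hg HG gG; set u := g d - g 0.
have nu := normc_ge0 u.
pose p t := normc u * G t - (Re u * Re (g t) + complex.Im u * complex.Im (g t)).
have : p 0 <= p d.
  apply: (has_deriv_nondecreasing (df := fun t =>
      normc u * dG t - (Re u * Re (dg t) + complex.Im u * complex.Im (dg t)))) d0 _ _ => t tb.
    have [h1 h2] := Hg t tb.
    apply: has_derivB; first exact/has_derivZ/HG.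
    by apply: has_derivD; exact: has_derivZ.
  rewrite subr_ge0 [Re u * _]mulrC [complex.Im u * _]mulrC -Re_mulJ.
  apply: le_trans (ler_norm _) _; apply: le_trans (Re_mulJ_le _ _) _.
  by rewrite mulrC ler_wpM2l//; exact: gG.
have E : normc u ^+ 2 = Re u * Re (g d) + complex.Im u * complex.Im (g d) -
    (Re u * Re (g 0) + complex.Im u * complex.Im (g 0)).
  by rewrite sqr_normc_ReIm /u !(ReD, ImD, ReN, ImN); ring.
rewrite /p => h; have {}h : normc u * normc u <= normc u * (G d - G 0).
  by rewrite -expr2 E mulrBr; lra.
move: nu; rewrite le_eqVlt => /predU1P[<-|nu]; last by rewrite -(ler_pM2l nu).
rewrite subr_ge0; apply: (has_deriv_nondecreasing d0 HG) => t /gG.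
by apply: le_trans; exact: normc_ge0.
Qed.

(** The right side is the integral of |w| exp (- t v) over [0, d]. It makes sense for v of either
    sign, and negative v is used to the left of a point of convergence. *)
Lemma cexp_increment_le w (v d : R) : v != 0 -> v <= Re w -> 0 <= d ->
  normc (cexp (- d%:C * w) - 1) <= normc w / v * (1 - expR (- d * v)).
Proof.
move=> v0 vw d0.
have := @curve_domination (fun t => cexp (- w * t%:C)) (fun t => cexp (- w * t%:C) * (- w * 1))
  (fun t => - (normc w / v) * expR (- v * t)) (fun t => normc w * expR (- v * t)) d d0.
have -> : - w * 0%:C = 0 by rewrite mulr0.
rewrite mulr0 cexp0 expR0.
have -> : - w * d%:C = - d%:C * w by ring.
have -> : - v * d = - d * v by ring.
have -> : - (normc w / v) * expR (- d * v) - - (normc w / v) * 1 =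
  normc w / v * (1 - expR (- d * v)) by ring.
apply.
- by move=> t _; apply: has_cderiv_cexp; apply: has_cderivZ; exact: has_cderiv_id.
- move=> t _; have h := has_deriv_expR (has_derivZ (- v) (has_deriv_id t)).
  apply: has_deriv_eq (has_derivZ (- (normc w / v)) h) _.
  by field.
move=> t /andP[t0 _]; rewrite mulr1 normcM normcNE normc_cexp mulrC.
by rewrite ler_wpM2l ?normc_ge0// ler_expR ReRMr ReN !mulNr lerN2 ler_wpM2r// ltW.
Qed.

Lemma cexp_diff_le w (v l l' : R) : v != 0 -> v <= Re w -> l <= l' ->
  normc (cexp (- l%:C * w) - cexp (- l'%:C * w)) <=
  expR (- l * (Re w - v)) * (normc w / v * (expR (- l * v) - expR (- l' * v))).
Proof.
move=> v0 vw ll'.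
have d0 : 0 <= l' - l by rewrite subr_ge0.
have h := cexp_increment_le v0 vw d0.
have -> : cexp (- l%:C * w) - cexp (- l'%:C * w) =
    - (cexp (- l%:C * w) * (cexp (- (l' - l)%:C * w) - 1)).
  have -> : - l'%:C * w = - l%:C * w + - (l' - l)%:C * w by rewrite rmorphB /=; ring.
  by rewrite cexpD; ring.
rewrite normcNE normcM normc_cexp -rmorphN ReRM.
have -> : - l * Re w = - l * (Re w - v) + - l * v by ring.
have -> : - l' * v = - l * v + - (l' - l) * v by ring.
rewrite !expRD -[leLHS]mulrA ler_wpM2l ?expR_ge0//.
have -> : normc w / v * (expR (- l * v) - expR (- l * v) * expR (- (l' - l) * v)) =
  expR (- l * v) * (normc w / v * (1 - expR (- (l' - l) * v))) by ring.
by rewrite ler_wpM2l ?expR_ge0.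
Qed.

(** The free constant P is the limit of the partial sums when uniform convergence is wanted, and 0
    when only a bound is known. *)
Lemma abel_sum (c e : nat -> R[i]) P n m : (n <= m)%N ->
  let F k := \sum_(j < k.+1) c j in
  \sum_(j < m.+1) c j * e j - \sum_(j < n.+1) c j * e j =
  (F m - P) * e m - (F n - P) * e n + \sum_(n <= k < m) (F k - P) * (e k - e k.+1).
Proof.
move=> nm F; rewrite -(subnKC nm); move: (m - n)%N => p.
elim: p => [|p IH]; first by rewrite addn0 big_geq// !subrr addr0.
have -> : \sum_(j < (n + p.+1).+1) c j * e j =
    \sum_(j < (n + p).+1) c j * e j + c (n + p.+1)%N * e (n + p.+1)%N.
  by rewrite addnS big_ord_recr.
rewrite addrAC IH addnS big_nat_recr ?leq_addr//=.
by rewrite /F [\sum_(j < (n + p).+2) c j]big_ord_recr /=; ring.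
Qed.

Lemma cvgc_bounded (u : nat -> R[i]) : cvgn u ->
  exists2 B : R, 0 <= B & forall n, normc (u n) <= B.
Proof.
move=> /cvg_ex[l /cvgc_normcP/(_ _ ltr01)[N HN]].
exists (normc l + 1 + \sum_(k < N) normc (u k)).
  by rewrite !addr_ge0 ?normc_ge0// sumr_ge0// => k _; exact: normc_ge0.
move=> n; have S0 : 0 <= \sum_(k < N) normc (u k).
  by rewrite sumr_ge0// => k _; exact: normc_ge0.
have [/HN h|nN] := leqP N n; first by have := normcBl (u n) l; lra.
have : normc (u n) <= \sum_(k < N) normc (u k).
  rewrite (bigD1 (Ordinal nN))//= lerDl sumr_ge0// => k _; exact: normc_ge0.
by have := normc_ge0 l; lra.
Qed.

Context (lam : nat -> R) (lam_le : forall m n, (m <= n)%N -> lam m <= lam n).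

(** Growth exp (lam L) of the partial sums lowers the decay rate from Re w to v = Re w - L, and the
    increments then telescope. Convergence uses v > 0, growth estimates v < 0. *)
Lemma abel_bound (c : nat -> R[i]) P w (v L B : R) n m : (n <= m)%N ->
  v != 0 -> 0 <= L -> v + L = Re w -> 0 <= B ->
  (forall k, (n <= k <= m)%N -> normc (\sum_(j < k.+1) c j - P) <= B * expR (lam k * L)) ->
  normc (\sum_(j < m.+1) c j * cexp (- (lam j)%:C * w) -
         \sum_(j < n.+1) c j * cexp (- (lam j)%:C * w)) <=
  B * (expR (- lam m * v) + expR (- lam n * v) +
       normc w / v * (expR (- lam n * v) - expR (- lam m * v))).
Proof.
move=> nm v0 L0 vL B0 H; rewrite (@abel_sum c (fun k => cexp (- (lam k)%:C * w)) P n m nm).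
pose F k := \sum_(j < k.+1) c j - P; rewrite -/(F m) -/(F n).
have vw : v <= Re w by rewrite -vL lerDl.
have bound k : (n <= k <= m)%N -> normc (F k * cexp (- (lam k)%:C * w)) <= B * expR (- lam k * v).
  move=> /H hk; rewrite normcM normc_cexp -rmorphN ReRM -vL.
  have -> : - lam k * v = lam k * L + - lam k * (v + L) by ring.
  by rewrite expRD mulrA ler_wpM2r ?expR_ge0.
apply: le_trans (normcD _ _) _; rewrite mulrDr lerD//.
  by apply: le_trans (normcB _ _) _; rewrite mulrDr lerD// bound ?nm ?leqnn.
apply: le_trans (normc_sum _ _ _) _.
have -> : B * (normc w / v * (expR (- lam n * v) - expR (- lam m * v))) =
    \sum_(n <= k < m) B * (normc w / v * (expR (- lam k * v) - expR (- lam k.+1 * v))).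
  rewrite -2!mulr_sumr -[in LHS]opprB -(telescope_sumr (fun k => expR (- lam k * v)))// -sumrN.
  by congr (_ * (_ * _)); apply: eq_bigr => k _; rewrite opprB.
rewrite !big_nat; apply: ler_sum => k /andP[nk km].
rewrite normcM; have hk : (n <= k <= m)%N by rewrite nk ltnW.
have h := cexp_diff_le v0 vw (lam_le (leqnSn k)).
have wv : Re w - v = L by rewrite -vL addrC addKr.
rewrite wv in h.
apply: le_trans (ler_pM (normc_ge0 _) (normc_ge0 _) (H k hk) h) _.
rewrite mulrA -[B * _ * _]mulrA -expRD mulNr subrr expR0 mulr1.
exact: lexx.
Qed.

End AbelSummation.

Lemma cexp_real {R : realType} (x : R) : cexp x%:C = (expR x)%:C.
Proof. by rewrite /cexp /= cos0 sin0 mulr1. Qed.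

(** * Growth, convergence and uniqueness for Dirichlet sections *)

Section DirichletSeries.
Context {R : realType} (lam : nat -> R) (a : nat -> R[i]).
Context (lam_incr : increasing_to_infinity lam).
Implicit Types (z : R[i]).
Local Notation Re := (@complex.Re R).
Let f := sections (Dirichlet lam) a.

Let lam_le m n : (m <= n)%N -> lam m <= lam n.
Proof.
by rewrite leq_eqVlt => /predU1P[->//|mn]; apply/ltW; case: lam_incr => + _; apply.
Qed.

Let fD z w n :
  f n (z + w) = \sum_(j < n.+1) (a j * cexp (- (lam j)%:C * z)) * cexp (- (lam j)%:C * w).
Proof. by apply: eq_bigr => j _; rewrite /= mulrDr cexpD mulrA. Qed.

Let large_le (B x y : R) : x < y -> exists N, forall n, (N <= n)%N ->
  B * expR (lam n * x) <= expR (lam n * y).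
Proof.
move=> xy; have yx : 0 < y - x by rewrite subr_gt0.
have [N HN] := lam_large lam_incr (B / (y - x)); exists N => n /HN.
rewrite ler_pdivrMr// => h.
have -> : lam n * y = lam n * (y - x) + lam n * x by ring.
rewrite expRD ler_wpM2r ?expR_ge0//; apply: le_trans h _.
by apply: le_trans (expR_ge1Dx _); rewrite lerDr.
Qed.

Let tail_le (B e v : R) : 0 < v -> 0 < e -> exists N, forall n, (N <= n)%N ->
  B * expR (- lam n * v) <= e.
Proof.
move=> v0 e0; have v1 : - v < 0 by rewrite oppr_lt0.
have [N HN] := large_le (B / e) v1; exists N => n /HN.
by rewrite mulr0 expR0 mulrAC ler_pdivrMr// mul1r mulrN -mulNr.
Qed.

(** Slow growth at z forces convergence at distance x > L to the right. Its contrapositive, left of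
    the abscissa, is the lower growth bound. *)
Let bounded_cvg z (L x : R) : 0 <= L -> L < x ->
  (exists N, forall n, (N <= n)%N -> normc (f n z) <= expR (lam n * L)) ->
  cvgn (fun n => f n (z + x%:C)).
Proof.
move=> L0 Lx [N HN]; apply: cauchyc_cvg => e e0.
pose v := x - L; have v0 : 0 < v by rewrite subr_gt0.
have vL : v + L = Re x%:C by rewrite subrK.
clearbody v; have [N' HN'] := tail_le (2 + normc x%:C / v) v0 e0.
have [N'' HN''] := lam_large lam_incr 0.
have main m n : (maxn N (maxn N' N'') <= n)%N -> (n <= m)%N ->
    normc (f m (z + x%:C) - f n (z + x%:C)) <= e.
  rewrite !geq_max => /and3P[Nn N'n N''n] nm; rewrite !fD.
  have := @abel_bound R lam lam_le (fun j => a j * cexp (- (lam j)%:C * z)) 0 x%:C v L 1 n m nm.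
  rewrite gt_eqF// mul1r => /(_ isT L0 vL ler01) h.
  apply: le_trans (h _) _.
    by move=> k /andP[nk _]; rewrite subr0 mul1r; apply: HN; exact: leq_trans nk.
  apply: le_trans (HN' _ N'n); rewrite mulrDl mulrDr.
  have E : expR (- lam m * v) <= expR (- lam n * v).
    by rewrite ler_expR !mulNr lerN2 ler_wpM2r ?(ltW v0)// lam_le.
  have X0 : 0 <= normc x%:C / v by rewrite divr_ge0 ?normc_ge0// ltW.
  have := mulr_ge0 X0 (expR_ge0 (- lam m * v)); lra.
exists (maxn N (maxn N' N'')) => m n Nm Nn; have [nm|/ltnW mn] := leqP n m; first exact: main.
by rewrite normcBC; exact: main.
Qed.

(** The partial sums at x are bounded, so Abel summation from x to z, with v = Re z - x < 0, gives
    growth exp (lam_n (x - Re z)) up to a constant. *)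
Let growth_le (x : R) z (L : R) : cvgn (fun n => f n x%:C) -> Re z < x -> x < Re z + L ->
  exists N, forall n, (N <= n)%N -> normc (f n z) <= expR (lam n * L).
Proof.
move=> /cvgc_bounded[B B0 HB] zx xL.
pose w := z - x%:C; pose v := Re z - x.
have v0 : v < 0 by rewrite subr_lt0.
have uL : - v < L by rewrite /v opprB ltrBlDl.
have [N HN] := large_le (B * (3 - normc w / v)) uL; exists N => n /HN; apply: le_trans.
have := @abel_bound R lam lam_le (fun j => a j * cexp (- (lam j)%:C * x%:C)) 0 w v 0 B 0 n (leq0n n).
have -> : z = x%:C + w by rewrite addrC subrK.
rewrite lt_eqF// addr0 /w ReD ReN -/v => /(_ isT (lexx _) erefl B0) h.
have h1 : normc (f n (x%:C + (z - x%:C)) - f 0%N (x%:C + (z - x%:C))) <= B * (expR (- lam n * v) + expR (- lam 0%N * v) +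
       normc (z - x%:C) / v * (expR (- lam 0%N * v) - expR (- lam n * v))).
  by rewrite !fD; apply: h => k _; rewrite mulr0 expR0 mulr1 subr0; exact: HB.
have h0 : normc (f 0%N (x%:C + (z - x%:C))) <= B * expR (- lam 0%N * v).
  rewrite fD big_ord1 normcM normc_cexp -rmorphN ReRM ReD ReN -/v ler_wpM2r ?expR_ge0//.
  by have := HB 0%N; rewrite /f /sections big_ord1 /= -rmorphN.
have E : expR (- lam 0%N * v) <= expR (lam n * - v).
  by rewrite ler_expR mulNr -mulrN ler_wpM2r ?oppr_ge0 ?(ltW v0)// lam_le.
have E' : expR (- lam n * v) = expR (lam n * - v) by rewrite mulNr mulrN.
have := normcBl (f n (x%:C + (z - x%:C))) (f 0%N (x%:C + (z - x%:C))).
rewrite E' in h1.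
have W0 : 0 <= - (normc (z - x%:C) / v).
  by rewrite -mulrN -invrN divr_ge0 ?normc_ge0// oppr_ge0 ltW.
have := mulr_ge0 W0 (expR_ge0 (- lam 0%N * v)).
have := ler_wpM2l B0 E.
move: W0 h1 h0.
set W := normc (z - x%:C) / v; set e0 := expR (- lam 0%N * v); set en := expR (lam n * - v).
set fn := normc _; set f0 := normc _; set fd := normc _ => W0 h1 h0 h2 h3 h4.
have := mulr_ge0 B0 h3; lra.
Qed.

(** On the region considered |w| / v is at most (M + |x|) / eta. In K, the 2 accounts for the two
    boundary terms of Abel summation. *)
Let uniform_cauchy (x eta M e : R) : cvgn (fun n => f n x%:C) -> 0 < eta -> 0 <= M -> 0 < e ->
  exists N, forall m n, (N <= m)%N -> (N <= n)%N -> forall z, normc z <= M -> x + eta <= Re z ->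
    normc (f m z - f n z) <= e.
Proof.
move=> /cvg_ex[P /cvgc_normcP fP] eta0 M0 e0.
pose K := 2 + (M + `|x|) / eta.
have K0 : 0 < K by rewrite ltr_wpDr ?divr_ge0 ?addr_ge0// ltW.
have [N HN] := fP _ (divr_gt0 e0 K0).
have [N' HN'] := lam_large lam_incr 0.
have main m n z : (maxn N N' <= n)%N -> (n <= m)%N -> normc z <= M -> x + eta <= Re z ->
    normc (f m z - f n z) <= e.
  rewrite geq_max => /andP[Nn N'n] nm zM xz.
  pose w := z - x%:C; pose v := Re z - x.
  have ve : eta <= v by rewrite /v; lra.
  have v0 : 0 < v by exact: lt_le_trans ve.
  have := @abel_bound R lam lam_le (fun j => a j * cexp (- (lam j)%:C * x%:C)) P w v 0 (e / K) n m nm.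
  have zE : z = x%:C + w by rewrite addrC subrK.
  have eK : 0 <= e / K by rewrite divr_ge0 ?(ltW e0) ?(ltW K0).
  rewrite gt_eqF// addr0 {1}/w ReD ReN -/v -!fD -zE => /(_ isT (lexx _) erefl eK) h.
  apply: le_trans (h _) _.
    move=> k /andP[nk _]; rewrite mulr0 expR0 mulr1; apply: HN; exact: leq_trans nk.
  rewrite mulrAC ler_pdivrMr// ler_wpM2l ?(ltW e0)//.
  have E k : (n <= k)%N -> expR (- lam k * v) <= 1.
    move=> nk; rewrite expR_le1 mulNr oppr_le0 mulr_ge0 ?(ltW v0)//.
    by apply: HN'; exact: leq_trans nk.
  have W0 : 0 <= normc w / v by rewrite divr_ge0 ?normc_ge0 ?(ltW v0).
  have W1 : normc w / v <= (M + `|x|) / eta.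
    rewrite ler_pM ?invr_ge0 ?normc_ge0 ?(ltW v0)//; last by rewrite lef_pV2 ?posrE.
    by apply: le_trans (normcB _ _) _; rewrite normcR lerD2r.
  have W2 : normc w / v * expR (- lam n * v) <= normc w / v * 1 by rewrite ler_wpM2l// E.
  have W3 := mulr_ge0 W0 (expR_ge0 (- lam m * v)).
  have := E n (leqnn n); have := E m nm; move: W1 W2 W3; rewrite /K.
  move: (normc w / v) (expR _) (expR _) (_ / eta) => b1 b2 b3 b4; lra.
exists (maxn N N') => m n Nm Nn z zM xz; have [nm|/ltnW mn] := leqP n m; first exact: main.
by rewrite normcBC; exact: main.
Qed.

Context (x0 A : R).
Context (abs_bound : forall n, \sum_(k < n.+1) normc (a k) * expR (- lam k * x0) <= A).

(** Here absolute convergence at x0 enters: each term grows by at most exp (lam_n C) in passing from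
    x0 to z. Counting terms would not do, as n need not be bounded by an exponential of lam_n. *)
Let exp_bound (M : R) : 0 <= M -> exists2 C : R, 0 <= C &
  exists N, forall n, (N <= n)%N -> forall z, normc z <= M -> normc (f n z) <= expR (lam n * C).
Proof.
move=> M0; pose C := `|x0| + M; have C0 : 0 <= C by rewrite addr_ge0.
exists (C + 1); first by rewrite addr_ge0.
have CC1 : C < C + 1 by rewrite ltrDl.
have [N HN] := large_le A CC1; have [N' HN'] := lam_large lam_incr `|lam 0%N|.
exists (maxn N N') => n; rewrite geq_max => /andP[/HN Nn /HN' N'n] z zM.
apply: le_trans Nn; apply: le_trans (normc_sum _ _ _) _.
apply: le_trans (ler_wpM2r (expR_ge0 _) (abs_bound n)); rewrite mulr_suml.
apply: ler_sum => -[k /= kn] _; rewrite normcM normc_cexp -rmorphN ReRM -mulrA.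
rewrite ler_wpM2l ?normc_ge0// -expRD ler_expR.
have -> : - lam k * Re z = - lam k * x0 + lam k * (x0 - Re z) by ring.
rewrite lerD2l; apply: le_trans (ler_norm _) _; rewrite normrM.
have h1 : `|lam k| <= lam n.
  rewrite ler_norml lam_le// andbT lerNl; apply: le_trans N'n.
  by apply: (@le_trans _ _ (- lam 0%N)); rewrite ?lerN2 ?lam_le// -normrN ler_norm.
have h2 : `|x0 - Re z| <= C.
  by apply: le_trans (ler_normB _ _) _; rewrite lerD2l; apply: le_trans (Re_le_normc _) zM.
by rewrite ler_pM.
Qed.

Let abs_bound_shift (y : R) n : x0 <= y ->
  \sum_(k < n.+1) normc (a k) * expR (- lam k * y) <= A * expR (`|lam 0%N| * (y - x0)).
Proof.
move=> xy; apply: le_trans (ler_wpM2r (expR_ge0 _) (abs_bound n)); rewrite mulr_suml.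
apply: ler_sum => k _; rewrite -mulrA ler_wpM2l ?normc_ge0// -expRD ler_expR.
have -> : - lam k * y = - lam k * x0 + - lam k * (y - x0) by ring.
rewrite lerD2l ler_wpM2r ?subr_ge0//.
by apply: (@le_trans _ _ (- lam 0%N)); rewrite ?lerN2 ?lam_le// -normrN ler_norm.
Qed.

(** The first possibly nonzero term dominates far to the right: relative to it the rest is at most B
    exp (- (lam_(k+1) - lam_k) y). *)
Let coefficients_unique (b : nat -> R[i]) (B x1 : R) :
  (forall n, \sum_(k < n.+1) normc (b k) * expR (- lam k * x1) <= B) ->
  (forall x, x1 <= x -> sections (Dirichlet lam) b ^~ x%:C @ \oo --> (0 : R[i])) ->
  forall k, b k = 0.
Proof.
move=> HB b0 k; elim/ltn_ind: k => k IH.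
have B0 : 0 <= B.
  by apply: le_trans (HB 0%N); rewrite big_ord1 mulr_ge0 ?normc_ge0 ?expR_ge0.
pose d := lam k.+1 - lam k.
have d0 : 0 < d by rewrite subr_gt0; case: lam_incr => + _; apply.
have small y : 0 <= y -> normc (b k) * expR (- lam k * x1) <= B * expR (- d * y).
  move=> y0; pose x := x1 + y.
  have xx : x1 <= x by rewrite lerDl.
  have normE j : normc (b j * cexp (- (lam j)%:C * x%:C)) =
      normc (b j) * expR (- lam j * x1) * expR (- lam j * y).
    by rewrite normcM normc_cexp -rmorphN ReRM /= -mulrA -expRD -mulrDr.
  have h : normc (b k * cexp (- (lam k)%:C * x%:C)) <= B * expR (- lam k.+1 * y).
    rewrite -normcNE -[- _]add0r; apply: (cvgc_normc_le (N := k)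
      (u := fun n => sections (Dirichlet lam) b n x%:C - b k * cexp (- (lam k)%:C * x%:C))).
      apply/cvgc_normcP => e e0; have /cvgc_normcP/(_ _ e0)[N HN] := b0 x xx.
      by exists N => n /HN; rewrite subr0 sub0r opprK subrK.
    move=> n kn; rewrite /sections -(big_mkord predT (fun j => b j * Defs.basis (Dirichlet lam) j x%:C)).
    rewrite (big_cat_nat (leq0n k) (leqW kn))/= big_mkord big1 ?add0r; last first.
      by move=> -[j jk] _ /=; rewrite IH// mul0r.
    rewrite big_ltn// addrAC subrr add0r; apply: le_trans (normc_sum _ _ _) _.
    apply: le_trans (ler_wpM2r (expR_ge0 _) (HB n)); rewrite mulr_suml.
    rewrite -(big_mkord predT (fun j => normc (b j) * expR (- lam j * x1) * expR (- lam k.+1 * y))).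
    rewrite (big_cat_nat (leq0n k.+1) (kn : k.+1 <= n.+1)%N)/= -[leLHS]add0r lerD//.
      by rewrite sumr_ge0// => j _; rewrite !mulr_ge0 ?normc_ge0 ?expR_ge0.
    rewrite !big_nat; apply: ler_sum => j /andP[kj _]; rewrite normE ler_wpM2l//.
      by rewrite mulr_ge0 ?normc_ge0 ?expR_ge0.
    by rewrite ler_expR ler_wpM2r// lerN2 lam_le.
  rewrite normE in h.
  rewrite -(@ler_pM2r _ (expR (- lam k * y))) ?expR_gt0//; apply: le_trans h _.
  have -> : - lam k.+1 * y = - d * y + - lam k * y by rewrite /d; ring.
  by rewrite expRD mulrA.
apply/eqP; rewrite -normc_eq0 eq_le normc_ge0 andbT.
rewrite -(@ler_pM2r _ (expR (- lam k * x1))) ?expR_gt0// mul0r.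
apply/ler_addgt0Pr => e e0; rewrite add0r.
have Be : 0 <= B / e by rewrite divr_ge0// ltW.
(* With d y = B / e the bound B exp (- d y) is at most e, because exp (B / e) >= B / e. *)
apply: le_trans (small (B / e / d) (divr_ge0 Be (ltW d0))) _.
rewrite mulNr mulrCA divff ?gt_eqF// mulr1 expRN ler_pdivrMr ?expR_gt0//.
rewrite mulrC -ler_pdivrMr//; apply: le_trans (expR_ge1Dx _).
by rewrite lerDr.
Qed.

(* If the limit is constant, then [f z - f (z + 1) = 0] forces [a k (1 - exp (- lam k)) = 0]. *)
Let nonconstant (s : R) : (exists z, ~ cvgn (fun n => f n z)) ->
  forall c, ~ forall z, s < Re z -> (fun n => f n z) @ \oo --> (c : R[i]).
Proof.
move=> [z dz] c H; apply: dz.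
pose b k := a k * (1 - cexp (- (lam k)%:C)).
pose x1 := Num.max x0 s + 1.
have x01 : x0 <= x1 by rewrite /x1 (@le_trans _ _ (Num.max x0 s)) ?le_max ?lexx// lerDl.
have sx1 : s < x1 by rewrite /x1 (@le_lt_trans _ _ (Num.max x0 s)) ?le_max ?lexx ?orbT// ltrDl.
have bE n (x : R) : sections (Dirichlet lam) b n x%:C = f n x%:C - f n (x%:C + 1).
  rewrite fD -sumrB; apply: eq_bigr => k _; rewrite /b /=.
  by rewrite [- (lam k)%:C * 1]mulr1; ring.
have x011 : x0 <= x1 + 1 by rewrite (le_trans x01)// lerDl.
have b0 : forall k, b k = 0.
  apply: (@coefficients_unique b
    (A * expR (`|lam 0%N| * (x1 - x0)) + A * expR (`|lam 0%N| * (x1 + 1 - x0))) x1).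
    move=> n; apply: le_trans (lerD (abs_bound_shift n x01) (abs_bound_shift n x011)).
    rewrite -big_split/=; apply: ler_sum => k _.
    have -> : - lam k * (x1 + 1) = - lam k + - lam k * x1 by ring.
    rewrite expRD mulrA -mulrDl ler_wpM2r ?expR_ge0// normcM -{2}[normc _]mulr1 -mulrDr.
    rewrite ler_wpM2l ?normc_ge0//; apply: le_trans (normcB _ _) _.
    by rewrite normc1 normc_cexp ReN.
  move=> x xx; have sx : s < x by exact: lt_le_trans xx.
  have /cvgc_normcP h1 := H x%:C sx.
  have /cvgc_normcP h2 : (fun n => f n (x%:C + 1)) @ \oo --> c.
    by apply: H; rewrite ReD /=; apply: lt_trans sx _; rewrite ltrDl.
  apply/cvgc_normcP => e e0; have [N HN] := h1 _ (half_gt0 e0).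
  have [N' HN'] := h2 _ (half_gt0 e0); exists (maxn N N') => n.
  rewrite geq_max bE subr0 => /andP[/HN n1 /HN' n2].
  have -> : f n x%:C - f n (x%:C + 1) = (f n x%:C - c) - (f n (x%:C + 1) - c) by ring.
  by apply: le_trans (normcB _ _) _; rewrite (splitr e) lerD.
(* The factor 1 - exp (- lam k) may vanish when lam k = 0, so only the later coefficients are forced
   to be 0. The sections are then eventually constant and converge also at z. *)
have [N HN] := lam_large lam_incr 1.
have a0 k : (N <= k)%N -> a k = 0.
  move=> /HN l1; have /eqP := b0 k; rewrite mulf_eq0 => /orP[/eqP//|].
  rewrite subr_eq0 => /eqP /(congr1 (@normc R)); rewrite normc1 normc_cexp ReN /= => E.
  have : expR (- lam k) < 1 by rewrite expR_lt1; lra.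
  by rewrite -E ltxx.
have fE n : (N <= n)%N -> f n z = f N z.
  move=> /subnKC <-; elim: (n - N)%N => [|p IH]; first by rewrite addn0.
  by rewrite addnS -IH /f /sections big_ord_recr/= a0 ?mul0r ?addr0// -addnS leq_addr.
by apply: cauchyc_cvg => e e0; exists N => m n /fE -> /fE ->; rewrite subrr normc0 ltW.
Qed.

Context (rho : R) (rho_gt0 : 0 < rho).
Context (cvg_gt : forall z, - ln rho < Re z -> cvgn (fun n => f n z)).
Context (dvg_lt : forall z, Re z < - ln rho -> ~ cvgn (fun n => f n z)).

Lemma half_plane_theorem : growth_conclusion f lam (fun z => expR (- Re z)) rho set0.
Proof.
have rE (r : R) : rho * expR r = expR (ln rho + r) by rewrite expRD lnK ?posrE.
have rE0 : rho = expR (ln rho) by rewrite lnK ?posrE.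
apply: growth_theorem => //.
- exact: expRe_proper.
- by move=> n z Q; apply: poly_approx_sum => k; apply: poly_approxZ; exact: cexp_entire.
- move=> M r M0 rr e e0; have [r0|r0] := leP r 0.
    exists 0%N => m n _ _ z _ /(fun h => le_trans h r0).
    by rewrite leNgt expR_gt0.
  have lr : ln r < ln rho by rewrite ltr_ln ?posrE.
  pose eta := (ln rho - ln r) / 2; have eta0 : 0 < eta by rewrite half_gt0// subr_gt0.
  have [|N HN] := @uniform_cauchy (eta - ln rho) eta M e _ eta0 M0 e0.
    by apply: cvg_gt; rewrite /= ltrDr.
  exists N => m n Nm Nn z zM zr; apply: HN => //.
  have : - Re z <= ln r by rewrite -ler_expR lnK ?posrE.
  by rewrite /eta; lra.
- move=> z L L0; rewrite rE ltr_expR => h.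
  pose x := (Num.max (Re z) (- ln rho) + (Re z + L)) / 2.
  have m1 : Num.max (Re z) (- ln rho) < Re z + L by rewrite gt_max; lra.
  have m2 : Re z <= Num.max (Re z) (- ln rho) by rewrite le_max lexx.
  have m3 : - ln rho <= Num.max (Re z) (- ln rho) by rewrite le_max lexx orbT.
  apply: (@growth_le x); first by apply: cvg_gt; rewrite /x /=; lra.
    by rewrite /x; lra.
  by rewrite /x; lra.
(* The midpoint x of L and - ln rho - Re z gives, by [bounded_cvg], convergence at z + x, which
   still lies left of the abscissa. *)
- move=> z L _ L0; rewrite rE ltr_expR => h bd.
  pose x := (L + (- ln rho - Re z)) / 2.
  have Lx : L < x by rewrite /x; lra.
  by apply: (dvg_lt _ (bounded_cvg (ltW L0) Lx bd)); rewrite ReD /= /x; lra.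
- by move=> U _ U0; rewrite setD0.
- apply: (@star_connected R _ (1 - ln rho)%:C) => z t.
  have DE y : sublevel (fun z => expR (- Re z)) rho y = (- Re y < ln rho).
    by rewrite /sublevel /= {1}rE0 ltr_expR.
  rewrite !DE => h /andP[t0 t1].
  rewrite ReD ReRM ReD ReN /=.
  have h1 : 0 <= t * (Re z + ln rho) by rewrite mulr_ge0//; lra.
  have [t1'|t1'] := eqVneq t 1; first by rewrite t1'; lra.
  have : t < 1 by rewrite lt_neqAle t1'.
  by lra.
- move=> c Hc; apply: (@nonconstant (- ln rho) _ c).
    by exists (- ln rho - 1)%:C; apply: dvg_lt; rewrite /= ltrBlDr ltrDl.
  by move=> z hz; apply: Hc; rewrite /sublevel /= {1}rE0 ltr_expR ltrNl.
- by exists (- ln rho)%:C; rewrite /= opprK lnK ?posrE.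
Qed.

End DirichletSeries.

Lemma dirichlet_theorem {R : realType} (lam : nat -> R) (a : nat -> R[i]) (rho : R) :
  0 < rho -> well_posed (Dirichlet lam) a -> is_rho (Dirichlet lam) a rho%:E ->
  growth_conclusion (sections (Dirichlet lam) a) lam (fun z => expR (- complex.Re z)) rho set0.
Proof.
move=> r0 [lam_incr [sa [sa_abs sa_fin]]] [sc [sc_abs scE]].
have {}scE : sc = (- ln rho)%:E.
  move: scE; rewrite inver gt_eqF//; case: sc {sc_abs} => [s|//|] /=.
    by move=> [/(congr1 (@ln R))]; rewrite expRK lnV ?posrE// => ->.
  by move=> [/eqP]; rewrite gt_eqF// invr_gt0.
have [x0 sx0] : exists x0 : R, (sa < x0%:E)%E.
  case: sa sa_fin {sa_abs} => [s _|//|_]; last by exists 0; rewrite ltNye.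
  by exists (s + 1); rewrite lte_fin ltrDl.
(* Absolute convergence at one real point right of sigma_a gives the bounded sums required by
   [half_plane_theorem]. *)
have [A _ HA] := cvgc_bounded ((sa_abs x0%:C).1 sx0).
apply: (half_plane_theorem lam_incr (x0 := x0) (A := A) _ r0) => //.
- move=> n; have := HA n; rewrite /sections /=.
  under eq_bigr => k _ do rewrite normr_normc -rmorphN -rmorphM/= cexp_real -rmorphM/=.
  rewrite -rmorph_sum normcR; apply: le_trans; exact: ler_norm.
- by move=> z hz; apply: (sc_abs z).1; rewrite scE lte_fin.
- by move=> z hz; apply: (sc_abs z).2; rewrite scE lte_fin.
Qed.

Lemma growth_conclusion_subset {R : realType} (f : nat -> R[i] -> R[i]) (lam : nat -> R)
    (w : R[i] -> R) (rho : R) (S S' : set R[i]) : S `<=` S' ->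
  growth_conclusion f lam w rho S -> growth_conclusion f lam w rho S'.
Proof.
move=> SS' [? [? [? [? [H ?]]]]]; do 4![split=> //]; split=> // z h nS.
by apply: H => // /SS'.
Qed.

Theorem theorem3 (R : realType) (t : series_type R) (a : nat -> R[i])
    (rho : R) :
  well_posed t a -> is_rho t a rho%:E -> 0 < rho ->
  let lam := exponents t in
  let w := height t in
  let f := sections t a in
  let D := sublevel w rho in
  let mu := growth_function f lam in
  proper_height w /\
  admissible_exponents f lam /\
  convergence_level f w = rho%:E /\
  (exists g : R[i] -> R[i],
     [/\ compact_cvg f D g, is_holomorphic D g & ~ is_constant D g]) /\
  (forall z : R[i],
     ~ ((fun n => f n z) @ \oo --> (0 : R[i]) /\ w z <= rho) ->
     ~ (t = Kapteyn /\ realS z) ->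
     mu z = maxe 1%E (rho^-1 * w z)%:E) /\
  [set z | rho < w z] `<=` [set z | (1 < mu z)%E] `|` [set z | w z = 1] /\
  (forall z, boundary D z -> zero_cluster_point f z) /\
  open D /\ pointwise_cvg f D /\
  (forall U : set R[i], open U -> pointwise_cvg f U -> U `<=` D).
Proof.
move=> wp hrho rho0.
suff : growth_conclusion (sections t a) (exponents t) (height t) rho
  [set z | t = Kapteyn /\ realS z] by [].
case: t wp hrho => [lam||| ] wp hrho.
- exact: growth_conclusion_subset (dirichlet_theorem rho0 wp hrho).
- exact: growth_conclusion_subset (power_theorem rho0 hrho).
- exact: growth_conclusion_subset (neumann_theorem rho0 hrho).
by apply: growth_conclusion_subset (kapteyn_theorem rho0 hrho) => z.
Qed.
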